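(* Let $W\subset GL(V)$ be a duality complex reflection group. Let $R$ be the $S^W$-subalgebra of $(S\otimes\wedge V^* )^W$ generated by $df_1,\ldots,df_{\ell-1}$, i.e. $R=\bigwedge_{S^W}\{df_1,\ldots,df_{\ell-1}\}$ (only $df_\ell$ is omitted). Then $(S\otimes\wedge V^*\otimes V)^W$ is a free $R$-module with basis the $2\ell$ elements $\theta_1,\ldots,\theta_\ell,\,d\theta_1,\ldots,d\theta_\ell$. Equivalently, for each $0\le m\le\ell$, $(S\otimes\wedge^m V^*\otimes V)^W$ is a free $S^W$-module with basis $$\{df_I\,\theta_k: I\subseteq\{1,\ldots,\ell-1\},\ |I|=m,\ k\in[\ell]\}\ \sqcup\ \{df_I\,d\theta_k: I\subseteq\{1,\ldots,\ell-1\},\ |I|=m-1,\ k\in[\ell]\}.$$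
   Context: Let $V=\mathbb{C}^\ell$ and let $W\subset GL(V)$ be a finite group generated by reflections (non-identity linear maps fixing a hyperplane pointwise). Fix a basis $x_1,\ldots,x_\ell$ of $V^*$ with dual basis $y_1,\ldots,y_\ell$ of $V$; let $S=\mathrm{Sym}(V^* )=\mathbb{C}[x_1,\ldots,x_\ell]$, graded by polynomial degree, with $W$ acting by linear substitutions, and let $W$ act diagonally on all tensor products (over $\mathbb{C}$). Then $S^W=\mathbb{C}[f_1,\ldots,f_\ell]$ for algebraically independent homogeneous basic invariants, indexed so $\deg f_1\le\cdots\le\deg f_\ell$; the exponents are $e_i=\deg f_i-1$. The module $(S\otimes V)^W$ is a free $S^W$-module of rank $\ell$; fix a basis of basic derivations $\theta_k=\sum_i\theta_k^{(i)}\otimes y_i$ with all $\theta_k^{(i)}$ homogeneous of a common degree $e_k^*$ (the coexponents). Write $dx_i=1\otimes x_i\in S\otimes\wedge V^*$ and $df=\sum_i \frac{\partial f}{\partial x_i}\otimes x_i$ for $f\in S$; $S\otimes\wedge V^*$ is an algebra (product in $S$ and wedge in $\wedge V^*$), and $S\otimes\wedge V^*\otimes V$ is a module over it by multiplication in the first two tensor factors. Identify $S\otimes V$ with its image under $f\otimes y\mapsto f\otimes 1\otimes y$, and extend $d$ by $d(f\otimes\omega\otimes y)=\sum_i\frac{\partial f}{\partial x_i}\otimes(x_i\wedge\omega)\otimes y$. For $I=\{i_1<\cdots<i_m\}$, $df_I=df_{i_1}\wedge\cdots\wedge df_{i_m}$ ($df_\emptyset=1$), and $[\ell]=\{1,\ldots,\ell\}$.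 $W$ is a duality group if it is irreducible and, with exponents ordered $e_1\le\cdots\le e_\ell$ and coexponents ordered $e_1^*\ge\cdots\ge e_\ell^*$, one has $e_i+e_i^*=\deg f_\ell$ for all $i$. *)

(* Defs.v *)
From HB Require Import structures.
From mathcomp Require Export all_boot all_order all_algebra all_fingroup.
From mathcomp Require Export mxrepresentation.
From mathcomp Require Export reals complex.
From mathcomp Require Export mpoly.

Set Implicit Arguments.
Unset Strict Implicit.
Unset Printing Implicit Defensive.

From mathcomp Require Import ring.

Import GRing.Theory.
Local Open Scope ring_scope.
Local Open Scope complex_scope.

(* V is the space of row vectors 'rV[R[i]]_l. A matrix A acts on it by        *)
(* v |-> v *m A, the convention of mx_representation. The basis y_k of V is   *)
(* the standard one and x_i is the i-th coordinate, so that S = Sym(V^* ) is  *)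
(* the ring of polynomials in the 'X_i.                                       *)
Notation Spoly R l := {mpoly R[i][l]}.

(* S (x) V: theta k is the coefficient of y_k. The regular module structure   *)
(* S^o makes p *: theta the multiplication by p : S, coefficient by           *)
(* coefficient; likewise for the two types below.                             *)
Notation derivation R l := {ffun 'I_l -> (Spoly R l)^o}.

(* S (x) /\V^*: a I is the coefficient of x_I = x_{i_1} /\ ... /\ x_{i_m},    *)
(* where I = {i_1 < ... < i_m}.                                               *)
Notation form R l := {ffun {set 'I_l} -> (Spoly R l)^o}.

(* S (x) /\V^* (x) V: eta k is the coefficient of y_k.                        *)
Notation dform R l := {ffun 'I_l -> form R l}.

Section Free.
Variables (A M : zmodType) (scale : A -> M -> M).

(* The family (b i)_{i | D i} is a basis of the free module N over the        *)
(* subring P of A, inside a module M with scalar action [scale].              *)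
Definition is_free_basis (P : A -> Prop) (N : M -> Prop)
    (I : finType) (D : pred I) (b : I -> M) : Prop :=
  (forall m, N m <->
     exists c : I -> A,
       (forall i, D i -> P (c i)) /\ m = \sum_(i | D i) scale (c i) (b i))
  /\ (forall c : I -> A, (forall i, D i -> P (c i)) ->
        \sum_(i | D i) scale (c i) (b i) = 0 -> forall i, D i -> c i = 0).

End Free.

Section Exterior.
Variables (R : realType) (l : nat).
Local Notation S := (Spoly R l).
Local Notation form := (form R l).
Local Notation dform := (dform R l).

Definition ext_basis (I : {set 'I_l}) : form := [ffun J => (J == I)%:R].

Definition ext_one : form := ext_basis set0.

Definition dx (i : 'I_l) : form := ext_basis [set i].

Definition inversions (I J : {set 'I_l}) : nat :=
  #|[set p in setX I J | (p.2 < p.1)%N]|.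

(* For disjoint I and J, x_I /\ x_J = (-1)^(inversions I J) x_{I u J}; the    *)
(* product vanishes when I and J meet.                                        *)
Definition wedge (a b : form) : form :=
  [ffun K : {set 'I_l} => \sum_(I : {set 'I_l} | I \subset K)
     (-1) ^+ inversions I (K :\: I) * a I * b (K :\: I)].

Lemma inversionsUl (I J K : {set 'I_l}) : [disjoint I & J] ->
  inversions (I :|: J) K = (inversions I K + inversions J K)%N.
Proof.
move=> dIJ; rewrite /inversions -cardsUI [X in (_ + X)%N](_ : _ = 0%N) ?addn0.
  by apply: eq_card => p; rewrite !inE; case: (p.1 \in I); case: (p.1 \in J);
    case: (p.2 \in K); case: (_ < _)%N.
apply/eqP; rewrite cards_eq0; apply/eqP/setP => p; rewrite !inE.
case: (boolP (p.1 \in I)) => //= h.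
by rewrite (disjointFr dIJ h) andbF.
Qed.

Lemma inversionsUr (I J K : {set 'I_l}) : [disjoint J & K] ->
  inversions I (J :|: K) = (inversions I J + inversions I K)%N.
Proof.
move=> dJK; rewrite /inversions -cardsUI [X in (_ + X)%N](_ : _ = 0%N) ?addn0.
  by apply: eq_card => p; rewrite !inE; case: (p.1 \in I); case: (p.2 \in J);
    case: (p.2 \in K); case: (_ < _)%N.
apply/eqP; rewrite cards_eq0; apply/eqP/setP => p; rewrite !inE.
case: (boolP (p.2 \in J)) => //= h; last by rewrite andbF.
by rewrite (disjointFr dJK h) !andbF.
Qed.

Lemma inversions0l (I : {set 'I_l}) : inversions set0 I = 0%N.
Proof. by apply/eqP; rewrite cards_eq0; apply/eqP/setP => p; rewrite !inE. Qed.

Lemma inversions0r (I : {set 'I_l}) : inversions I set0 = 0%N.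
Proof.
by apply/eqP; rewrite cards_eq0; apply/eqP/setP => p; rewrite !inE andbF.
Qed.

Lemma wedge1l : left_id ext_one wedge.
Proof.
move=> a; apply/ffunP => K; rewrite ffunE (bigD1 set0) ?sub0set //=.
rewrite big1 => [|I /andP[_ /negPf h]].
  by rewrite ffunE eqxx setD0 inversions0l mul1r mul1r addr0.
by rewrite ffunE h mulr0 mul0r.
Qed.

Lemma wedge1r : right_id ext_one wedge.
Proof.
move=> a; apply/ffunP => K; rewrite ffunE (bigD1 K) //=.
rewrite big1 => [|I /andP[s h]].
  by rewrite ffunE setDv eqxx inversions0r mul1r mulr1 addr0.
rewrite ffunE setD_eq0; case: (boolP (K \subset I)) => h'; rewrite ?mulr0 //.
by case/negP: h; rewrite eqEsubset s h'.
Qed.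

Lemma wedgeA : associative wedge.
Proof.
move=> a b c; apply/ffunP => K; rewrite !ffunE.
transitivity (\sum_(I : {set 'I_l} | I \subset K)
    \sum_(J : {set 'I_l} | J \subset I)
      ((-1) ^+ inversions I (K :\: I) * (-1) ^+ inversions J (I :\: J)
         * a J * b (I :\: J) * c (K :\: I) : S)); last first.
  apply: eq_bigr => I _; rewrite ffunE mulr_sumr mulr_suml.
  apply: eq_bigr => J _.
  by rewrite !mulrA.
rewrite (exchange_big_dep (fun J : {set 'I_l} => J \subset K)) /=; last first.
  by move=> I J h h'; apply: subset_trans h.
apply: eq_bigr => J sJ; rewrite ffunE mulr_sumr; symmetry.
rewrite (reindex_onto (fun L => J :|: L)
           (fun I : {set 'I_l} => I :\: J)) /=; last first.
  move=> I /andP[_ s]; apply/setP=> x; rewrite !inE.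
  by case: (boolP (x \in J)) => // /(subsetP s).
have E L : (J :|: L \subset K) && (J \subset J :|: L)
    && ((J :|: L) :\: J == L) = (L \subset K :\: J).
  rewrite subsetUl andbT subUset sJ /= subsetD; apply: andb_id2l => _.
  rewrite setDUl setDv set0U; apply/eqP/idP => [<-|h].
    by rewrite disjoints_subset; apply/subsetP=> x; rewrite !inE => /andP[].
  by apply/setDidPl.
apply: eq_big => [L|L]; rewrite E // subsetD => /andP[sLK dLJ].
have -> : (J :|: L) :\: J = L by rewrite setDUl setDv set0U; apply/setDidPl.
have -> : K :\: (J :|: L) = (K :\: J) :\: L by rewrite setDDl.
rewrite inversionsUl 1?disjoint_sym //.
set M := (K :\: J) :\: L.
have eKJ : K :\: J = L :|: M.
  apply/setP=> x; rewrite /M !inE; case: (boolP (x \in L)) => //= xL.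
  by rewrite (disjointFr dLJ xL) (subsetP sLK).
have dLM : [disjoint L & M].
  by rewrite disjoints_subset; apply/subsetP=> x; rewrite !inE => ->.
rewrite [in inversions J (K :\: J)]eKJ inversionsUr // !exprD.
by ring.
Qed.

HB.instance Definition _ :=
  Monoid.isLaw.Build form ext_one wedge wedgeA wedge1l wedge1r.

Definition wedge_dform (a : form) (eta : dform) : dform :=
  [ffun k => wedge a (eta k)].

(* index_enum 'I_l is increasing, so this is w_{i_1} /\ ... /\ w_{i_m} for    *)
(* I = {i_1 < ... < i_m}.                                                     *)
Definition wedge_set (w : 'I_l -> form) (I : {set 'I_l}) : form :=
  \big[wedge/ext_one]_(i in I) w i.

Definition der_dform (theta : derivation R l) : dform :=
  [ffun k => theta k *: ext_one].

Definition diff (f : S) : form := \sum_i f^`M(i) *: dx i.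

Definition diff_dform (eta : dform) : dform :=
  [ffun k => \sum_(I : {set 'I_l}) \sum_i
     (eta k I : S)^`M(i) *: wedge (dx i) (ext_basis I)].

(* The form-degree m part S (x) /\^m V^* (x) V.                               *)
Definition dform_degree (m : nat) (eta : dform) : Prop :=
  forall k (I : {set 'I_l}), #|I| != m -> eta k I = 0.

(* The S^W-subalgebra generated by X, with SW the set of scalars S^W.         *)
Inductive subalgebra (SW : S -> Prop) (X : form -> Prop) : form -> Prop :=
| subalgebra_scalar p : SW p -> subalgebra SW X (p *: ext_one)
| subalgebra_gen a : X a -> subalgebra SW X a
| subalgebra_add a b :
    subalgebra SW X a -> subalgebra SW X b -> subalgebra SW X (a + b)
| subalgebra_mul a b :
    subalgebra SW X a -> subalgebra SW X b -> subalgebra SW X (wedge a b).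

(* A linear map A of V acts on V^* by x |-> x \o A^-1; in coordinates         *)
(* x_i |-> \sum_j (A^-1)_{ji} x_j. On V it maps y_k to \sum_j A_{kj} y_j.     *)
Definition act_poly (A : 'M[R[i]]_l) (p : S) : S :=
  p \mPo [tuple \sum_j invmx A j i *: 'X_j | i < l].

Definition act_dx (A : 'M[R[i]]_l) (i : 'I_l) : form :=
  \sum_j (invmx A j i)%:MP *: dx j.

Definition act_form (A : 'M[R[i]]_l) (a : form) : form :=
  \sum_(I : {set 'I_l}) act_poly A (a I) *: wedge_set (act_dx A) I.

Definition act_der (A : 'M[R[i]]_l) (theta : derivation R l) :
    derivation R l :=
  [ffun j => \sum_k (A k j)%:MP * act_poly A (theta k)].

Definition act_dform (A : 'M[R[i]]_l) (eta : dform) : dform :=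
  [ffun j => \sum_k (A k j)%:MP *: act_form A (eta k)].

End Exterior.

Section ReflectionGroups.
Variables (R : realType) (l : nat).

Definition is_reflection (A : 'M[R[i]]_l) : Prop :=
  A != 1%:M /\
  exists H : 'M[R[i]]_l,
    \rank H = l.-1 /\ forall v : 'rV[R[i]]_l, (v <= H)%MS -> v *m A = v.

Variables (gT : finGroupType) (G : {group gT}).

(* A finite subgroup W of GL(V) is given as the image of a faithful           *)
(* representation of a finite group.                                          *)
Variable rG : mx_representation R[i] G l.

Definition reflection_group : Prop :=
  mx_faithful rG /\
  exists T : {set gT},
    (forall t, t \in T -> is_reflection (rG t)) /\ <<T>>%g = G.

Definition inv_poly (p : Spoly R l) : Prop :=
  forall g, g \in G -> act_poly (rG g) p = p.

Definition inv_der (theta : derivation R l) : Prop :=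
  forall g, g \in G -> act_der (rG g) theta = theta.

Definition inv_dform (eta : dform R l) : Prop :=
  forall g, g \in G -> act_dform (rG g) eta = eta.

Definition mpdeg (p : Spoly R l) : nat := (msize p).-1.

Definition basic_invariants (f : l.-tuple (Spoly R l)) : Prop :=
  [/\ forall i, tnth f i \is (mpdeg (tnth f i)).-homog,
      forall i j : 'I_l, (i <= j)%N -> (mpdeg (tnth f i) <= mpdeg (tnth f j))%N,
      forall q : Spoly R l, q \mPo f = 0 -> q = 0
    & forall p, inv_poly p <-> exists q : Spoly R l, p = q \mPo f].

Definition exponent (f : l.-tuple (Spoly R l)) (i : 'I_l) : nat :=
  (mpdeg (tnth f i)).-1.

(* [coexp k] is the common degree of the coefficients of [theta k].           *)
Definition basic_derivations (theta : 'I_l -> derivation R l)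
    (coexp : 'I_l -> nat) : Prop :=
  is_free_basis *:%R inv_poly inv_der predT theta /\
  forall k i, (theta k i : Spoly R l) \is (coexp k).-homog.

End ReflectionGroups.

(* Since l >= 1 is forced by irreducibility, the dimension is n.+1 and the    *)
(* last invariant has index ord_max. The exponents are increasing by          *)
(* basic_invariants; the coexponents have to be sorted in decreasing order.   *)
Definition duality_group (R : realType) (n : nat) (gT : finGroupType)
    (G : {group gT}) (rG : mx_representation R[i] G n.+1)
    (f : n.+1.-tuple (Spoly R n.+1)) (coexp : 'I_n.+1 -> nat) : Prop :=
  mx_irreducible rG /\
  forall i : 'I_n.+1,
    (exponent f i + nth 0%N (sort geq (codom coexp)) i)%N
    = mpdeg (tnth f ord_max).

Section Bases.
Variables (R : realType) (n : nat).
Variables (f : n.+1.-tuple (Spoly R n.+1)).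
Variables (theta : 'I_n.+1 -> derivation R n.+1).

Definition df (i : 'I_n.+1) : form R n.+1 := diff (tnth f i).

Definition df_set : {set 'I_n.+1} -> form R n.+1 := wedge_set df.

(* The algebra generators df_i, with only the last one omitted.               *)
Definition df_butlast (a : form R n.+1) : Prop :=
  exists2 i : 'I_n.+1, i != ord_max & a = df i.

(* theta_1, ..., theta_l, d theta_1, ..., d theta_l                           *)
Definition theta_dtheta (k : 'I_n.+1 + 'I_n.+1) : dform R n.+1 :=
  match k with
  | inl k => der_dform (theta k)
  | inr k => diff_dform (der_dform (theta k))
  end.

(* The elements df_I theta_k (inl) and df_I d theta_k (inr), of which         *)
(* [in_degree m] selects those of form-degree m with l not in I.              *)
Definition df_theta (Ik : {set 'I_n.+1} * ('I_n.+1 + 'I_n.+1)) :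
    dform R n.+1 :=
  wedge_dform (df_set Ik.1) (theta_dtheta Ik.2).

Definition in_degree (m : nat) (Ik : {set 'I_n.+1} * ('I_n.+1 + 'I_n.+1)) :
    bool :=
  (ord_max \notin Ik.1) &&
  match Ik.2 with inl _ => #|Ik.1| == m | inr _ => #|Ik.1|.+1 == m end.

End Bases.

(* Main.v *)
Require Import Defs.
From mathcomp Require Import ring zify cyclic cyclotomic separable.
From Stdlib Require Import Classical.

(* Pair an invariant element eta of S (x) /\V^* (x) V with the df_j and with the
   Hessians of the f_j, then multiply by df_K for K avoiding the last index. The
   results are invariant forms; their top coefficients are anti-invariants,
   hence multiples of the Jacobian by invariants. This expresses eta through the
   df_I d(theta_k) and the df_I theta_k, up to two square matrices B and C over
   S^W which record the same pairings of the d(theta_k) and the theta_k. The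
   duality relation makes det B and det C invariants of degree 0, that is,
   constants, and it remains to see that they are nonzero.
   Evaluate them at a point v where f_1, ..., f_(l-1) vanish and f_l = 1. There
   the vector field d/df_l is proportional to the Euler field, so that B and C
   factor through the values at v of the theta_k and of the Jacobian matrix.
   Both are invertible: averaging over W and over homotheties by roots of unity
   of order deg f_l produces an invariant derivation vanishing at v with the
   identity as its linear part, and writing it in the basis theta_k inverts
   the matrix of the theta_k(v); hence v has trivial stabilizer. *)

Set Implicit Arguments.
Unset Strict Implicit.
Unset Printing Implicit Defensive.

Import GRing.Theory Num.Theory.
Local Open Scope ring_scope.
Local Open Scope complex_scope.

(** * Exterior algebra *)

Lemma set_min_ind (l : nat) (P : {set 'I_l} -> Prop) :
  P set0 ->
  (forall (i : 'I_l) (I : {set 'I_l}),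
     (forall j, j \in I -> (i < j)%N) -> P I -> P (i |: I)) ->
  forall I, P I.
Proof.
move=> P0 PU I; have [m] := ubnP #|I|; elim: m I => // m IHm I.
have [->|/set0Pn[i0 i0I]] := eqVneq I set0; first by [].
case: (arg_minnP (fun i : 'I_l => i : nat) i0I) => i iI imin cI.
rewrite -(setD1K iI); apply: PU.
  move=> j /setD1P[ji jI]; rewrite ltn_neqAle imin // andbT.
  by apply: contra_neq ji => /val_inj.
have iI' : i \in I by [].
by apply: IHm; move: cI; rewrite (cardsD1 i I) iI'.
Qed.

Lemma sum_antisym (V : zmodType) (l : nat) (F : 'I_l -> 'I_l -> V) :
  (forall i, F i i = 0) -> (forall i j, F i j = - F j i) ->
  \sum_i \sum_j F i j = 0.
Proof.
move=> F0 FN.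
rewrite (eq_bigr (fun i : 'I_l => \sum_(j : 'I_l | (i < j)%N) F i j
                         + \sum_(j : 'I_l | ~~ (i < j)%N) F i j)) => [|i _]; last first.
  exact: bigID.
rewrite big_split /= [X in _ + X](exchange_big_dep xpredT) //= -big_split big1 //=.
move=> i _; rewrite [X in _ + X](bigID (fun j => j == i)) /= big_andbC.
rewrite [X in _ + (X + _)](big_pred1 i) => [|j]; last first.
  by rewrite /=; have [->|_] := eqVneq j i; rewrite ?ltnn ?andbF.
rewrite F0 add0r [X in _ + X](eq_big (fun j : 'I_l => (i < j)%N) (fun j => - F i j)).
- by rewrite sumrN subrr.
- by move=> j; rewrite -leqNgt andbC ltn_neqAle eq_sym.
- by move=> j _; apply: FN.
Qed.

Section Exterior.
Variables (S : idomainType) (l : nat).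
Local Notation form := {ffun {set 'I_l} -> S^o}.

(* The operations of Defs.v over an arbitrary domain of scalars. *)
Definition ebasis (I : {set 'I_l}) : form := [ffun J => (J == I)%:R].

Definition eone : form := ebasis set0.

Definition edx (i : 'I_l) : form := ebasis [set i].

Definition ewedge (a b : form) : form :=
  [ffun K : {set 'I_l} => \sum_(I : {set 'I_l} | I \subset K)
     (-1) ^+ inversions I (K :\: I) * a I * b (K :\: I)].

Definition ewedge_set (w : 'I_l -> form) (I : {set 'I_l}) : form :=
  \big[ewedge/eone]_(i in I) w i.

Implicit Types (a b c : form) (w z : 'I_l -> form) (I J K : {set 'I_l}).
Implicit Types (p q : S) (i j : 'I_l).

Lemma ebasisE I J : ebasis I J = (J == I)%:R.
Proof. by rewrite ffunE. Qed.

Lemma ewedgeDl a b c : ewedge (a + b) c = ewedge a c + ewedge b c.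
Proof.
apply/ffunP=> K; rewrite !ffunE -big_split; apply: eq_bigr => I _ /=.
by rewrite ffunE; ring.
Qed.

Lemma ewedgeDr a b c : ewedge a (b + c) = ewedge a b + ewedge a c.
Proof.
apply/ffunP=> K; rewrite !ffunE -big_split; apply: eq_bigr => I _ /=.
by rewrite ffunE; ring.
Qed.

Lemma formZE p a I : (p *: a) I = p * a I :> S.
Proof. by rewrite ffunE. Qed.

Lemma ewedgeZl p a b : ewedge (p *: a) b = p *: ewedge a b.
Proof.
apply/ffunP=> K; rewrite formZE !ffunE mulr_sumr; apply: eq_bigr => I _ /=.
by rewrite formZE; ring.
Qed.

Lemma ewedgeZr p a b : ewedge a (p *: b) = p *: ewedge a b.
Proof.
apply/ffunP=> K; rewrite formZE !ffunE mulr_sumr; apply: eq_bigr => I _ /=.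
by rewrite formZE; ring.
Qed.

Lemma ewedge0l a : ewedge 0 a = 0.
Proof. by have := ewedgeZl 0 0 a; rewrite !scale0r. Qed.

Lemma ewedge0r a : ewedge a 0 = 0.
Proof. by have := ewedgeZr 0 a 0; rewrite !scale0r. Qed.

Lemma ewedgeNl a b : ewedge (- a) b = - ewedge a b.
Proof. by rewrite -scaleN1r ewedgeZl scaleN1r. Qed.

Lemma ewedgeNr a b : ewedge a (- b) = - ewedge a b.
Proof. by rewrite -scaleN1r ewedgeZr scaleN1r. Qed.

Lemma ewedge_suml (T : Type) (r : seq T) (P : pred T) (F : T -> form) b :
  ewedge (\sum_(i <- r | P i) F i) b = \sum_(i <- r | P i) ewedge (F i) b.
Proof.
by rewrite (big_morph (fun x => ewedge x b) (fun x y => ewedgeDl x y b) (ewedge0l b)).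
Qed.

Lemma ewedge_sumr (T : Type) (r : seq T) (P : pred T) (F : T -> form) a :
  ewedge a (\sum_(i <- r | P i) F i) = \sum_(i <- r | P i) ewedge a (F i).
Proof. by rewrite (big_morph (ewedge a) (ewedgeDr a) (ewedge0r a)). Qed.

Lemma form_expand a : a = \sum_(I : {set 'I_l}) a I *: ebasis I.
Proof.
apply/ffunP=> K; rewrite sum_ffunE (bigD1 K) //= big1 => [|I IK].
  by rewrite formZE ffunE eqxx mulr1 addr0.
by rewrite formZE ffunE eq_sym (negPf IK) mulr0.
Qed.

Lemma ewedge_ebasis I J :
  ewedge (ebasis I) (ebasis J) =
  if [disjoint I & J] then (-1) ^+ inversions I J *: ebasis (I :|: J)
  else 0.
Proof.
apply/ffunP=> K; rewrite ffunE.
have [IK|IK] := boolP (I \subset K); last first.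
  rewrite big1 => [|I' I'K]; last first.
    rewrite ffunE; case: eqP => [E|]; last by rewrite mulr0 mul0r.
    by rewrite -E I'K in IK.
  case: ifP => _; rewrite ffunE // ffunE; case: eqP => [E|]; last by rewrite scaler0.
  by rewrite E subsetUl in IK.
rewrite (bigD1 I) //= big1 => [|I' /andP[_ /negPf I'I]]; last first.
  by rewrite ffunE I'I mulr0 mul0r.
rewrite !ffunE eqxx addr0 mulr1.
case: ifP => [dIJ|dIJ]; last first.
  rewrite ffunE; case: eqP => [E|]; last by rewrite mulr0.
  by move/negP: dIJ; case; rewrite -E disjoint_sym disjoints_subset; apply/subsetP=> x; rewrite !inE => /andP[].
rewrite formZE ffunE.
have -> : (K :\: I == J) = (K == I :|: J).
  apply/eqP/eqP => [<-|->].
    apply/setP=> x; rewrite !inE; case: (boolP (x \in I)) => //= /(subsetP IK) //.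
  rewrite setDUl setDv set0U; apply/setDidPl; by rewrite disjoint_sym.
by case: eqP => [->|]; rewrite ?mulr0 // setDUl setDv set0U (setDidPl _) // disjoint_sym.
Qed.

Lemma ewedge1l : left_id eone ewedge.
Proof.
move=> a; rewrite [a in LHS]form_expand ewedge_sumr [RHS]form_expand.
apply: eq_bigr => I _; rewrite ewedgeZr ewedge_ebasis disjoints_subset sub0set.
by rewrite inversions0l scale1r set0U.
Qed.

Lemma ewedge1r : right_id eone ewedge.
Proof.
move=> a; rewrite [a in LHS]form_expand ewedge_suml [RHS]form_expand.
apply: eq_bigr => I _; rewrite ewedgeZl ewedge_ebasis disjoint_sym.
by rewrite disjoints_subset sub0set inversions0r scale1r setU0.
Qed.

Lemma ewedgeA : associative ewedge.
Proof.
move=> a b c; rewrite [a]form_expand [b]form_expand [c]form_expand.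
rewrite !ewedge_suml; apply: eq_bigr => I _.
rewrite ewedge_sumr [X in _ = ewedge X _]ewedge_sumr [RHS]ewedge_suml; apply: eq_bigr => J _.
rewrite !ewedge_sumr; apply: eq_bigr => K _.
rewrite !(ewedgeZl, ewedgeZr) !scalerA; congr (_ *: _); first by ring.
rewrite !ewedge_ebasis.
have [dJK|dJK] := boolP [disjoint J & K]; have [dIJ|dIJ] := boolP [disjoint I & J].
- rewrite ewedgeZl ewedgeZr !ewedge_ebasis -!setI_eq0 setIUl setIUr !setU_eq0.
  rewrite !setI_eq0 dJK dIJ andbT /=.
  have [dIK|_] := boolP [disjoint I & K]; last by rewrite !scaler0.
  rewrite !scalerA -!exprD setUA inversionsUl // inversionsUr //.
  by congr (_ ^+ _ *: _); rewrite addnC -addnA.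
- rewrite ewedge0l ewedgeZr ewedge_ebasis -setI_eq0 setIUr setU_eq0 !setI_eq0.
  by rewrite (negPf dIJ) scaler0.
- rewrite ewedge0r ewedgeZl ewedge_ebasis -setI_eq0 setIUl setU_eq0 !setI_eq0.
  by rewrite (negPf dJK) andbF scaler0.
- by rewrite ewedge0l ewedge0r.
Qed.

Definition lincomb w (u : 'I_l -> S) : form := \sum_i u i *: w i.

Definition is_oneform a := exists u, a = lincomb (edx) u.

Lemma lincombZ p w u : p *: lincomb w u = lincomb w (fun i => p * u i).
Proof.
by rewrite /lincomb scaler_sumr; apply: eq_bigr => i _; rewrite scalerA.
Qed.

Lemma lincombD w u v : lincomb w u + lincomb w v = lincomb w (fun i => u i + v i).
Proof.
by rewrite /lincomb -big_split; apply: eq_bigr => i _; rewrite scalerDl.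
Qed.

Lemma lincomb1 w i : w i = lincomb w (fun j => (j == i)%:R).
Proof.
rewrite /lincomb (bigD1 i) //= eqxx scale1r big1 ?addr0 //.
by move=> j /negPf ->; rewrite scale0r.
Qed.

Lemma ewedge_dx2 i j : ewedge (edx i) (edx j) = - ewedge (edx j) (edx i).
Proof.
rewrite !ewedge_ebasis disjoint_sym setUC.
have [dij|_] := boolP [disjoint _ & _]; last by rewrite oppr0.
have ij : i != j by apply: contraTneq dij => ->; rewrite disjoints1 inE eqxx.
have E (x y : 'I_l) : inversions [set x] [set y] = (y < x)%N.
  rewrite /inversions; case: ltnP => yx.
    have -> : [set p in setX [set x] [set y] | (p.2 < p.1)%N] = [set (x, y)].
      apply/setP=> -[s t]; rewrite !inE /= xpair_eqE.
      by case: eqP => //= ->; case: eqP => //= ->; rewrite yx.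
    by rewrite cards1.
  apply/eqP; rewrite cards_eq0; apply/eqP/setP=> -[s t]; rewrite !inE /=.
  by case: eqP => //= ->; case: eqP => //= ->; rewrite ltnNge yx.
rewrite !E -scaleNr; congr (_ *: _).
have nij : (i : nat) != j by [].
by case: (ltngtP i j) nij => // _ _; rewrite ?expr0 ?expr1 ?opprK.
Qed.

Lemma ewedge_dx_sqr i : ewedge (edx i) (edx i) = 0.
Proof. by rewrite ewedge_ebasis disjoints1 inE eqxx. Qed.

Lemma ewedge_lincomb w z (u v : 'I_l -> S) :
  ewedge (lincomb w u) (lincomb z v) =
  \sum_i \sum_j (u i * v j) *: ewedge (w i) (z j).
Proof.
rewrite /lincomb ewedge_suml; apply: eq_bigr => i _; rewrite ewedge_sumr.
by apply: eq_bigr => j _; rewrite ewedgeZl ewedgeZr scalerA.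
Qed.

Lemma ewedge_oneformC a b :
  is_oneform a -> is_oneform b -> ewedge a b = - ewedge b a.
Proof.
move=> [u ->] [v ->]; rewrite [LHS]ewedge_lincomb [in RHS]ewedge_lincomb.
rewrite [LHS]exchange_big -[RHS]sumrN; apply: eq_bigr => i _.
rewrite -[RHS]sumrN; apply: eq_bigr => j _.
by rewrite (ewedge_dx2 j i) mulrC scalerN.
Qed.

Lemma ewedge_oneform_sqr a : is_oneform a -> ewedge a a = 0.
Proof.
move=> [u ->]; rewrite ewedge_lincomb; apply: sum_antisym => i.
  by rewrite ewedge_dx_sqr scaler0.
by move=> j; rewrite (ewedge_dx2 i j) scalerN mulrC.
Qed.

(* The lowest index comes first in [ewedge_set], so adding an index below    *)
(* those of [I] multiplies on the left.                                      *)
Lemma ewedge_setU1 w i I : (forall j, j \in I -> (i < j)%N) ->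
  ewedge_set w (i |: I) = ewedge (w i) (ewedge_set w I).
Proof.
move=> hi; rewrite /ewedge_set -[LHS]big_filter -[X in ewedge _ X]big_filter.
have E : [seq j <- index_enum 'I_l | j \in i |: I]
       = i :: [seq j <- index_enum 'I_l | j \in I].
  have tr : transitive (fun j k : 'I_l => (j < k)%N).
    by move=> x y z'; apply: ltn_trans.
  have srt (P : pred 'I_l) :
      sorted (fun j k : 'I_l => (j < k)%N) [seq j <- index_enum 'I_l | P j].
    apply: sorted_filter => //; rewrite /index_enum -enumT.
    by have := iota_ltn_sorted 0 l; rewrite -val_enum_ord sorted_map.
  apply: (irr_sorted_eq tr); first by move=> x; apply: ltnn.
  - exact: srt.
  - rewrite /= path_min_sorted; first exact: srt.
    by apply/allP=> j; rewrite mem_filter => /andP[/hi].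
  - by move=> j; rewrite inE !mem_filter !inE mem_index_enum !andbT.
by rewrite E big_cons.
Qed.

Lemma ewedge_set0 w : ewedge_set w set0 = eone.
Proof. by rewrite /ewedge_set big_set0. Qed.

Lemma ewedge_set1 w i : ewedge_set w [set i] = w i.
Proof. by rewrite -[[set i]]setU0 ewedge_setU1 ?ewedge_set0 ?ewedge1r // => j; rewrite inE. Qed.

Lemma inversions1 i J : inversions [set i] J = #|[set j in J | (j < i)%N]|.
Proof.
rewrite /inversions -(card_imset _ (_ : injective (fun j : 'I_l => (i, j)))); last first.
  by move=> x y [].
apply: eq_card => -[s t]; rewrite !inE /=; apply/idP/imsetP.
  by move=> /andP[/andP[/eqP -> tJ] ti]; exists t; rewrite ?inE ?tJ.
by move=> [j]; rewrite inE => /andP[jJ ji] [-> ->]; rewrite eqxx jJ.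
Qed.

Lemma ewedge_set1l w i J : (forall j, is_oneform (w j)) ->
  ewedge (w i) (ewedge_set w J) =
  if i \in J then 0 else (-1) ^+ inversions [set i] J *: ewedge_set w (i |: J).
Proof.
move=> hw; elim/set_min_ind: J => [|j J jJ IH].
  rewrite inE inversions0r scale1r ewedge_set0 ewedge1r.
  by rewrite setU0 ewedge_set1.
rewrite (ewedge_setU1 w jJ) ewedgeA !inE.
have [->|ij] := eqVneq i j; first by rewrite ewedge_oneform_sqr // ewedge0l.
have jnJ : j \notin J by apply/negP=> /jJ; rewrite ltnn.
have /orP[iltj|jlti] : (i < j)%N || (j < i)%N by rewrite -neq_ltn.
  have iJ k : k \in j |: J -> (i < k)%N.
    by rewrite !inE => /predU1P[-> //|/jJ]; apply: ltn_trans.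
  have -> : i \in J = false by apply/negP=> h; have := iJ i; rewrite !inE h orbT ltnn => /(_ isT).
  rewrite -ewedgeA -ewedge_setU1 // -ewedge_setU1 //= inversions1.
  rewrite (_ : [set _ in _ | _] = set0) ?cards0 ?scale1r //.
  by apply/setP=> k; rewrite inE in_set0; apply/negbTE/negP=> /andP[/iJ h]; rewrite ltnNge ltnW.
rewrite (ewedge_oneformC (hw i) (hw j)) ewedgeNl -ewedgeA IH /=.
have [iJ|iJ] := boolP (i \in J); first by rewrite ewedge0r oppr0.
rewrite ewedgeZr -ewedge_setU1; last first.
  by move=> k; rewrite !inE => /predU1P[-> //|/jJ].
rewrite -scaleN1r scalerA -exprS setUCA; congr (_ ^+ _ *: _).
rewrite !inversions1 [in RHS](_ : [set _ in _ | _] = j |: [set k in J | (k < i)%N]).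
  by rewrite cardsU1 !inE (negPf jnJ).
by apply/setP=> k; rewrite !inE; case: eqP => // ->; rewrite jlti.
Qed.

Lemma disjoint_setU1 i I J :
  [disjoint i |: I & J] = (i \notin J) && [disjoint I & J].
Proof. by rewrite -!setI_eq0 setIUl setU_eq0 !setI_eq0 disjoints1. Qed.

Lemma ewedge_set_mul w I J : (forall j, is_oneform (w j)) ->
  ewedge (ewedge_set w I) (ewedge_set w J) =
  if [disjoint I & J] then (-1) ^+ inversions I J *: ewedge_set w (I :|: J)
  else 0.
Proof.
move=> hw; elim/set_min_ind: I => [|i I iI IH].
  by rewrite ewedge_set0 ewedge1l set0U inversions0l scale1r disjoints_subset sub0set.
rewrite (ewedge_setU1 w iI) -ewedgeA IH disjoint_setU1.
have inI : i \notin I by apply/negP=> /iI; rewrite ltnn.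
have [dIJ|_] := boolP [disjoint I & J]; last by rewrite andbF ewedge0r.
rewrite andbT ewedgeZr ewedge_set1l // inE (negPf inI) /=.
case: (boolP (i \in J)) => iJ /=; first by rewrite scaler0.
rewrite scalerA -exprD setUA; congr (_ ^+ _ *: _).
rewrite inversionsUl ?disjoints1 // addnC; congr (_ + _)%N.
rewrite !inversions1; apply: eq_card => k; rewrite !inE.
case: (boolP (k \in I)) => //= /iI; case: (k \in J) => //= h.
by apply/negbTE; rewrite -leqNgt ltnW.
Qed.

Lemma ewedge_set_dx I : ewedge_set (edx) I = ebasis I.
Proof.
elim/set_min_ind: I => [|i I iI IH]; first by rewrite ewedge_set0.
rewrite (ewedge_setU1 _ iI) IH ewedge_ebasis disjoints1.
have inI : i \notin I by apply/negP=> /iI; rewrite ltnn.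
rewrite inI inversions1 (_ : [set _ in _ | _] = set0) ?cards0 ?scale1r //.
apply/setP=> k; rewrite inE in_set0; apply/negbTE/negP=> /andP[/iI h].
by rewrite ltnNge ltnW.
Qed.

Lemma ewedge_setZ (s : 'I_l -> S) w I :
  ewedge_set (fun i => s i *: w i) I = (\prod_(i in I) s i) *: ewedge_set w I.
Proof.
elim/set_min_ind: I => [|i I iI IH].
  by rewrite !ewedge_set0 big_set0 scale1r.
have inI : i \notin I by apply/negP=> /iI; rewrite ltnn.
by rewrite !ewedge_setU1 // IH ewedgeZl ewedgeZr scalerA big_setU1.
Qed.

Lemma eq_ewedge_set w z I : (forall i, i \in I -> w i = z i) ->
  ewedge_set w I = ewedge_set z I.
Proof. by move=> h; rewrite /ewedge_set; apply: eq_bigr. Qed.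
End Exterior.

Section Degree.
Variables (S : idomainType) (l : nat).
Local Notation form := {ffun {set 'I_l} -> S^o}.
Implicit Types (a b c : form) (w z : 'I_l -> form) (I J K : {set 'I_l}).
Implicit Types (p q : S) (i j : 'I_l).

Definition form_degree (m : nat) a := forall I, #|I| != m -> a I = 0.

Definition top a : S := a setT.

Lemma topD a b : top (a + b) = top a + top b.
Proof. by rewrite /top ffunE. Qed.

Lemma topN a : top (- a) = - top a.
Proof. by rewrite /top ffunE. Qed.

Lemma topZ p a : top (p *: a) = p * top a.
Proof. by rewrite /top formZE. Qed.

Lemma top0 : top 0 = 0.
Proof. by rewrite /top ffunE. Qed.

Lemma top_sum (T : Type) (r : seq T) (P : pred T) (F : T -> form) :
  top (\sum_(i <- r | P i) F i) = \sum_(i <- r | P i) top (F i).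
Proof. by rewrite (big_morph top topD top0). Qed.

Lemma form_degree_wedge m k a b :
  form_degree m a -> form_degree k b -> form_degree (m + k) (ewedge a b).
Proof.
move=> ha hb K cK; rewrite ffunE big1 // => I IK.
have [cI|cI] := eqVneq #|I| m; last by rewrite ha // mulr0 mul0r.
rewrite hb ?mulr0 //; apply: contra cK => /eqP <-.
by rewrite -cI -(cardsID I K) (setIidPr IK).
Qed.

Lemma form_degreeZ m p a : form_degree m a -> form_degree m (p *: a).
Proof. by move=> ha I cI; rewrite formZE ha ?mulr0. Qed.

Lemma form_degree0 m : form_degree m 0.
Proof. by move=> I _; rewrite ffunE. Qed.

Lemma form_degreeD m a b :
  form_degree m a -> form_degree m b -> form_degree m (a + b).
Proof. by move=> ha hb I cI; rewrite ffunE ha ?hb ?addr0. Qed.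

Lemma form_degree_ebasis I : form_degree #|I| (ebasis S I).
Proof. by move=> J; rewrite ebasisE; have [->|] := eqVneq J I; rewrite ?eqxx. Qed.

Lemma form_degree_oneform a : is_oneform a -> form_degree 1 a.
Proof.
move=> [u ->]; rewrite /lincomb; apply: big_ind.
- exact: form_degree0.
- by move=> x y; apply: form_degreeD.
- move=> i _; apply: form_degreeZ; rewrite -(cards1 i).
  exact: form_degree_ebasis.
Qed.

Lemma form_degree_wedge_set w I : (forall i, is_oneform (w i)) ->
  form_degree #|I| (ewedge_set w I).
Proof.
move=> hw; elim/set_min_ind: I => [|i I iI IH].
  by rewrite ewedge_set0; apply: form_degree_ebasis.
rewrite (ewedge_setU1 _ iI) cardsU1.
have -> : i \notin I by apply/negP=> /iI; rewrite ltnn.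
by apply: form_degree_wedge IH; apply: form_degree_oneform.
Qed.

Lemma top_degree m a : form_degree m a -> m != l -> top a = 0.
Proof. by move=> ha ml; rewrite /top ha // cardsT card_ord eq_sym. Qed.

Lemma top_wedge_set w I : (forall i, is_oneform (w i)) -> I != setT ->
  top (ewedge_set w I) = 0.
Proof.
move=> hw IT; apply: (top_degree (form_degree_wedge_set (I := I) hw)).
apply: contra IT => /eqP cI.
by rewrite eqEcard subsetT cardsT card_ord cI /=.
Qed.

Lemma top_wedge_ebasis a J :
  top (ewedge (ebasis S (~: J)) a) = (-1) ^+ inversions (~: J) J * a J.
Proof.
rewrite /top ffunE (bigD1 (~: J)) ?subsetT //= big1 => [|I /andP[_ IJ]].
  by rewrite ebasisE eqxx mulr1 addr0 setTD setCK.
by rewrite ebasisE (negPf IJ) mulr0 mul0r.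
Qed.

Lemma inversionsr1 i J : inversions J [set i] = #|[set j in J | (i < j)%N]|.
Proof.
rewrite /inversions -(card_imset _ (_ : injective (fun j : 'I_l => (j, i)))); last first.
  by move=> x y [].
apply: eq_card => -[s t]; rewrite !inE /=; apply/idP/imsetP.
  by move=> /andP[/andP[sJ /eqP ->] ti]; exists s; rewrite ?inE ?sJ.
by move=> [j]; rewrite inE => /andP[jJ ji] [-> ->]; rewrite eqxx jJ.
Qed.

Lemma inversions1C i J : i \notin J ->
  (inversions J [set i] + inversions [set i] J)%N = #|J|.
Proof.
move=> iJ; rewrite inversions1 inversionsr1 -(cardsID [set j : 'I_l | (i < j)%N] J).
congr (_ + _)%N; apply: eq_card => j; rewrite !inE //.
case: (boolP (j \in J)) => jJ; rewrite ?andbF // andbT -leqNgt ltn_neqAle /=.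
have -> // : (j : nat) != i.
by apply: contraNneq iJ => /val_inj <-.
Qed.

Lemma top_oneformC a b : is_oneform b ->
  top (ewedge a b) = (-1) ^+ l.-1 * top (ewedge b a).
Proof.
move=> [u ->]; rewrite [a]form_expand /lincomb !ewedge_suml !top_sum mulr_sumr.
under eq_bigr => I _ do rewrite ewedge_sumr top_sum.
under [RHS]eq_bigr => i _ do rewrite ewedge_sumr top_sum mulr_sumr.
rewrite exchange_big; apply: eq_bigr => i _; apply: eq_bigr => I _ /=.
rewrite !(ewedgeZl, ewedgeZr) !topZ !ewedge_ebasis disjoint_sym setUC.
have [dI|_] := boolP [disjoint [set i] & I]; last by rewrite !top0 !mulr0.
rewrite !topZ /top !ebasisE; have [E|_] := eqVneq setT _; last by rewrite !mulr0.
move: dI; rewrite disjoints1 => iI.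
have <- : #|I| = l.-1.
  by have /(congr1 predn) := cardsU1 i I; rewrite iI -E cardsT card_ord add1n => ->.
rewrite -(inversions1C iI) exprD !mulr1.
have S1 : ((-1) ^+ inversions [set i] I) ^+ 2 = 1 :> S by rewrite sqrr_sign.
by rewrite -[LHS]mulr1 -[X in _ * X = _]S1; ring.
Qed.

Definition in_span w a := exists u, a = lincomb w u.

Definition in_alg w a :=
  exists s : {set 'I_l} -> S, a = \sum_(I : {set 'I_l}) s I *: ewedge_set w I.

Lemma in_algD w a b : in_alg w a -> in_alg w b -> in_alg w (a + b).
Proof.
move=> [s ->] [t ->]; exists (fun I => s I + t I); rewrite -big_split.
by apply: eq_bigr => I _; rewrite scalerDl.
Qed.

Lemma in_algZ w p a : in_alg w a -> in_alg w (p *: a).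
Proof.
move=> [s ->]; exists (fun I => p * s I); rewrite scaler_sumr.
by apply: eq_bigr => I _; rewrite scalerA.
Qed.

Lemma in_alg0 w : in_alg w 0.
Proof. by exists (fun=> 0); rewrite big1 // => I _; rewrite scale0r. Qed.

Lemma in_alg_sum w (T : Type) (r : seq T) (P : pred T) (F : T -> form) :
  (forall t, P t -> in_alg w (F t)) -> in_alg w (\sum_(t <- r | P t) F t).
Proof.
move=> h; apply: big_ind => //; first exact: in_alg0.
by move=> x y; apply: in_algD.
Qed.

Lemma in_alg_wedge_set w I : in_alg w (ewedge_set w I).
Proof.
exists (fun J => (J == I)%:R); rewrite (bigD1 I) //= eqxx scale1r big1 ?addr0 //.
by move=> J /negPf ->; rewrite scale0r.
Qed.

Lemma in_algM w a b : (forall i, is_oneform (w i)) ->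
  in_alg w a -> in_alg w b -> in_alg w (ewedge a b).
Proof.
move=> hw [s ->] [t ->]; rewrite ewedge_suml; apply: in_alg_sum => I _.
rewrite ewedge_sumr; apply: in_alg_sum => J _.
rewrite ewedgeZl ewedgeZr ewedge_set_mul //; do 2! apply: in_algZ.
have [_|_] := boolP [disjoint _ & _]; last exact: in_alg0.
by apply: in_algZ; apply: in_alg_wedge_set.
Qed.

Lemma in_alg_span w a : in_span w a -> in_alg w a.
Proof.
move=> [u ->]; apply: in_alg_sum => i _; apply: in_algZ.
by rewrite -[w i]ewedge_set1; apply: in_alg_wedge_set.
Qed.

Lemma in_alg_wedge_set_span w z I : (forall i, is_oneform (w i)) ->
  (forall i, in_span w (z i)) -> in_alg w (ewedge_set z I).
Proof.
move=> hw hz; elim/set_min_ind: I => [|i I iI IH].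
  by rewrite ewedge_set0 -(ewedge_set0 w); apply: in_alg_wedge_set.
by rewrite ewedge_setU1 //; apply: in_algM => //; apply: in_alg_span.
Qed.

Lemma top_in_alg w a : (forall i, is_oneform (w i)) -> in_alg w a ->
  exists s, top a = s * top (ewedge_set w setT).
Proof.
move=> hw [s ->]; exists (s setT).
rewrite top_sum (bigD1 setT) // big1 => [|I /andP[_ IT]].
  by rewrite Monoid.mulm1 [LHS]topZ.
by rewrite topZ top_wedge_set ?mulr0.
Qed.

Lemma ewedge_set_eq0 w (G : S) a : (forall i, is_oneform (w i)) -> G != 0 ->
  (forall i, in_span w (G *: edx S i)) ->
  (forall K, top (ewedge (ewedge_set w K) a) = 0) -> a = 0.
Proof.
move=> hw G0 hG ha; apply/ffunP=> J; rewrite [RHS]ffunE.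
have := in_alg_wedge_set_span (~: J) hw hG.
rewrite ewedge_setZ ewedge_set_dx => -[s hs].
have : top (ewedge ((\prod_(i in ~: J) G) *: ebasis S (~: J)) a) = 0.
  rewrite hs ewedge_suml top_sum big1 // => I _.
  by rewrite ewedgeZl topZ ha mulr0.
rewrite ewedgeZl topZ top_wedge_ebasis => /eqP.
rewrite !mulf_eq0 prodf_seq_eq0 signr_eq0.
case/orP=> [/hasP[i _ /andP[_ h]]|/eqP //]; by rewrite h in G0.
Qed.
End Degree.

(** * Polynomial algebras with a linear action *)

(* What the argument uses of the polynomial ring {mpoly C[l]}. *)
Record poly_alg (C : numClosedFieldType) (l : nat) (S : idomainType) := PolyAlg {
  pcst : {rmorphism C -> S};
  pvar : 'I_l -> S;
  pder : 'I_l -> S -> S;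
  psubst : ('I_l -> S) -> {rmorphism S -> S};
  peval : ('I_l -> C) -> {rmorphism S -> C};
  poly_alg_ind : forall P : S -> Prop,
    (forall c, P (pcst c)) -> (forall i, P (pvar i)) ->
    (forall p q, P p -> P q -> P (p + q)) ->
    (forall p q, P p -> P q -> P (p * q)) -> forall p, P p;
  pderD : forall i, {morph pder i : p q / p + q};
  pderM : forall i p q, pder i (p * q) = pder i p * q + p * pder i q;
  pder_cst : forall i c, pder i (pcst c) = 0;
  pder_var : forall i j, pder i (pvar j) = (i == j)%:R;
  psubst_cst : forall t c, psubst t (pcst c) = pcst c;
  psubst_var : forall t i, psubst t (pvar i) = t i;
  peval_cst : forall v c, peval v (pcst c) = c;
  peval_var : forall v i, peval v (pvar i) = v i;
  scaling_cst : forall p, psubst (fun i => pcst 2 * pvar i) p = p ->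
    p = pcst (peval (fun=> 0) p)
}.

Section Polynomials.
Variables (C : numClosedFieldType) (l : nat) (S : idomainType).
Variable P : poly_alg C l S.
Local Notation form := {ffun {set 'I_l} -> S^o}.
Local Notation dform := {ffun 'I_l -> form}.
Local Notation k_ := (pcst P).
Local Notation x_ := (pvar P).
Local Notation d_ := (pder P).
Implicit Types (a b : form) (w z : 'I_l -> form) (I J K : {set 'I_l}).
Implicit Types (p q : S) (i j : 'I_l) (c : C) (t : 'I_l -> S) (v : 'I_l -> C).
Implicit Types (A B : 'M[C]_l).

Lemma pder0 i : d_ i 0 = 0.
Proof. by have := pder_cst P i 0; rewrite rmorph0. Qed.

Lemma pder_sum i (T : Type) (r : seq T) (Q : pred T) (F : T -> S) :
  d_ i (\sum_(s <- r | Q s) F s) = \sum_(s <- r | Q s) d_ i (F s).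
Proof. by rewrite (big_morph _ (pderD P i) (pder0 i)). Qed.

Lemma pderZ i c p : d_ i (k_ c * p) = k_ c * d_ i p.
Proof. by rewrite pderM pder_cst mul0r add0r. Qed.

Lemma pderN i p : d_ i (- p) = - d_ i p.
Proof. by rewrite -mulN1r -(rmorphN1 k_) pderZ rmorphN1 mulN1r. Qed.

Lemma pderC i j p : d_ i (d_ j p) = d_ j (d_ i p).
Proof.
elim/(@poly_alg_ind _ _ _ P): p => [c|s|p q IHp IHq|p q IHp IHq].
- by rewrite !pder_cst !pder0.
- by rewrite !pder_var -!(rmorph_nat k_) !pder_cst.
- by rewrite !pderD IHp IHq.
- by rewrite !(pderM, pderD) IHp IHq; ring.
Qed.

Lemma pder_subst t p j :
  d_ j (psubst P t p) = \sum_i psubst P t (d_ i p) * d_ j (t i).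
Proof.
elim/(@poly_alg_ind _ _ _ P): p => [c|s|p q IHp IHq|p q IHp IHq].
- by rewrite psubst_cst pder_cst big1 // => i _; rewrite pder_cst rmorph0 mul0r.
- rewrite psubst_var (bigD1 s) //= pder_var eqxx rmorph1 mul1r big1 ?addr0 //.
  by move=> i /negPf is'; rewrite pder_var is' rmorph0 mul0r.
- rewrite rmorphD pderD IHp IHq -big_split; apply: eq_bigr => i _ /=.
  by rewrite pderD rmorphD mulrDl.
- rewrite rmorphM pderM IHp IHq mulr_suml mulr_sumr -big_split.
  by apply: eq_bigr => i _ /=; rewrite pderM rmorphD !rmorphM /=; ring.
Qed.

Lemma eq_psubst t t' : t =1 t' -> psubst P t =1 psubst P t'.
Proof.
move=> tt' p; elim/(@poly_alg_ind _ _ _ P): p => [c|s|p q IHp IHq|p q IHp IHq].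
- by rewrite !psubst_cst.
- by rewrite !psubst_var.
- by rewrite !rmorphD /= IHp IHq.
- by rewrite !rmorphM /= IHp IHq.
Qed.

Lemma psubst_comp t t' p :
  psubst P t' (psubst P t p) = psubst P (fun i => psubst P t' (t i)) p.
Proof.
elim/(@poly_alg_ind _ _ _ P): p => [c|s|p q IHp IHq|p q IHp IHq].
- by rewrite !psubst_cst.
- by rewrite !psubst_var.
- by rewrite !rmorphD /= IHp IHq.
- by rewrite !rmorphM /= IHp IHq.
Qed.

Lemma psubst_id t p : (forall i, t i = x_ i) -> psubst P t p = p.
Proof.
move=> ht; elim/(@poly_alg_ind _ _ _ P): p => [c|s|p q IHp IHq|p q IHp IHq].
- by rewrite psubst_cst.
- by rewrite psubst_var.
- by rewrite rmorphD /= IHp IHq.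
- by rewrite rmorphM /= IHp IHq.
Qed.

Lemma peval_subst v t p :
  peval P v (psubst P t p) = peval P (fun i => peval P v (t i)) p.
Proof.
elim/(@poly_alg_ind _ _ _ P): p => [c|s|p q IHp IHq|p q IHp IHq].
- by rewrite psubst_cst !peval_cst.
- by rewrite psubst_var peval_var.
- by rewrite !rmorphD /= IHp IHq.
- by rewrite !rmorphM /= IHp IHq.
Qed.

Lemma eq_peval v v' : v =1 v' -> peval P v =1 peval P v'.
Proof.
move=> vv' p; elim/(@poly_alg_ind _ _ _ P): p => [c|s|p q IHp IHq|p q IHp IHq].
- by rewrite !peval_cst.
- by rewrite !peval_var.
- by rewrite !rmorphD /= IHp IHq.
- by rewrite !rmorphM /= IHp IHq.
Qed.

Definition pdiff p : form := lincomb (edx S (l := l)) (fun i => d_ i p).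

Lemma oneform_pdiff p : is_oneform (pdiff p).
Proof. by eexists. Qed.

Lemma pdiffD p q : pdiff (p + q) = pdiff p + pdiff q.
Proof. by rewrite lincombD; apply: eq_bigr => i _; rewrite pderD. Qed.

Lemma pdiffM p q : pdiff (p * q) = q *: pdiff p + p *: pdiff q.
Proof.
rewrite !lincombZ lincombD; apply: eq_bigr => i _.
by rewrite pderM mulrC.
Qed.

Lemma pdiff_cst c : pdiff (k_ c) = 0.
Proof. by rewrite /pdiff /lincomb big1 // => i _; rewrite pder_cst scale0r. Qed.

Lemma pdiff_var i : pdiff (x_ i) = edx S i.
Proof.
by rewrite (lincomb1 (edx S (l := l)) i); apply: eq_bigr => j _; rewrite pder_var.
Qed.

Lemma pdiffZ c p : pdiff (k_ c * p) = k_ c *: pdiff p.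
Proof. by rewrite pdiffM pdiff_cst scaler0 add0r. Qed.

Lemma pdiff0 : pdiff 0 = 0.
Proof. by have := pdiff_cst 0; rewrite rmorph0. Qed.

Lemma pdiff_sum (T : Type) (r : seq T) (Q : pred T) (F : T -> S) :
  pdiff (\sum_(s <- r | Q s) F s) = \sum_(s <- r | Q s) pdiff (F s).
Proof. by rewrite (big_morph _ pdiffD pdiff0). Qed.

Lemma pdiff_subst t p :
  pdiff (psubst P t p) = lincomb (fun i => pdiff (t i)) (fun i => psubst P t (d_ i p)).
Proof.
rewrite /lincomb /pdiff /lincomb.
under [RHS]eq_bigr => i _ do rewrite scaler_sumr.
rewrite [RHS]exchange_big; apply: eq_bigr => j _.
rewrite pder_subst scaler_suml; apply: eq_bigr => i _.
by rewrite scalerA.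
Qed.

Definition pact A : {rmorphism S -> S} :=
  psubst P (fun i => \sum_j k_ (invmx A j i) * x_ j).

Definition act_edx A i : form := \sum_j k_ (invmx A j i) *: edx S j.

Definition eact A a : form := \sum_I pact A (a I) *: ewedge_set (act_edx A) I.

Definition dact A (eta : dform) : dform :=
  [ffun j => \sum_k k_ (A k j) *: eact A (eta k)].

Lemma pactX A i : pact A (x_ i) = \sum_j k_ (invmx A j i) * x_ j.
Proof. exact: psubst_var. Qed.

Lemma pact_cst A c : pact A (k_ c) = k_ c.
Proof. exact: psubst_cst. Qed.

Lemma pder_pact A p j : d_ j (pact A p) = \sum_i k_ (invmx A j i) * pact A (d_ i p).
Proof.
rewrite pder_subst; apply: eq_bigr => i _; rewrite mulrC; congr (_ * _).
rewrite pder_sum (bigD1 j) //= pderZ pder_var eqxx mulr1 big1 ?addr0 // => s.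
by rewrite pderZ pder_var eq_sym => /negPf ->; rewrite mulr0.
Qed.

Lemma invmx_mul A B : A \in unitmx -> B \in unitmx ->
  invmx (A *m B) = invmx B *m invmx A.
Proof.
move=> uA uB; have uAB : A *m B \in unitmx by rewrite unitmx_mul uA.
apply: (can_inj (mulKmx uAB)); rewrite mulmxV // mulmxA.
by rewrite -(mulmxA A) mulmxV // mulmx1 mulmxV.
Qed.

Lemma pact_comp A B p : A \in unitmx -> B \in unitmx ->
  pact B (pact A p) = pact (A *m B) p.
Proof.
move=> uA uB; rewrite [LHS]psubst_comp; apply: eq_psubst => i.
rewrite rmorph_sum invmx_mul //=.
under eq_bigr => j _ do rewrite rmorphM pact_cst pactX mulr_sumr.
rewrite exchange_big; apply: eq_bigr => s _ /=.
rewrite mxE rmorph_sum mulr_suml; apply: eq_bigr => j _.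
by rewrite /= rmorphM /=; ring.
Qed.

Lemma pact1 p : pact 1%:M p = p.
Proof.
apply: psubst_id => i; rewrite invmx1 (bigD1 i) //= mxE eqxx rmorph1 mul1r.
by rewrite big1 ?addr0 // => j; rewrite mxE => /negPf ->; rewrite rmorph0 mul0r.
Qed.

Lemma act_edxE A i : act_edx A i = pdiff (pact A (x_ i)).
Proof.
by rewrite pactX pdiff_sum; apply: eq_bigr => j _; rewrite pdiffZ pdiff_var.
Qed.

Lemma oneform_act_edx A i : is_oneform (act_edx A i).
Proof. by rewrite act_edxE; apply: oneform_pdiff. Qed.

Lemma eactD A a b : eact A (a + b) = eact A a + eact A b.
Proof.
rewrite /eact -big_split; apply: eq_bigr => I _ /=.
by rewrite ffunE rmorphD scalerDl.
Qed.

Lemma eactZ A p a : eact A (p *: a) = pact A p *: eact A a.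
Proof.
rewrite /eact [RHS]scaler_sumr; apply: eq_bigr => I _.
by rewrite formZE rmorphM scalerA.
Qed.

Lemma eact0 A : eact A 0 = 0.
Proof. by have := eactZ A 0 0; rewrite scale0r rmorph0 scale0r. Qed.

Lemma eact_sum A (T : Type) (r : seq T) (Q : pred T) (F : T -> form) :
  eact A (\sum_(i <- r | Q i) F i) = \sum_(i <- r | Q i) eact A (F i).
Proof. by rewrite (big_morph _ (eactD A) (eact0 A)). Qed.

Lemma eact_ebasis A I :
  eact A (ebasis S I) = ewedge_set (act_edx A) I.
Proof.
rewrite /eact (bigD1 I) //= ebasisE eqxx rmorph1 scale1r big1 ?addr0 //.
by move=> J JI; rewrite ebasisE (negPf JI) rmorph0 scale0r.
Qed.

Lemma eact_wedge A a b :
  eact A (ewedge a b) = ewedge (eact A a) (eact A b).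
Proof.
have hA i : is_oneform (act_edx A i) by apply: oneform_act_edx.
have E I J : eact A (ewedge (ebasis S I) (ebasis S J)) =
    ewedge (eact A (ebasis S I)) (eact A (ebasis S J)).
  rewrite (eact_ebasis A I) (eact_ebasis A J).
  rewrite ewedge_ebasis (ewedge_set_mul I J hA).
  have [_|_] := boolP [disjoint _ & _]; last exact: eact0.
  by rewrite eactZ eact_ebasis rmorphXn rmorphN1.
rewrite [a]form_expand [b]form_expand.
rewrite ewedge_suml (eact_sum A _ _ (fun I => ewedge _ _)).
rewrite [X in ewedge X _](eact_sum A _ _ (fun I => a I *: _)).
rewrite [RHS]ewedge_suml.
apply: eq_bigr => I _.
rewrite ewedge_sumr (eact_sum A _ _ (fun I => ewedge _ _)).
rewrite [X in ewedge _ X](eact_sum A _ _ (fun I => b I *: _)).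
rewrite [RHS]ewedge_sumr.
apply: eq_bigr => J _.
rewrite [X in eact A X]ewedgeZl [X in eact A (_ *: X)]ewedgeZr.
rewrite [LHS]eactZ [X in _ *: X = _]eactZ E.
rewrite [X in _ = ewedge X _]eactZ [X in _ = ewedge _ X]eactZ [RHS]ewedgeZl.
by rewrite [X in _ = _ *: X]ewedgeZr.
Qed.

Lemma eact_one A : eact A (eone S l) = eone S l.
Proof. by rewrite eact_ebasis ewedge_set0. Qed.

Lemma eact_edx A i : eact A (edx S i) = act_edx A i.
Proof. by rewrite eact_ebasis ewedge_set1. Qed.

Lemma eact_pdiff A p : eact A (pdiff p) = pdiff (pact A p).
Proof.
rewrite {1}/pdiff /lincomb eact_sum /pdiff /lincomb.
under [RHS]eq_bigr => j _ do rewrite pder_pact scaler_suml.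
rewrite [RHS]exchange_big; apply: eq_bigr => i _.
rewrite eactZ eact_edx scaler_sumr; apply: eq_bigr => j _.
by rewrite scalerA mulrC.
Qed.

Lemma eact_wedge_set A w I :
  eact A (ewedge_set w I) = ewedge_set (fun i => eact A (w i)) I.
Proof.
elim/set_min_ind: I => [|i I iI IH].
  by rewrite !ewedge_set0 eact_one.
by rewrite !ewedge_setU1 // eact_wedge IH.
Qed.

Lemma top_eact A a :
  top (eact A a) = pact A (top a) * top (eact A (ebasis S setT)).
Proof.
rewrite {1}[a]form_expand eact_sum top_sum (bigD1 setT) //= big1 => [|I IT].
  by rewrite addr0 eactZ topZ.
rewrite eactZ topZ eact_ebasis top_wedge_set ?mulr0 // => i.
exact: oneform_act_edx.
Qed.

Definition pairing (eta : dform) w : form := \sum_j ewedge (eta j) (w j).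

Definition coinvariant A w :=
  forall j, w j = \sum_i (k_ (invmx A j i)) *: eact A (w i).

Lemma eact_pairing A eta w : A \in unitmx -> dact A eta = eta ->
  coinvariant A w -> eact A (pairing eta w) = pairing eta w.
Proof.
move=> uA heta hw; symmetry.
have E j : ewedge (eta j) (w j) = \sum_k \sum_i
    (k_ (A k j * invmx A j i)) *: ewedge (eact A (eta k)) (eact A (w i)).
  rewrite (hw j) -{1}heta ffunE ewedge_suml; apply: eq_bigr => k _.
  rewrite ewedge_sumr; apply: eq_bigr => i _.
  by rewrite ewedgeZl ewedgeZr scalerA rmorphM.
rewrite /pairing [LHS](eq_bigr _ (fun j _ => E j)) [LHS]exchange_big.
rewrite eact_sum; apply: eq_bigr => k _; rewrite [LHS]exchange_big.
have F i : \sum_j (k_ (A k j * invmx A j i)) *: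
      ewedge (eact A (eta k)) (eact A (w i)) =
    (k == i)%:R *: ewedge (eact A (eta k)) (eact A (w i)).
  rewrite -scaler_suml -rmorph_sum /=; congr (_ *: _).
  have := congr1 (fun M : 'M_l => M k i) (mulmxV uA).
  by rewrite !mxE => ->; case: (k == i); rewrite ?rmorph1 ?rmorph0.
rewrite (eq_bigr _ (fun i _ => F i)) (bigD1 k) //= eqxx scale1r.
rewrite big1 ?addr0 => [|i ik]; first by rewrite eact_wedge.
by rewrite eq_sym (negPf ik) scale0r.
Qed.

Lemma invariant_pder A p j : pact A p = p ->
  (d_ j p) = \sum_i (k_ (invmx A j i)) * pact A (d_ i p).
Proof.
by move=> hp; rewrite -{1}hp pder_pact.
Qed.

Lemma coinvariant_pder A p : pact A p = p ->
  coinvariant A (fun j => (d_ j p) *: eone S l).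
Proof.
move=> hp j; rewrite {1}(invariant_pder j hp) scaler_suml.
by apply: eq_bigr => i _; rewrite eactZ eact_one scalerA.
Qed.

Lemma coinvariant_pdiff A p : pact A p = p ->
  coinvariant A (fun j => pdiff (d_ j p)).
Proof.
move=> hp j; rewrite {1}(invariant_pder j hp) pdiff_sum.
by apply: eq_bigr => i _; rewrite pdiffZ eact_pdiff.
Qed.
End Polynomials.

(** * Divisibility of anti-invariants by the Jacobian *)

Lemma generic_combination (D : idomainType) (l : nat) (T : finType) (Q : pred T)
    (d : T -> 'I_l -> D) :
  (forall n, n.+1%:R != 0 :> D) ->
  (forall t, Q t -> exists i, d t i != 0) ->
  exists n : nat, forall t, Q t -> \sum_(i < l) n%:R ^+ i * d t i != 0.
Proof.
move=> D0 hd.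
pose p : {poly D} := \prod_(t | Q t) \poly_(i < l) (if insub i is Some j then d t j else 0).
have natrI : injective (fun n => n%:R : D).
  move=> m n /=; wlog mn : m n / (m <= n)%N.
    by move=> h; case/orP: (leq_total m n) => /h // h' /esym /h' ->.
  rewrite -(subnKC mn) natrD => /eqP; rewrite -subr_eq0 opprD addNKr oppr_eq0.
  by case: (n - m)%N => [|k]; rewrite ?addn0 // (negPf (D0 k)).
have p0 : p != 0.
  apply/prodf_neq0 => t /hd[i hi]; apply: contra hi => /eqP h.
  have := congr1 (fun q : {poly D} => q`_i) h.
  by rewrite coef_poly ltn_ord coef0 valK => ->.
have [n hn] : exists n : nat, ~~ root p n%:R.
  have : ~~ all (root p) [seq n%:R | n <- iota 0 (size p)].
    apply/negP=> h; have := max_poly_roots p0 h.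
    by rewrite map_inj_uniq // iota_uniq size_map size_iota ltnn => /(_ isT).
  by rewrite all_map => /allPn[n _ hn]; exists n.
exists n => t Qt; apply: contra hn => /eqP h.
rewrite /root horner_prod (bigD1 t) //= horner_poly.
rewrite (_ : \sum_(i < l) _ = 0) ?mul0r //; rewrite -[RHS]h.
by apply: eq_bigr => i _; rewrite valK mulrC.
Qed.

Section Span.
Variables (S : idomainType) (l : nat).
Local Notation form := {ffun {set 'I_l} -> S^o}.
Implicit Types (a b : form) (w : 'I_l -> form).

Lemma in_spanD w a b : in_span w a -> in_span w b -> in_span w (a + b).
Proof. by move=> [u ->] [v ->]; rewrite lincombD; eexists. Qed.

Lemma in_spanZ w p a : in_span w a -> in_span w (p *: a).
Proof. by move=> [u ->]; rewrite lincombZ; eexists. Qed.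

Lemma in_span0 w : in_span w 0.
Proof. by exists (fun=> 0); rewrite /lincomb big1 // => i _; rewrite scale0r. Qed.

Lemma in_spanN w a : in_span w a -> in_span w (- a).
Proof. by rewrite -scaleN1r; apply: in_spanZ. Qed.

Lemma in_span_sum w (T : Type) (r : seq T) (Q : pred T) (F : T -> form) :
  (forall t, Q t -> in_span w (F t)) -> in_span w (\sum_(t <- r | Q t) F t).
Proof.
move=> h; apply: big_ind => //; first exact: in_span0.
by move=> x y; apply: in_spanD.
Qed.

Lemma in_span_gen w i : in_span w (w i).
Proof. by eexists; apply: lincomb1. Qed.

Lemma top_span w z : (forall i, is_oneform (w i)) ->
  (forall i, in_span w (z i)) ->
  exists s, top (ewedge_set z setT) = top (ewedge_set w setT) * s.
Proof.
move=> hw hz; have [s hs] := top_in_alg hw (in_alg_wedge_set_span setT hw hz).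
by exists s; rewrite hs mulrC.
Qed.

Lemma top_ebasis : top (ebasis S (l := l) setT) = 1.
Proof. by rewrite /top ebasisE eqxx. Qed.
End Span.

Section Invariants.
Variables (C : numClosedFieldType) (l : nat) (S : idomainType).
Variable P : poly_alg C l S.
Variables (gT : finGroupType) (G : {group gT}) (rG : mx_representation C G l).
Variable f : 'I_l -> S.
Local Notation form := {ffun {set 'I_l} -> S^o}.
Local Notation k_ := (pcst P).
Local Notation x_ := (pvar P).
Local Notation d_ := (pder P).
Implicit Types (a b : form) (w z : 'I_l -> form) (I J K : {set 'I_l}).
Implicit Types (p q : S) (i j : 'I_l) (c : C) (t : 'I_l -> S) (v : 'I_l -> C).

Definition gact (g : gT) : {rmorphism S -> S} := pact P (rG g).

Definition ginv p := forall g, g \in G -> gact g p = p.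

Definition gdf i : form := pdiff P (f i).

Hypothesis rG_faithful : mx_faithful rG.
Hypothesis f_gen : forall p, ginv p <-> exists q, p = psubst P f q.

Lemma rG_unit g : g \in G -> rG g \in unitmx.
Proof. exact: repr_mx_unit. Qed.

Lemma gact_comp g h p : g \in G -> h \in G -> gact h (gact g p) = gact (g * h)%g p.
Proof.
by move=> gG hG; rewrite /gact pact_comp ?rG_unit // repr_mxM.
Qed.

Lemma gact_cst g c : gact g (k_ c) = k_ c.
Proof. exact: pact_cst. Qed.

Lemma gact1 p : gact 1%g p = p.
Proof. by rewrite /gact repr_mx1 pact1. Qed.

Lemma k_inj : injective k_.
Proof. exact: fmorph_inj. Qed.

Lemma natS_neq0 n : n.+1%:R != 0 :> S.
Proof. by rewrite -(rmorph_nat k_) fmorph_eq0 pnatr_eq0. Qed.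

Lemma ginv_sum u : ginv (\sum_(h in G) gact h u).
Proof.
move=> g gG; rewrite rmorph_sum [RHS](reindex_inj (mulIg g)) /=.
rewrite [RHS](eq_bigl (mem G)) => [|h]; last by rewrite groupMr.
by apply: eq_bigr => h hG; rewrite gact_comp.
Qed.

Lemma oneform_gdf i : is_oneform (gdf i).
Proof. exact: oneform_pdiff. Qed.

Lemma pdiff_ginv p : ginv p -> in_span gdf (pdiff P p).
Proof. by move/f_gen => [q ->]; rewrite pdiff_subst; eexists. Qed.

Lemma interpolation_poly (lam : S) (Phi : {poly S}) u :
  in_span gdf (\sum_(h in G) ((Phi^`()).[gact h lam] * gact h u) *: pdiff P (gact h lam)
             + \sum_(h in G) Phi.[gact h lam] *: pdiff P (gact h u)).
Proof.
rewrite -big_split /=; elim/poly_ind: Phi u => [|p c IH] u.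
  rewrite big1 => [|h _]; first exact: in_span0.
  by rewrite deriv0 !horner0 mul0r !scale0r addr0.
have := in_spanD (IH (lam * u)) (in_spanZ c (pdiff_ginv (ginv_sum u))).
rewrite pdiff_sum scaler_sumr -big_split /=; congr (in_span _ _).
apply: eq_bigr => h _; rewrite rmorphM pdiffM derivD derivC derivM derivX mulr1 !hornerE.
rewrite !scalerDr !scalerDl !scalerA !mulrDl !scalerDl -!addrA.
by congr (_ + _).
Qed.

Lemma interpolation (K : {set gT}) (lam u : S) : K \subset G ->
  (forall h, h \in K -> gact h u = u) ->
  let Phi := \prod_(g in G :\: K) ('X - (gact g lam)%:P) ^+ 2 in
  in_span gdf ((\sum_(h in K) Phi.[gact h lam]) *: pdiff P u).
Proof.
move=> KG hu Phi.
have := in_spanD (interpolation_poly lam Phi u)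
  (in_spanN (in_spanZ u (interpolation_poly lam Phi 1))).
rewrite [X in - (u *: X)](_ : _ =
    \sum_(h in G) (Phi^`()).[gact h lam] *: pdiff P (gact h lam)); last first.
  rewrite [X in _ + X]big1 => [|h _]; last first.
    by rewrite rmorph1 -(rmorph1 k_) pdiff_cst scaler0.
  by rewrite addr0; apply: eq_bigr => h _; rewrite rmorph1 mulr1.
rewrite addrAC scaler_sumr -sumrB -big_split /=; congr (in_span _ _).
rewrite (big_setID K) /= [X in _ + X]big1 ?addr0 => [|h hGK]; last first.
  have h0 : ('X - (gact h lam)%:P).[gact h lam] = 0 by rewrite hornerXsubC subrr.
  have -> : Phi.[gact h lam] = 0.
    by rewrite /Phi (bigD1 h) //= expr2 !hornerM h0 !mul0r.
  have -> : (Phi^`()).[gact h lam] = 0.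
    move: h0; rewrite /Phi (bigD1 h) //=; move: ('X - _%:P) => E h0.
    rewrite expr2 !derivM !(hornerD, hornerM) h0.
    by rewrite !(mul0r, mulr0, addr0).
  by rewrite mul0r !scale0r scaler0 subrr addr0.
rewrite (setIidPr KG) scaler_suml; apply: eq_bigr => h hK.
by rewrite hu // scalerA mulrC subrr add0r.
Qed.

Definition lin (m : 'I_l -> C) : S := \sum_i k_ (m i) * x_ i.

Definition anti p := forall g, g \in G ->
  gact g p * top (eact P (rG g) (ebasis S setT)) = p.

Definition jac : S := top (ewedge_set gdf setT).

Lemma pder_lin m i : d_ i (lin m) = k_ (m i).
Proof.
rewrite pder_sum (bigD1 i) //= pderZ pder_var eqxx mulr1 big1 ?addr0 // => j.
by rewrite pderZ pder_var eq_sym => /negPf ->; rewrite mulr0.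
Qed.

Lemma pdiff_lin m : pdiff P (lin m) = \sum_i k_ (m i) *: edx S i.
Proof. by rewrite pdiff_sum; apply: eq_bigr => i _; rewrite pdiffZ pdiff_var. Qed.

Lemma gact_var g i : gact g (x_ i) = lin (fun j => invmx (rG g) j i).
Proof. exact: pactX. Qed.

Lemma gact_lin g m : gact g (lin m) = lin (fun j => \sum_i m i * invmx (rG g) j i).
Proof.
rewrite rmorph_sum /= /lin.
under eq_bigr => i _ do rewrite rmorphM gact_cst gact_var mulr_sumr.
rewrite exchange_big; apply: eq_bigr => j _ /=; rewrite rmorph_sum mulr_suml.
by apply: eq_bigr => i _; rewrite /= rmorphM mulrA.
Qed.

Lemma linB m m' : lin m - lin m' = lin (fun i => m i - m' i).
Proof. by rewrite -sumrB; apply: eq_bigr => i _; rewrite rmorphB mulrBl. Qed.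

Lemma lin_eq0 m : lin m = 0 -> forall i, m i = 0.
Proof.
move=> h i; apply: k_inj; rewrite rmorph0 -(pder_lin m i) h.
by have := pder_cst P i 0; rewrite rmorph0.
Qed.

Lemma gact_fix_var g : g \in G -> (forall i, gact g (x_ i) = x_ i) -> g = 1%g.
Proof.
move=> gG hg; apply/set1P; apply: (subsetP rG_faithful); apply/rkerP; split=> //.
suff h : invmx (rG g) = 1%:M by rewrite -[rG g]invmxK h invmx1.
apply/matrixP=> j i; apply: k_inj; have := congr1 (d_ j) (hg i).
by rewrite gact_var pder_lin pder_var => ->; rewrite mxE; case: (j == i); rewrite ?rmorph1 ?rmorph0.
Qed.

Lemma jac_anti : anti jac.
Proof.
move=> g gG; rewrite /gact -top_eact eact_wedge_set; congr top.
apply: eq_ewedge_set => i _; rewrite /gdf eact_pdiff; congr pdiff.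
suff h : ginv (f i) by apply: h.
by apply/f_gen; exists (x_ i); rewrite psubst_var.
Qed.

(* Congruence modulo the linear form with coefficients [c], as equality      *)
(* under the retraction of the polynomial ring that kills this form.         *)
Section LinearForm.
Variables (c : 'I_l -> C) (i0 : 'I_l).
Hypothesis ci0 : c i0 != 0.
Let L := lin c.

Definition modlin : {rmorphism S -> S} :=
  psubst P (fun i => if i == i0 then x_ i - k_ (c i0)^-1 * L else x_ i).

Lemma modlin_var i : modlin (x_ i) = x_ i - k_ ((i == i0)%:R / c i0) * L.
Proof.
rewrite /modlin psubst_var; case: eqP => [->|_]; first by rewrite mul1r.
by rewrite mul0r rmorph0 mul0r subr0.
Qed.

Lemma modlin_lin m : modlin (lin m) = lin m - k_ (m i0 / c i0) * L.
Proof.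
rewrite rmorph_sum /=.
under eq_bigr => i _ do rewrite rmorphM /= {1}/modlin psubst_cst modlin_var mulrBr mulrA -rmorphM.
rewrite sumrB -mulr_suml -rmorph_sum /= [X in _ - k_ X * _](bigD1 i0) //=.
rewrite eqxx [X in k_ (_ + X)]big1 ?addr0 ?mul1r //.
by move=> i /negPf ->; rewrite mul0r mulr0.
Qed.

Lemma modlin_L : modlin L = 0.
Proof. by rewrite /L modlin_lin divff // rmorph1 mul1r subrr. Qed.

Lemma modlinP p : exists q, p - modlin p = L * q.
Proof.
elim/(@poly_alg_ind _ _ _ P): p => [a|s|p q [p' hp] [q' hq]|p q [p' hp] [q' hq]].
- by exists 0; rewrite /modlin psubst_cst subrr mulr0.
- by eexists; rewrite modlin_var opprB addrC subrK mulrC.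
- by exists (p' + q'); rewrite rmorphD mulrDr -hp -hq; ring.
- exists (p' * q + modlin p * q'); rewrite rmorphM mulrDr mulrA -hp mulrCA -hq.
  by ring.
Qed.

Lemma modlin_dvd p : modlin p = 0 -> exists q, p = L * q.
Proof. by move=> h; have [q] := modlinP p; rewrite h subr0; exists q. Qed.

Lemma L_neq0 : L != 0.
Proof.
by apply/eqP => /lin_eq0/(_ i0) h; move: ci0; rewrite h eqxx.
Qed.

Definition inertia : {set gT} :=
  [set g in G | [forall i, modlin (gact g (x_ i)) == modlin (x_ i)]].

Lemma modlin_inertia g p : g \in inertia -> modlin (gact g p) = modlin p.
Proof.
rewrite inE => /andP[gG /forallP hg].
elim/(@poly_alg_ind _ _ _ P): p => [a|s|p q hp hq|p q hp hq].
- by rewrite gact_cst.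
- exact/eqP.
- by rewrite !rmorphD /= hp hq.
- by rewrite !rmorphM /= hp hq.
Qed.

Lemma inertia_group_set : group_set inertia.
Proof.
apply/group_setP; split=> [|g h gI hI].
  by rewrite inE group1; apply/forallP=> i; rewrite gact1.
have [gG hG] : g \in G /\ h \in G by move: gI hI; rewrite !inE => /andP[-> _] /andP[].
rewrite inE groupM //; apply/forallP=> i.
by rewrite -gact_comp // modlin_inertia // modlin_inertia.
Qed.
Definition inertia_group := Group inertia_group_set.

Lemma inertia_sub : inertia \subset G.
Proof. by apply/subsetP=> g; rewrite inE => /andP[]. Qed.

Lemma inertiaG g : g \in inertia -> g \in G.
Proof. exact/subsetP/inertia_sub. Qed.

Definition shear g i : C := (invmx (rG g) i0 i - (i == i0)%:R) / c i0.

Definition chi g : C := 1 + \sum_i c i * shear g i.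

Lemma gact_shear g i : g \in inertia -> gact g (x_ i) = x_ i + k_ (shear g i) * L.
Proof.
rewrite inE => /andP[gG /forallP/(_ i)/eqP].
rewrite gact_var modlin_lin modlin_var => /eqP; rewrite subr_eq => /eqP ->.
by rewrite -addrA; congr (_ + _); rewrite /shear mulrBl rmorphB; ring.
Qed.

Lemma gact_L g : g \in inertia -> gact g L = k_ (chi g) * L.
Proof.
move=> gI; rewrite {1}/L /lin rmorph_sum /=.
under eq_bigr => i _ do rewrite rmorphM gact_cst /= gact_shear // mulrDr mulrA -rmorphM.
by rewrite big_split -mulr_suml -rmorph_sum /= /chi rmorphD rmorph1 mulrDl mul1r.
Qed.

Lemma chiM g h : g \in inertia -> h \in inertia -> chi (g * h)%g = chi g * chi h.
Proof.
move=> gI hI; apply: k_inj; apply: (mulIf L_neq0).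
rewrite -gact_L; last exact: (@groupM _ inertia_group).
rewrite -gact_comp ?inertiaG // (gact_L gI) rmorphM gact_cst /= gact_L //.
by rewrite rmorphM mulrA.
Qed.

Lemma chi1 : chi 1%g = 1.
Proof.
apply: k_inj; apply: (mulIf L_neq0); rewrite -gact_L ?gact1 ?rmorph1 ?mul1r //.
exact: (@group1 _ inertia_group).
Qed.

Lemma chi_neq0 g : g \in inertia -> chi g != 0.
Proof.
move=> gI; apply/eqP => h; have := chi1; rewrite -(mulgV g) chiM ?h ?mul0r //.
  by move/eqP; rewrite eq_sym oner_eq0.
exact: (@groupVr _ inertia_group).
Qed.

Lemma chi_eq1 g : g \in inertia -> chi g = 1 -> g = 1%g.
Proof.
move=> gI hg; apply: gact_fix_var => [|i]; first exact: inertiaG.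
have gX k : gact (g ^+ k)%g (x_ i) = x_ i + (k_ (shear g i) * L) *+ k.
  elim: k => [|k IH]; first by rewrite gact1 mulr0n addr0.
  rewrite expgSr -gact_comp ?inertiaG //; last exact: (@groupX _ inertia_group).
  rewrite IH rmorphD rmorphMn rmorphM gact_cst /= gact_L // hg rmorph1 mul1r.
  by rewrite gact_shear // -addrA mulrS.
have /eqP := gX #[g]%g; rewrite expg_order gact1 -subr_eq0 opprD addNKr oppr_eq0.
rewrite -mulr_natl mulf_eq0; case: #[g]%g (order_gt0 g) => // n _.
by rewrite (negPf (natS_neq0 n)) /= gact_shear // => /eqP ->; rewrite addr0.
Qed.

Lemma chi_inj g h : g \in inertia -> h \in inertia -> chi g = chi h -> g = h.
Proof.
move=> gI hI E; have hV : (h^-1)%g \in inertia by exact: (@groupVr _ inertia_group).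
apply/eqP; rewrite -(mulgK h^-1%g g) invgK -[h in _ == h]mul1g; apply/eqP; congr (_ * _)%g.
apply: chi_eq1; first exact: (@groupM _ inertia_group).
by rewrite chiM // E -chiM // mulgV chi1.
Qed.

Let e := #|inertia|.

Lemma inertia_card : (0 < e)%N.
Proof. exact: (@cardG_gt0 _ inertia_group). Qed.

Lemma natC_neq0 n : (0 < n)%N -> n%:R != 0 :> C.
Proof. by rewrite pnatr_eq0; case: n. Qed.

Definition avg_var i : S := \sum_(h in inertia) gact h (x_ i).

Definition norm_L : S := \prod_(h in inertia) gact h L.

Lemma gact_avg_var g i : g \in inertia -> gact g (avg_var i) = avg_var i.
Proof.
move=> gI; rewrite rmorph_sum [RHS](reindex_inj (mulIg g)) /=.
rewrite [RHS](eq_bigl (mem inertia)) => [|h]; last exact: (@groupMr _ inertia_group).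
by apply: eq_bigr => h hI; rewrite gact_comp ?inertiaG.
Qed.

Lemma gact_norm_L g : g \in inertia -> gact g norm_L = norm_L.
Proof.
move=> gI; rewrite rmorph_prod [RHS](reindex_inj (mulIg g)) /=.
rewrite [RHS](eq_bigl (mem inertia)) => [|h]; last exact: (@groupMr _ inertia_group).
by apply: eq_bigr => h hI; rewrite gact_comp ?inertiaG.
Qed.

Lemma avg_varE i : avg_var i = k_ e%:R * x_ i + k_ (\sum_(h in inertia) shear h i) * L.
Proof.
rewrite /avg_var (eq_bigr _ (fun h hI => gact_shear i hI)) big_split /=.
by rewrite sumr_const -mulr_suml -rmorph_sum /= rmorph_nat mulr_natl.
Qed.

Lemma norm_LE : norm_L = k_ (\prod_(h in inertia) chi h) * L ^+ e.
Proof.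
rewrite /norm_L (eq_bigr _ (fun h hI => gact_L hI)) big_split /=.
by rewrite prodr_const -rmorph_prod.
Qed.

(* Up to the constant [e], the forms [z i] are the differentials of linear    *)
(* coordinates in which the inertia group is diagonal.                        *)
Definition coord_form i : form :=
  if i == i0 then pdiff P L else pdiff P (avg_var i).

Lemma oneform_coord_form i : is_oneform (coord_form i).
Proof. by rewrite /coord_form; case: eqP => _; apply: oneform_pdiff. Qed.

Lemma span_coord_form i : in_span coord_form (edx S i).
Proof.
have hL : in_span coord_form (pdiff P L).
  by have := in_span_gen coord_form i0; rewrite {2}/coord_form eqxx.
have hi j : j != i0 -> in_span coord_form (edx S j).
  move=> ji; have := in_spanD (in_span_gen coord_form j)
    (in_spanN (in_spanZ (k_ (\sum_(h in inertia) shear h j)) hL)).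
  rewrite {2}/coord_form (negPf ji) avg_varE pdiffD !pdiffZ addrK pdiff_var.
  move/(in_spanZ (k_ e%:R^-1)); rewrite scalerA -rmorphM mulVf ?rmorph1 ?scale1r //.
  exact/natC_neq0/inertia_card.
have [->|] := eqVneq i i0; last exact: hi.
have := in_spanD hL (in_spanN (in_span_sum (index_enum 'I_l) (Q := fun j => j != i0)
  (F := fun j => k_ (c j) *: edx S j) (fun j ji => in_spanZ _ (hi j ji)))).
rewrite pdiff_lin (bigD1 i0) //= addrK => /(in_spanZ (k_ (c i0)^-1)).
by rewrite scalerA -rmorphM mulVf // rmorph1 scale1r.
Qed.

Definition const_form a := forall I, exists c', a I = k_ c'.

Lemma const_formD a b : const_form a -> const_form b -> const_form (a + b).
Proof.
move=> ha hb I; have [a' Ea] := ha I; have [b' Eb] := hb I.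
by exists (a' + b'); rewrite ffunE Ea Eb rmorphD.
Qed.

Lemma const_formZ c' a : const_form a -> const_form (k_ c' *: a).
Proof.
by move=> ha I; have [a' Ea] := ha I; exists (c' * a'); rewrite formZE Ea rmorphM.
Qed.

Lemma const_form_wedge a b : const_form a -> const_form b -> const_form (ewedge a b).
Proof.
move=> ha hb K; rewrite ffunE; apply: (big_ind (fun p => exists c', p = k_ c')).
- by exists 0; rewrite rmorph0.
- by move=> p q [p' ->] [q' ->]; exists (p' + q'); rewrite rmorphD.
move=> I _; have [a' ->] := ha I; have [b' ->] := hb (K :\: I).
by exists ((-1) ^+ inversions I (K :\: I) * a' * b'); rewrite !rmorphM rmorphXn rmorphN1.
Qed.

Lemma const_form_ebasis I : const_form (ebasis S I).
Proof. by move=> J; exists (J == I)%:R; rewrite ebasisE rmorph_nat. Qed.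

Lemma const_form_coord i : const_form (coord_form i).
Proof.
have hL : const_form (pdiff P L).
  rewrite pdiff_lin; apply: big_ind => [||j _].
  - by move=> I; exists 0; rewrite ffunE rmorph0.
  - by move=> a b; apply: const_formD.
  - exact/const_formZ/const_form_ebasis.
rewrite /coord_form; case: eqP => // _; rewrite avg_varE pdiffD !pdiffZ pdiff_var.
by apply: const_formD; apply: const_formZ => //; apply: const_form_ebasis.
Qed.

Lemma top_coord_form : exists2 c', c' != 0 & top (ewedge_set coord_form setT) = k_ c'.
Proof.
have hc I : const_form (ewedge_set coord_form I).
  elim/set_min_ind: I => [|i I iI IH].
    by rewrite ewedge_set0; apply: const_form_ebasis.
  by rewrite ewedge_setU1 //; apply: const_form_wedge => //; apply: const_form_coord.
have [c' hc'] := hc setT setT; exists c' => //.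
have [s hs] := top_span oneform_coord_form span_coord_form.
apply: contraTneq (oner_neq0 S) => c0; rewrite negbK -(top_ebasis S l).
by rewrite -ewedge_set_dx hs /top hc' c0 rmorph0 mul0r.
Qed.

Lemma inertia_det g : g \in inertia ->
  top (eact P (rG g) (ebasis S setT)) = k_ (chi g).
Proof.
move=> gI; have [c' c'0 hc'] := top_coord_form.
have kc' : k_ c' != 0 by rewrite fmorph_eq0.
apply: (mulfI kc'); rewrite -{1}(gact_cst g) -hc' -top_eact eact_wedge_set.
rewrite (eq_ewedge_set (z := fun i => (if i == i0 then k_ (chi g) else 1) *: coord_form i)).
  rewrite ewedge_setZ topZ mulrC; congr (_ * _).
  rewrite (bigD1 i0) ?inE //= eqxx big1 ?mulr1 // => i /andP[_ /negPf ->] //.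
move=> i _; rewrite /coord_form; case: eqP => _; rewrite eact_pdiff.
  by have := gact_L gI; rewrite /gact => ->; rewrite pdiffZ.
by have := gact_avg_var i gI; rewrite /gact => ->; rewrite scale1r.
Qed.

Lemma anti_dvd p (j : nat) : anti p -> (j < e)%N -> exists q, p = L ^+ j * q.
Proof.
move=> hp; elim: j => [|j IH] je; first by exists p; rewrite mul1r.
have [q Eq] := IH (ltnW je).
have [g gI hg] : exists2 g, g \in inertia & chi g ^+ j.+1 != 1.
  apply/exists_inP; rewrite -negb_forall_in; apply/negP => /forall_inP h.
  have j0 : (0 < j.+1)%N by [].
  have X0 : 'X^(j.+1) - 1 != 0 :> {poly C} by rewrite -size_poly_eq0 size_XnsubC.
  have := @max_poly_roots _ _ [seq chi g | g <- enum inertia] X0.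
  rewrite size_XnsubC // size_map -cardE ltnS leqNgt je.
  have -> : all (root ('X^(j.+1) - 1)) [seq chi g | g <- enum inertia].
    rewrite all_map; apply/allP=> g; rewrite mem_enum => gI /=.
    by rewrite /root !hornerE subr_eq0; apply: h.
  have -> : uniq [seq chi g | g <- enum inertia].
    rewrite map_inj_in_uniq ?enum_uniq // => g h' ; rewrite !mem_enum.
    exact: chi_inj.
  by move=> /(_ isT isT).
have Lj : L ^+ j != 0 by rewrite expf_neq0 // L_neq0.
have E : gact g q * k_ (chi g ^+ j.+1) = q.
  apply: (mulfI Lj); rewrite -Eq -[RHS](hp g (inertiaG gI)) inertia_det //.
  have -> : gact g p = k_ (chi g ^+ j) * L ^+ j * gact g q.
    by rewrite Eq rmorphM rmorphXn /= gact_L // exprMn rmorphXn.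
  by rewrite exprSr rmorphM /=; ring.
have : modlin q = 0.
  have /eqP := congr1 modlin E; rewrite rmorphM modlin_inertia // {2}/modlin psubst_cst.
  rewrite -subr_eq0 -{2}[modlin q]mulr1 -mulrBr mulf_eq0 => /orP[/eqP //|].
  by rewrite -(rmorph1 k_) -rmorphB fmorph_eq0 subr_eq0 (negPf hg).
by move=> /modlin_dvd[q' Eq']; exists q'; rewrite Eq Eq' exprSr mulrA.
Qed.

Lemma pdiffX p n : pdiff P (p ^+ n.+1) = (n.+1%:R * p ^+ n) *: pdiff P p.
Proof.
elim: n => [|n IH]; first by rewrite expr1 mulr1 scale1r.
rewrite exprS pdiffM IH scalerA -scalerDl; congr (_ *: _).
by rewrite [in RHS]mulrSr exprS; ring.
Qed.

Lemma jac_local : exists G1 s, modlin G1 != 0 /\ G1 * L ^+ e.-1 = jac * s.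
Proof.
have [n hn] : exists n : nat, forall g, g \in G :\: inertia ->
    \sum_(i < l) n%:R ^+ i * modlin (x_ i - gact g (x_ i)) != 0.
  apply: generic_combination => [|g]; first exact: natS_neq0.
  rewrite inE => /andP[gI gG]; move: gI; rewrite inE gG /= negb_forall.
  by move=> /existsP[i hi]; exists i; rewrite rmorphB subr_eq0 eq_sym.
pose lam := lin (fun i : 'I_l => n%:R ^+ i).
have hlam g : g \in G :\: inertia -> modlin lam - modlin (gact g lam) != 0.
  move/hn; apply: contra => /eqP h; apply/eqP; rewrite -[RHS]h /lam /lin !rmorph_sum -sumrB.
  apply: eq_bigr => i _; rewrite !rmorphM gact_cst /= {3 5}/modlin psubst_cst.
  by rewrite rmorphXn rmorph_nat rmorphB mulrBr.
pose Phi := \prod_(g in G :\: inertia) ('X - (gact g lam)%:P) ^+ 2.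
pose G0 := \sum_(h in inertia) Phi.[gact h lam].
have hG0 : modlin G0 != 0.
  rewrite /G0 rmorph_sum (eq_bigr (fun _ =>
    \prod_(g in G :\: inertia) (modlin lam - modlin (gact g lam)) ^+ 2)) => [|h hI].
    rewrite sumr_const -mulr_natl mulf_neq0 //.
      by rewrite -(rmorph_nat k_) fmorph_eq0 natC_neq0 // inertia_card.
    by apply/prodf_neq0 => g /hlam h; rewrite expf_neq0.
  rewrite /Phi horner_prod rmorph_prod; apply: eq_bigr => g _.
  by rewrite horner_exp hornerXsubC rmorphXn rmorphB /= (modlin_inertia lam hI).
have h1 i : in_span gdf (G0 *: pdiff P (avg_var i)).
  by apply: interpolation inertia_sub _ => h; apply: gact_avg_var.
have h2 : in_span gdf ((G0 * L ^+ e.-1) *: pdiff P L).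
  have := interpolation lam inertia_sub gact_norm_L; rewrite -/Phi -/G0.
  set a := \prod_(h in inertia) chi h.
  have a0 : a * e%:R != 0.
    rewrite mulf_neq0 ?natC_neq0 ?inertia_card //.
    by apply/prodf_neq0 => h; apply: chi_neq0.
  rewrite norm_LE -/a pdiffZ -{1}(prednK inertia_card) pdiffX prednK ?inertia_card //.
  move/(in_spanZ (k_ (a * e%:R)^-1)); rewrite !scalerA; congr (in_span _ (_ *: _)).
  have K : k_ (a * e%:R)^-1 * k_ (a * e%:R) = 1 by rewrite -rmorphM mulVf ?rmorph1.
  have R (u y z X E : S) : u * (y * E) = 1 -> u * z * (y * (E * X)) = z * X.
    by move=> h; rewrite -[RHS]mul1r -h; ring.
  by apply: R; rewrite -[RHS]K [X in _ = _ * X]rmorphM rmorph_nat.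
have [c' c'0 hc'] := top_coord_form.
have [s hs] : exists s, top (ewedge_set (fun i =>
    (if i == i0 then G0 * L ^+ e.-1 else G0) *: coord_form i) setT) = jac * s.
  apply: top_span => [|i]; first exact: oneform_gdf.
  by rewrite /coord_form; case: eqP.
exists (G0 ^+ l * k_ c'), s; split.
  rewrite rmorphM {2}/modlin psubst_cst mulf_neq0 ?fmorph_eq0 //.
  by rewrite rmorphXn expf_neq0.
rewrite -hs ewedge_setZ topZ hc' (bigD1 i0) ?inE //= eqxx.
rewrite (eq_bigr (fun=> G0)) => [|i /andP[_ /negPf ->] //].
rewrite prodr_const (_ : #|_| = l.-1); last first.
  have := cardC1 i0; rewrite card_ord => <-; apply: eq_card => i.
  by rewrite [LHS]unfold_in /= in_setT inE.
have -> : G0 ^+ l = G0 * G0 ^+ l.-1 by rewrite -exprS (ltn_predK (ltn_ord i0)).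
rewrite -!mulrA [k_ c' * _]mulrC; congr (_ * _); exact: mulrCA.
Qed.

Lemma anti_local p : anti p -> exists G1 s, modlin G1 != 0 /\ G1 * p = jac * s.
Proof.
move=> hp; have [G1 [s [hG1 hs]]] := jac_local.
have he : (e.-1 < e)%N by rewrite ltn_predL inertia_card.
have [q ->] := anti_dvd hp he.
by exists G1, (s * q); split=> //; rewrite mulrA hs mulrA.
Qed.
End LinearForm.

Lemma span_vars (D : idomainType) (phi : {rmorphism S -> D}) :
  (forall n, n.+1%:R != 0 :> D) ->
  (forall g, g \in G :\ 1%g -> exists i, phi (x_ i - gact g (x_ i)) != 0) ->
  exists m : 'I_l -> C,
    let G0 := \prod_(g in G :\ 1%g) (lin m - gact g (lin m)) ^+ 2 in
    phi G0 != 0 /\ forall i, in_span gdf (G0 *: edx S i).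
Proof.
move=> D0 /(generic_combination D0)[n hn].
pose m (i : 'I_l) : C := n%:R ^+ i; exists m => G0; split.
  rewrite rmorph_prod; apply/prodf_neq0 => g hg; rewrite rmorphXn expf_neq0 //.
  apply: contra (hn g hg) => /eqP h; apply/eqP; rewrite -[RHS]h /lin !rmorph_sum -sumrB.
  rewrite rmorph_sum; apply: eq_bigr => i _; rewrite !rmorphM gact_cst /=.
  by rewrite -mulrBr /m rmorphM !rmorphXn !rmorph_nat.
move=> i; have h1 h : h \in [set 1%g] -> gact h (x_ i) = x_ i.
  by move/set1P->; rewrite gact1.
have := interpolation (lin m) _ h1; rewrite sub1set group1 => /(_ isT).
rewrite pdiff_var /= big_set1 gact1 horner_prod.
by under eq_bigr => g _ do rewrite horner_exp hornerXsubC.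
Qed.

Lemma span_vars_generic : exists m : 'I_l -> C,
    let G0 := \prod_(g in G :\ 1%g) (lin m - gact g (lin m)) ^+ 2 in
    G0 != 0 /\ forall i, in_span gdf (G0 *: edx S i).
Proof.
apply: (@span_vars S idfun) => [|g]; first exact: natS_neq0.
move=> /setD1P[g1 gG]; apply/existsP; rewrite -negb_forall; apply: contra g1.
move/forallP=> h; apply/eqP; apply: gact_fix_var => // i.
by have := h i; rewrite subr_eq0 => /eqP.
Qed.

Lemma jac_dvd_span G0 : (forall i, in_span gdf (G0 *: edx S i)) ->
  exists s, G0 ^+ l = jac * s.
Proof.
move=> /(top_span oneform_gdf)[s hs]; exists s; rewrite -hs ewedge_setZ topZ.
by rewrite ewedge_set_dx top_ebasis mulr1 prodr_const cardsT card_ord.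
Qed.

Lemma jac_neq0 : jac != 0.
Proof.
have [m [G0 /jac_dvd_span[s hs]]] := span_vars_generic.
by apply: contraNneq G0 => j0; move/eqP: hs; rewrite j0 mul0r expf_eq0 => /andP[].
Qed.

Lemma jac_dvd p : (forall (m : 'I_l -> C) i0, m i0 != 0 ->
    exists G1 s, modlin m i0 G1 != 0 /\ G1 * p = jac * s) ->
  exists s, p = jac * s.
Proof.
pose loc p := forall (m : 'I_l -> C) i0, m i0 != 0 ->
  exists G1 s, modlin m i0 G1 != 0 /\ G1 * p = jac * s.
pose good F := forall p, loc p -> (exists s, F * p = jac * s) -> exists s, p = jac * s.
have good1 : good 1 by move=> q _; rewrite mul1r.
have goodM F F' : good F -> good F' -> good (F * F').
  move=> hF hF' q lq; rewrite -mulrA => /hF h; apply: hF' => //; apply: h => m i0 hm.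
  have [G1 [s [hG1 hs]]] := lq m i0 hm.
  by exists G1, (F' * s); split=> //; rewrite mulrCA hs; ring.
have good_lin m : lin m != 0 -> good (lin m).
  move=> m0 q lq [u hu].
  have [i0 hi0] : exists i0, m i0 != 0.
    apply/existsP; rewrite -negb_forall; apply: contra m0 => /forallP h.
    rewrite /lin big1 // => i _; have /eqP -> := h i.
    by rewrite rmorph0 mul0r.
  have [G1 [w [hG1 hw]]] := lq m i0 hi0.
  have E : G1 * u = lin m * w.
    by apply: (mulfI jac_neq0); rewrite mulrCA -hu mulrCA hw mulrCA.
  have : modlin m i0 u = 0.
    have /eqP := congr1 (modlin m i0) E; rewrite !rmorphM modlin_L // mul0r mulf_eq0.
    by rewrite (negPf hG1) => /eqP.
  move=> /(modlin_dvd)[u' hu']; exists u'; apply: (mulfI m0).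
  by rewrite hu hu' mulrCA.
move=> lp; have [m [G0 hG0]] := span_vars_generic.
set F := \prod_(g in _) _ in G0 hG0.
have gF : good F.
  rewrite /F; move: G0; rewrite prodf_seq_neq0 => /allP h.
  apply: (big_ind good) => // g hg; have := h g (mem_index_enum g).
  rewrite hg /= expf_eq0 /= gact_lin linB => hm.
  by rewrite expr2; apply: goodM; apply: good_lin.
have gFl k : good (F ^+ k) by elim: k => [|k IH]; rewrite ?exprS //; apply: goodM.
apply: (gFl l) => //; have [s ->] := jac_dvd_span hG0.
by exists (s * p); rewrite mulrA.
Qed.

Lemma anti_jac p : anti p -> exists2 q, ginv q & p = jac * q.
Proof.
move=> hp; have [q hq] : exists q, p = jac * q.
  by apply: jac_dvd => m i0 hm; apply: anti_local.
exists q => // g gG; have := hp g gG; rewrite hq rmorphM mulrAC jac_anti //.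
exact/mulfI/jac_neq0.
Qed.

Lemma top_invariant a : (forall g, g \in G -> eact P (rG g) a = a) ->
  exists2 q, ginv q & top a = jac * q.
Proof. by move=> ha; apply: anti_jac => g gG; rewrite /gact -top_eact ha. Qed.

End Invariants.

(** * Points with prescribed values of the invariants *)

Lemma prim_root_exists (C : numClosedFieldType) (h : nat) : (0 < h)%N ->
  exists z : C, h.-primitive_root z.
Proof.
move=> h0; have [rs Ers] := closed_field_poly_normal ('X^h - 1 : {poly C}).
have lc : lead_coef ('X^h - 1 : {poly C}) = 1 by rewrite lead_coefXnsubC.
rewrite lc scale1r in Ers.
have szrs : size rs = h.
  by have := congr1 (fun p : {poly C} => size p) Ers; rewrite size_XnsubC // size_prod_XsubC => -[].
have urs : uniq rs.
  rewrite -separable_prod_XsubC -Ers; apply: separable_Xn_sub_1.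
  by rewrite pnatr_eq0 -lt0n.
have rrs : all h.-unity_root rs.
  by apply/allP=> z zr; rewrite /root_of_unity Ers root_prod_XsubC.
have := has_prim_root h0 rrs urs; rewrite szrs leqnn => /(_ isT)/hasP[z _ hz].
by exists z.
Qed.

Section Ideals.
Variable S : comNzRingType.

Definition is_ideal (I : S -> Prop) :=
  [/\ I 0, forall a b, I a -> I b -> I (a + b) & forall s a, I a -> I (s * a)].

Definition add_gen (I : S -> Prop) (a : S) (p : S) := exists q s, I q /\ p = q + s * a.

Lemma is_ideal_add_gen I a : is_ideal I -> is_ideal (add_gen I a).
Proof.
move=> [I0 ID IM]; split.
- by exists 0, 0; rewrite mul0r addr0.
- move=> _ _ [q [s [Iq ->]]] [q' [s' [Iq' ->]]]; exists (q + q'), (s + s'); split.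
    exact: ID.
  by ring.
- move=> r _ [q [s [Iq ->]]]; exists (r * q), (r * s); split; first exact: IM.
  by ring.
Qed.

Lemma add_gen_sub I a p : I p -> add_gen I a p.
Proof. by exists p, 0; rewrite mul0r addr0. Qed.

Lemma add_gen_gen I a : is_ideal I -> add_gen I a a.
Proof. by move=> [I0 _ _]; exists 0, 1; rewrite mul1r add0r. Qed.

Lemma proper_add_gen I (T : eqType) (rs : seq T) (a : T -> S) : is_ideal I -> ~ I 1 ->
  I (\prod_(r <- rs) a r) -> exists r, ~ add_gen I (a r) 1.
Proof.
move=> iI nI hI; apply: NNPP => h; apply: nI.
have [I0 ID IM] := iI.
have hr r : add_gen I (a r) 1.
  by apply: NNPP => h'; apply: h; exists r.
have : add_gen I (\prod_(r <- rs) a r) 1.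
  elim: rs {hI} => [|r rs [q2 [s2 [Iq2 E2]]]].
    by exists 0, 1; rewrite big_nil mulr1 add0r.
  have [q1 [s1 [Iq1 E1]]] := hr r.
  exists (q1 * (q2 + s2 * \prod_(r <- rs) a r) + s1 * a r * q2), (s1 * s2); split.
    by apply: ID; [rewrite mulrC|]; apply: IM.
  by rewrite big_cons -{1}[1]mulr1 {1}E1 {1}E2; ring.
by move=> [q [s [Iq ->]]]; apply: ID => //; apply: IM.
Qed.
End Ideals.

Section Point.
Variables (C : numClosedFieldType) (l : nat) (S : idomainType).
Variable P : poly_alg C l S.
Variables (gT : finGroupType) (G : {group gT}) (rG : mx_representation C G l).
Variable f : 'I_l -> S.
Local Notation k_ := (pcst P).
Local Notation x_ := (pvar P).
Local Notation gact := (gact P rG).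
Hypothesis f_gen : forall p, ginv P rG p <-> exists q, p = psubst P f q.
Hypothesis f_indep : forall q, psubst P f q = 0 -> q = 0.

(* The values of the basic invariants can be prescribed: averaging over the   *)
(* group shows that the ideal (f_j - c_j) is proper, and each coordinate is   *)
(* integral over the invariants, so it can be given a value in turn.          *)
Lemma exists_point (c : 'I_l -> C) : exists v, forall j, peval P v (f j) = c j.
Proof.
pose I0 p := exists s : 'I_l -> S, p = \sum_j s j * (f j - k_ (c j)).
have iI0 : is_ideal I0.
  split.
  - by exists (fun=> 0); rewrite big1 // => j _; rewrite mul0r.
  - move=> _ _ [s ->] [t ->]; exists (fun j => s j + t j); rewrite -big_split.
    by apply: eq_bigr => j _; rewrite mulrDl.
  - move=> r _ [s ->]; exists (fun j => r * s j); rewrite mulr_sumr.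
    by apply: eq_bigr => j _; rewrite mulrA.
have I0gen j : I0 (f j - k_ (c j)).
  exists (fun i => (i == j)%:R); rewrite (bigD1 j) //= eqxx mul1r big1 ?addr0 // => i.
  by move=> /negPf ->; rewrite mul0r.
have f_inv j : ginv P rG (f j).
  by apply/f_gen; exists (x_ j); rewrite psubst_var.
have nI0 : ~ I0 1.
  move=> [s hs].
  have [q hq] : exists q : 'I_l -> S, forall j, \sum_(g in G) gact g (s j) = psubst P f (q j).
    by apply: (fin_all_exists (P := fun j q => _ = psubst P f q)) => j; apply/f_gen/ginv_sum.
  have := f_indep (q := #|G|%:R - \sum_j q j * (x_ j - k_ (c j))).
  rewrite rmorphB rmorph_nat rmorph_sum /= => H.
  have /H/(congr1 (peval P c))/eqP : #|G|%:R - \sum_j psubst P f (q j * (x_ j - k_ (c j))) = 0.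
    apply/eqP; rewrite subr_eq0; apply/eqP.
    transitivity (\sum_(g in G) gact g 1).
      by rewrite (eq_bigr (fun=> 1)) ?sumr_const // => g _; rewrite rmorph1.
    rewrite hs (eq_bigr (fun g => \sum_j gact g (s j) * (f j - k_ (c j)))) => [|g gG].
      rewrite exchange_big; apply: eq_bigr => j _ /=.
      by rewrite -mulr_suml hq rmorphM rmorphB psubst_var psubst_cst.
    rewrite rmorph_sum; apply: eq_bigr => j _; rewrite rmorphM rmorphB /= f_inv //.
    by rewrite gact_cst.
  rewrite rmorphB rmorph_nat rmorph_sum rmorph0 big1 ?subr0 => [|j _].
    by rewrite pnatr_eq0 eqn0Ngt cardG_gt0.
  by rewrite rmorphM rmorphB peval_var peval_cst subrr mulr0.
have I0val a : ginv P rG a -> exists b, I0 (a - k_ b).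
  move=> /f_gen[q ->]; exists (peval P c q).
  have [I00 I0D I0M] := iI0.
  elim/(@poly_alg_ind _ _ _ P): q => [b|s|p q hp hq|p q hp hq].
  - by rewrite psubst_cst peval_cst subrr.
  - by rewrite psubst_var peval_var.
  - by have := I0D _ _ hp hq; rewrite !rmorphD; congr I0; ring.
  - have := I0D _ _ (I0M (psubst P f q) _ hp) (I0M (k_ (peval P c p)) _ hq).
    by rewrite !rmorphM /=; congr I0; ring.
have step (vs : seq 'I_l) : exists I, [/\ is_ideal I, ~ I 1,
    (forall p, I0 p -> I p) & forall i, i \in vs -> exists r, I (x_ i - k_ r)].
  elim: vs => [|i vs [I [iI nI hI hr]]]; first by exists I0.
  have [II0 ID IM] := iI.
  pose Q : {poly S} := \prod_(g in G) ('X - (gact g (x_ i))%:P).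
  have Qsz : size Q = #|G|.+1 by rewrite /Q -big_enum size_prod_XsubC -cardE.
  have Qmon : Q \is monic by rewrite /Q -big_enum; apply: monic_prod_XsubC.
  have Qinv m : ginv P rG Q`_m.
    move=> g gG; have E : map_poly (gact g) Q = Q.
      rewrite rmorph_prod [RHS](reindex_inj (mulIg g)) /=.
      rewrite [RHS](eq_bigl (mem G)) => [|h]; last by rewrite groupMr.
      by apply: eq_bigr => h hG; rewrite rmorphB /= map_polyX map_polyC /= gact_comp.
    by rewrite -[in RHS]E coef_map.
  have [b hb] : exists b : 'I_#|G| -> C, forall m : 'I_#|G|, I0 (Q`_m - k_ (b m)).
    by apply: (fin_all_exists (P := fun (m : 'I_#|G|) b => I0 (Q`_m - k_ b))) => m; apply: I0val.
  pose p : {poly C} := 'X^#|G| + \poly_(m < #|G|) (if insub m is Some m' then b m' else 0).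
  have pmon : lead_coef p = 1.
    by rewrite lead_coefDl ?lead_coefXn // size_polyXn ltnS size_poly.
  have [rs Ers] := closed_field_poly_normal p; rewrite pmon scale1r in Ers.
  have : I (\prod_(r <- rs) (x_ i - k_ r)).
    have -> : \prod_(r <- rs) (x_ i - k_ r) = (map_poly k_ p).[x_ i].
      rewrite Ers rmorph_prod horner_prod; apply: eq_bigr => r _.
      by rewrite rmorphB /= map_polyX map_polyC !hornerE.
    have -> : (map_poly k_ p).[x_ i] = - \sum_(m < #|G|) (x_ i ^+ m) * (Q`_m - k_ (b m)).
      have Q0 : Q.[x_ i] = 0.
        rewrite horner_prod (bigD1 1%g) //= gact1 hornerXsubC subrr mul0r //.
      have : Q.[x_ i] = x_ i ^+ #|G| + \sum_(m < #|G|) Q`_m * x_ i ^+ m.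
        rewrite horner_coef Qsz big_ord_recr /= addrC; congr (_ + _).
        by have := monicP Qmon; rewrite lead_coefE Qsz /= => ->; rewrite mul1r.
      rewrite Q0 => /esym/eqP; rewrite addr_eq0 => /eqP EQ.
      rewrite rmorphD /= map_polyXn hornerD hornerXn EQ -sumrN.
      rewrite -!sumrN (_ : (map_poly k_ _).[_] = \sum_(m < #|G|) k_ (b m) * x_ i ^+ m).
        by rewrite -big_split; apply: eq_bigr => m _ /=; ring.
      rewrite (@horner_coef_wide _ #|G|).
        by apply: eq_bigr => m _; rewrite coef_map coef_poly ltn_ord valK.
      by rewrite size_map_poly size_poly.
    rewrite -sumrN; apply: big_ind => // m _.
    by rewrite -mulrN -[- (_ - _)]mulN1r mulrA; apply/IM/hI/hb.
  move/(proper_add_gen iI nI) => [r hr'].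
  exists (add_gen I (x_ i - k_ r)); split=> //.
  - exact: is_ideal_add_gen.
  - by move=> q /hI; apply: add_gen_sub.
  - move=> i'; rewrite inE => /predU1P[->|/hr[r' hr'']].
      by exists r; apply: add_gen_gen.
    by exists r'; apply: add_gen_sub.
have [I [[I00 ID IM] nI hI hr]] := step (enum 'I_l).
have [v hv] : exists v : 'I_l -> C, forall i, I (x_ i - k_ (v i)).
  by apply: (fin_all_exists (P := fun i r => I (x_ i - k_ r))) => i; apply: hr; rewrite mem_enum.
have Iv p : I (p - k_ (peval P v p)).
  elim/(@poly_alg_ind _ _ _ P): p => [b|s|p q hp hq|p q hp hq].
  - by rewrite peval_cst subrr.
  - by rewrite peval_var.
  - by have := ID _ _ hp hq; rewrite !rmorphD; congr I; ring.
  - have := ID _ _ (IM q _ hp) (IM (k_ (peval P v p)) _ hq).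
    by rewrite !rmorphM /=; congr I; ring.
exists v => j; apply/eqP; rewrite -subr_eq0; apply: contraPT nI => h; apply.
have : I (k_ (peval P v (f j) - c j)).
  have := ID _ _ (hI _ (I0gen j)) (IM (-1) _ (Iv (f j))).
  by rewrite rmorphB; congr I; ring.
by move/(IM (k_ (peval P v (f j) - c j)^-1)); rewrite -rmorphM mulVf // rmorph1.
Qed.
End Point.

Section Homogeneous.
Variables (C : numClosedFieldType) (l : nat) (S : idomainType).
Variable P : poly_alg C l S.
Local Notation k_ := (pcst P).
Local Notation x_ := (pvar P).
Local Notation d_ := (pder P).
Implicit Types (p q : S) (c : C) (v : 'I_l -> C).

Definition scaling c : {rmorphism S -> S} := psubst P (fun i => k_ c * x_ i).

Definition phomog d p :=
  (forall c, scaling c p = k_ (c ^+ d) * p) /\ \sum_i x_ i * d_ i p = k_ d%:R * p.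

Lemma peval_scaling v c p : peval P v (scaling c p) = peval P (fun i => c * v i) p.
Proof.
rewrite peval_subst; apply: eq_peval => i.
by rewrite rmorphM peval_cst peval_var.
Qed.

Lemma scaling_pact A c p : scaling c (pact P A p) = pact P A (scaling c p).
Proof.
rewrite [LHS]psubst_comp [RHS]psubst_comp; apply: eq_psubst => i.
rewrite rmorph_sum rmorphM /= pact_cst pactX mulr_sumr; apply: eq_bigr => j _.
by rewrite rmorphM /= psubst_cst psubst_var mulrCA.
Qed.

Lemma pder_scaling c i p : d_ i (scaling c p) = k_ c * scaling c (d_ i p).
Proof.
rewrite /scaling pder_subst (bigD1 i) //= pderZ pder_var eqxx mulr1 big1 ?addr0.
  by rewrite mulrC.
by move=> j ji; rewrite pderZ pder_var eq_sym (negPf ji) !mulr0.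
Qed.

Lemma peval_homog0 d p : phomog d p -> (0 < d)%N -> peval P (fun=> 0) p = 0.
Proof.
move=> [h _] d0; have := peval_scaling (fun=> 0) 0 p.
rewrite h expr0n eqn0Ngt d0 rmorph0 mul0r rmorph0 => E.
by rewrite [RHS]E; apply: eq_peval => i; rewrite mul0r.
Qed.

Lemma peval_scale_homog d p v c : phomog d p ->
  peval P (fun i => c * v i) p = c ^+ d * peval P v p.
Proof. by move=> [h _]; rewrite -peval_scaling h rmorphM peval_cst. Qed.

Lemma peval_euler d p v : phomog d p ->
  \sum_i v i * peval P v (d_ i p) = d%:R * peval P v p.
Proof.
move=> [_ /(congr1 (peval P v))]; rewrite rmorphM peval_cst => <-.
by rewrite rmorph_sum; apply: eq_bigr => i _; rewrite rmorphM peval_var.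
Qed.

Lemma peval_euler_der d p v j : phomog d.+1 p ->
  \sum_i v i * peval P v (d_ i (d_ j p)) = d%:R * peval P v (d_ j p).
Proof.
move=> [_ /(congr1 (d_ j))]; rewrite pderZ pder_sum => /(congr1 (peval P v)).
rewrite rmorph_sum rmorphM peval_cst /=.
under eq_bigr => i _ do rewrite pderM rmorphD !rmorphM /= peval_var pder_var pderC.
rewrite big_split /= (bigD1 j) //= eqxx rmorph1 mul1r big1 => [|i /negPf ij].
  by rewrite addr0 mulrSr mulrDl mul1r addrC => /addIr.
by rewrite eq_sym ij rmorph0 mul0r.
Qed.

Lemma linear_homog p : phomog 1 p -> exists m : 'I_l -> C, p = lin P m.
Proof.
move=> [h1 h2]; exists (fun i => peval P (fun=> 0) (d_ i p)).
rewrite -[LHS]mul1r -(rmorph1 k_) -[1 : C]/(1%:R) -h2; apply: eq_bigr => i _.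
rewrite mulrC; congr (_ * _); apply: scaling_cst.
have k2 : k_ 2 != 0 by rewrite fmorph_eq0 pnatr_eq0.
by apply: (mulfI k2); rewrite -pderZ -[2]expr1 -h1 pder_scaling expr1.
Qed.
End Homogeneous.

(** * Invariant forms of a duality group *)

Lemma fin_all_exists_pair (I J : finType) (T : Type) (Q : I -> J -> T -> Prop) :
  (forall i j, exists x, Q i j x) -> exists u, forall i j, Q i j (u i j).
Proof.
move=> hQ; have [u hu] := fin_all_exists (fun i => fin_all_exists (hQ i)).
by exists u.
Qed.

Section Duality.
Variables (C : numClosedFieldType) (n : nat) (S : idomainType).
Local Notation l := n.+1.
Variable P : poly_alg C l S.
Variables (gT : finGroupType) (G : {group gT}) (rG : mx_representation C G l).
Variables (f : 'I_l -> S) (theta : 'I_l -> 'I_l -> S) (d es : 'I_l -> nat).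
Local Notation k_ := (pcst P).
Local Notation x_ := (pvar P).
Local Notation d_ := (pder P).
Local Notation gact := (gact P rG).
Local Notation ginv := (ginv P rG).
Local Notation o := (@ord_max n).

Definition gder_inv (t : 'I_l -> S) := forall g, g \in G ->
  forall j, \sum_k k_ (rG g k j) * gact g (t k) = t j.

Hypothesis rG_faithful : mx_faithful rG.
Hypothesis rG_irr : mx_irreducible rG.
Hypothesis f_gen : forall p, ginv p <-> exists q, p = psubst P f q.
Hypothesis f_indep : forall q, psubst P f q = 0 -> q = 0.
Hypothesis f_homog : forall i, phomog P (d i) (f i).
Hypothesis theta_homog : forall k i, phomog P (es k) (theta k i).
Hypothesis theta_inv : forall k, gder_inv (theta k).
Hypothesis theta_gen : forall t, gder_inv t ->
  exists c : 'I_l -> S, (forall k, ginv (c k)) /\ forall i, t i = \sum_k c k * theta k i.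
Hypothesis theta_free : forall c : 'I_l -> S, (forall k, ginv (c k)) ->
  (forall i, \sum_k c k * theta k i = 0) -> forall k, c k = 0.
Hypothesis d_gt0 : forall i, (0 < d i)%N.
Hypothesis es_gt0 : forall k, (0 < es k)%N.
Hypothesis es_le : forall k, (es k <= d o)%N.

Local Notation h := (d o).

Lemma f_ginv i : ginv (f i).
Proof. by apply/f_gen; exists (x_ i); rewrite psubst_var. Qed.

Lemma d_neq1 i : d i != 1%N.
Proof.
apply/eqP => di; have [m hm] : exists m, f i = lin P m.
  by apply: linear_homog; rewrite -di.
have m_inv g : g \in G -> forall j, \sum_s rG g j s * m s = m j.
  move=> gG; have := f_ginv i (groupVr gG); rewrite hm gact_lin => h j.
  have := congr1 (d_ j) h; rewrite !pder_lin => /(@k_inj C l S P) <-.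
  by apply: eq_bigr => s _; rewrite repr_mxV // invmxK mulrC.
have [j mj] : exists j, m j != 0.
  apply/existsP; rewrite -negb_forall; apply/negP => /forallP m0.
  have /f_indep H : psubst P f (x_ i) = 0.
    by rewrite psubst_var hm /lin big1 // => s _; rewrite (eqP (m0 s)) rmorph0 mul0r.
  have := congr1 (d_ i) H; rewrite pder_var eqxx pder0 => /eqP.
  by rewrite oner_eq0.
pose y (s : 'I_l) : C := \sum_(g in G) (rG g j s).
have y_inv g : g \in G -> forall s, \sum_t rG g t s * y t = y s.
  move=> gG s; rewrite /y [RHS](reindex_inj (mulIg g)) /=.
  rewrite [RHS](eq_bigl (mem G)) => [|g']; last by rewrite groupMr.
  under eq_bigr => t _ do rewrite mulr_sumr.
  rewrite exchange_big; apply: eq_bigr => g' g'G /=.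
  by rewrite repr_mxM // mxE; apply: eq_bigr => t _; rewrite mulrC.
have [c [_ hc]] : exists c : 'I_l -> S, (forall k, ginv (c k)) /\
    forall s, k_ (y s) = \sum_k c k * theta k s.
  apply: theta_gen => g gG s; rewrite -(y_inv g gG s) rmorph_sum.
  by apply: eq_bigr => t _; rewrite gact_cst rmorphM.
have y0 s : y s = 0.
  have := congr1 (peval P (fun=> 0)) (hc s); rewrite peval_cst => ->.
  rewrite rmorph_sum big1 // => k _.
  by rewrite rmorphM /= (peval_homog0 (theta_homog k s)) ?mulr0.
have : \sum_s y s * m s = #|G|%:R * m j.
  under eq_bigr => s _ do rewrite mulr_suml.
  rewrite exchange_big (eq_bigr (fun=> m j)) => [|g gG]; last exact: m_inv.
  by rewrite sumr_const mulr_natl.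
rewrite big1 => [|s _]; last by rewrite y0 mul0r.
move/eqP; rewrite eq_sym mulf_eq0 (negPf mj) orbF pnatr_eq0 => /eqP G0.
by have := cardG_gt0 G; rewrite G0.
Qed.

Lemma theta_euler k : es k = 1%N -> exists a, forall i, theta k i = k_ a * x_ i.
Proof.
move=> ek; have [N hN] : exists N : 'I_l -> 'I_l -> C, forall i, theta k i = lin P (N i).
  apply: (fin_all_exists (P := fun i m => theta k i = lin P m)) => i.
  by apply: linear_homog; rewrite -ek; apply: theta_homog.
pose M : 'M[C]_l := \matrix_(s, i) N i s.
have cM g : g \in G -> M *m rG g = rG g *m M.
  move=> gG; have uA := repr_mx_unit rG gG.
  suff E : invmx (rG g) *m (M *m rG g) = M by rewrite -{2}E mulKVmx.
  apply/matrixP=> s j; have := congr1 (d_ s) (theta_inv k gG j).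
  rewrite hN pder_lin pder_sum => E; apply: (@k_inj C l S P).
  have EM r t : M r t = N t r by rewrite mxE.
  rewrite EM -E mxE; under [RHS]eq_bigr => t _ do rewrite hN gact_lin pderZ pder_lin -rmorphM.
  rewrite -rmorph_sum; congr (k_ _).
  under eq_bigr => t _ do rewrite mxE mulr_sumr.
  rewrite exchange_big; apply: eq_bigr => t _ /=; rewrite mulr_sumr.
  by apply: eq_bigr => r _; rewrite EM; ring.
have [a] := eigenvalue_closed M (ltn0Sn n).
rewrite /eigenvalue => ha; exists a => i; rewrite hN.
have hmod : mxmodule rG (eigenspace M a).
  apply: kermx_centg_module; apply/centgmxP => g gG.
  by rewrite mulmxBl mulmxBr cM // scalar_mxC.
have [_ _ /(_ _ hmod (submx1 _) ha)] := rG_irr.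
move=> /sub_kermxP; rewrite mul1mx => /eqP; rewrite subr_eq0 => /eqP Ma.
rewrite /lin (bigD1 i) //= big1 ?addr0 => [|j ji].
  by have := congr1 (fun X : 'M_l => X i i) Ma; rewrite !mxE eqxx mulr1n => ->.
have := congr1 (fun X : 'M_l => X j i) Ma; rewrite !mxE (negPf ji) mulr0n => ->.
by rewrite rmorph0 mul0r.
Qed.

Variable v : 'I_l -> C.
Hypothesis fv : forall j, peval P v (f j) = (j == o)%:R.

Lemma v_neq0 : exists i, v i != 0.
Proof.
apply/existsP; rewrite -negb_forall; apply/negP => /forallP v0.
have := fv o; rewrite eqxx (eq_peval P (v' := fun=> 0)) => [|i]; last exact/eqP.
rewrite (peval_homog0 (f_homog o)) // => /eqP; by rewrite eq_sym oner_eq0.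
Qed.

Definition thetav : 'M[C]_l := \matrix_(k, i) peval P v (theta k i).

Lemma thetav_unit : thetav \in unitmx.
Proof.
have [z hz] := prim_root_exists C (d_gt0 o).
have z0 : z != 0 by rewrite (prim_root_eq0 hz) -lt0n.
have zX b : z ^+ b != 0 by rewrite expf_neq0.
(* [u t] runs over the orbit of [v] under homotheties and the group, and      *)
(* [y t] is the inverse image of [v].                                         *)
pose u (t : 'I_h * gT) i : C := z ^+ t.1 * \sum_j v j * rG t.2 j i.
pose y (t : 'I_h * gT) i : C := (z ^+ t.1)^-1 * \sum_j v j * invmx (rG t.2) j i.
pose Q := [pred t : 'I_h * gT | t.2 \in G].
have yu t : t \in Q -> (forall i, y t i = v i) -> forall i, u t i = v i.
  move=> tG hy i; have uA := repr_mx_unit rG tG.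
  have E : \row_j v j *m invmx (rG t.2) = z ^+ t.1 *: \row_j v j.
    apply/rowP=> s; rewrite !mxE -(hy s) /y mulrA mulfV ?zX // mul1r.
    by apply: eq_bigr => j _; rewrite mxE.
  have := congr1 (fun X : 'rV_l => (X *m rG t.2) 0 i) E.
  rewrite mulmxKV // -scalemxAl !mxE => ->; congr (_ * _).
  by apply: eq_bigr => j _; rewrite mxE.
pose R := [pred t | (t \in Q) && [exists i, y t i != v i]].
have [m hm] : exists m : 'I_l -> C, forall t, t \in R -> \sum_i m i * y t i != \sum_i m i * v i.
  have [|t|N hN] := @generic_combination C l _ R (fun t i => y t i - v i).
  - by move=> N; rewrite pnatr_eq0.
  - by move=> /andP[_ /existsP[i hi]]; exists i; rewrite subr_eq0.
  exists (fun i => N%:R ^+ i) => t tR; rewrite -subr_eq0 -sumrB.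
  by under eq_bigr => i _ do rewrite -mulrBr; apply: hN.
pose lv (w : 'I_l -> C) := \sum_i m i * w i.
pose F : S := \prod_(t in R) (lin P m - k_ (lv (y t))) ^+ 2.
pose sF (t : 'I_h * gT) : S := scaling P (z ^+ t.1)^-1 (gact t.2 F).
pose T i := \sum_(t in Q) sF t * (x_ i - k_ (u t i)).
have T_inv : gder_inv T.
  move=> g gG i; rewrite /T.
  under eq_bigr => j _ do rewrite rmorph_sum mulr_sumr.
  rewrite exchange_big /=.
  have iR : injective (fun t : 'I_h * gT => (t.1, (t.2 * g)%g)).
    by move=> [b w] [b' w'] [-> /mulIg ->].
  rewrite [RHS](reindex_inj iR) [RHS](eq_bigl (mem Q)) /=; last first.
    by move=> t; rewrite !inE /= groupMr.
  apply: eq_bigr => t tG; rewrite {2}/sF /= -gact_comp // /gact scaling_pact -/(sF t).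
  under eq_bigr => j _ do rewrite rmorphM mulrCA.
  rewrite -mulr_sumr; congr (_ * _).
  under eq_bigr => j _ do rewrite rmorphB mulrBr.
  rewrite sumrB; congr (_ - _).
    under eq_bigr => j _ do rewrite pactX mulr_sumr.
    rewrite exchange_big (bigD1 i) //= [X in _ + X]big1 ?addr0 => [|s si].
      under eq_bigr => j _ do rewrite mulrA -rmorphM mulrC.
      rewrite -mulr_sumr -rmorph_sum /= (_ : \sum_j _ = 1) ?rmorph1 ?mulr1 //.
      have := congr1 (fun X : 'M_l => X i i) (mulVmx (repr_mx_unit rG gG)).
      by rewrite !mxE eqxx mulr1n => <-; apply: eq_bigr => j _; rewrite mulrC.
    under eq_bigr => j _ do rewrite mulrA -rmorphM mulrC.
    rewrite -mulr_sumr -rmorph_sum /= (_ : \sum_j _ = 0) ?rmorph0 ?mulr0 //.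
    have := congr1 (fun X : 'M_l => X s i) (mulVmx (repr_mx_unit rG gG)).
    by rewrite !mxE (negPf si) mulr0n => E; rewrite -[RHS]E; apply: eq_bigr => j _; rewrite mulrC.
  under eq_bigr => j _ do rewrite pact_cst -rmorphM.
  rewrite -rmorph_sum; congr (k_ _); rewrite /u /= repr_mxM //.
  under eq_bigr => j _ do rewrite mulrCA mulr_sumr.
  rewrite -mulr_sumr; congr (_ * _); rewrite exchange_big; apply: eq_bigr => j _ /=.
  by rewrite mxE mulr_sumr; apply: eq_bigr => s _; ring.
have sF_scale t : scaling P z (sF (ordS t.1, t.2)) = sF t.
  rewrite /sF /= [LHS]psubst_comp; apply: eq_psubst => i.
  rewrite rmorphM /= psubst_cst psubst_var mulrA -rmorphM; congr (k_ _ * _).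
  by rewrite (prim_expr_mod hz) exprS invfM mulrC mulrA mulfV // mul1r.
have T_scale i : scaling P z (T i) = k_ z * T i.
  have iR : injective (fun t : 'I_h * gT => (ordS t.1, t.2)).
    move=> [b w] [b' w'] E; have /ordS_inj -> : ordS b = ordS b' by exact: (congr1 fst E).
    by congr (_, _); exact: (congr1 snd E).
  rewrite /T rmorph_sum [LHS](reindex_inj iR) mulr_sumr.
  rewrite [LHS](eq_bigl (mem Q)) => [|t]; last by rewrite !inE.
  apply: eq_bigr => t _; rewrite rmorphM sF_scale mulrCA; congr (_ * _).
  rewrite rmorphB /= {1}/scaling psubst_var /scaling psubst_cst mulrBr -rmorphM.
  by congr (_ - k_ _); rewrite /u /= (prim_expr_mod hz) exprS mulrA.
have [p [p_inv hp]] := theta_gen T_inv.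
have p_scale k : k_ (z ^+ es k) * scaling P z (p k) = k_ z * p k.
  apply/eqP; rewrite -subr_eq0; apply/eqP.
  apply: (theta_free (c := fun k => k_ (z ^+ es k) * scaling P z (p k) - k_ z * p k))
    => [{}k g gG|i].
    rewrite rmorphB !rmorphM !gact_cst /= p_inv //; congr (_ * _ - _).
    by rewrite /gact -scaling_pact; have := p_inv k g gG; rewrite /gact => ->.
  have := T_scale i; rewrite hp rmorph_sum mulr_sumr => /eqP.
  rewrite -subr_eq0 -sumrB => /eqP E; rewrite -[RHS]E; apply: eq_bigr => {}k _.
  by have [h1 _] := theta_homog k i; rewrite rmorphM /= h1; ring.
have pv k : es k != 1%N -> peval P v (p k) = 0.
  move=> ek; have [q hq] := (iffLR (f_gen _)) (p_inv k).
  have pz : peval P v (scaling P z (p k)) = peval P v (p k).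
    rewrite peval_scaling hq !peval_subst; apply: eq_peval => j.
    rewrite (peval_scale_homog _ _ (f_homog j)) fv; case: eqP => [->|_].
      by rewrite (prim_expr_order hz) mul1r.
    by rewrite mulr0.
  have /eqP := congr1 (peval P v) (p_scale k).
  rewrite !rmorphM !peval_cst /= pz -subr_eq0 -mulrBl mulf_eq0 => /orP[|/eqP //].
  rewrite subr_eq0 -{2}[z]expr1 (eq_prim_root_expr hz).
  have := es_le k; have := es_gt0 k; rewrite leq_eqVlt eq_sym (negPf ek) /= => e1.
  rewrite leq_eqVlt => /orP[/eqP eh|eh].
    rewrite eh modnn (modn_small (_ : 1 < h)%N) //; by rewrite -eh.
  by rewrite !modn_small ?(ltn_trans e1) // (negPf ek).
have [a ha] : exists a : 'I_l -> C, forall k, es k = 1%N -> forall i, theta k i = k_ (a k) * x_ i.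
  apply: (fin_all_exists (P := fun k a => es k = 1%N -> forall i, theta k i = k_ a * x_ i)) => k.
  have [/theta_euler[a ha]|ek] := eqVneq (es k) 1%N; first by exists a.
  by exists 0 => /eqP; rewrite (negPf ek).
pose s := \sum_(k | es k == 1%N) peval P v (p k) * a k.
have sFv t : peval P v (sF t) = \prod_(t' in R) (lv (y t) - lv (y t')) ^+ 2.
  rewrite /sF /F rmorph_prod rmorph_prod rmorph_prod; apply: eq_bigr => t' _.
  rewrite !rmorphXn /= !rmorphB /= gact_cst {2}/scaling psubst_cst peval_cst gact_lin.
  congr ((_ - _) ^+ 2); rewrite peval_scaling rmorph_sum /= /lv.
  under eq_bigr => j _ do rewrite rmorphM peval_cst peval_var mulr_suml.
  rewrite exchange_big; apply: eq_bigr => i _ /=; rewrite /y mulrCA mulr_sumr mulr_sumr.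
  by apply: eq_bigr => j _; ring.
have sFv0 t : t \in R -> peval P v (sF t) = 0.
  by move=> tR; rewrite sFv (bigD1 t) //= subrr expr0n mul0r.
have dsFv0 t j : t \in R -> peval P v (d_ j (sF t)) = 0.
  move=> tR; rewrite /sF /F (bigD1 t) //= expr2 !rmorphM pderM.
  set E := scaling P _ (gact _ (lin P m - _)).
  have E0 : peval P v E = 0.
    rewrite /E !rmorphB /= gact_cst {2}/scaling psubst_cst peval_cst gact_lin.
    rewrite peval_scaling rmorph_sum /=.
    under eq_bigr => i _ do rewrite rmorphM peval_cst peval_var mulr_suml.
    apply/eqP; rewrite subr_eq0; apply/eqP.
    rewrite exchange_big; apply: eq_bigr => i _ /=; rewrite /y mulrCA mulr_sumr mulr_sumr.
    by apply: eq_bigr => i' _; ring.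
  by rewrite pderM !(rmorphD, rmorphM) /= E0 !(mul0r, mulr0, addr0).
have Tv i : peval P v (T i) = 0.
  rewrite rmorph_sum big1 // => t tQ; rewrite rmorphM rmorphB /= peval_var peval_cst.
  have [tR|tR] := boolP (t \in R); first by rewrite sFv0 // mul0r.
  rewrite yu ?subrr ?mulr0 // => i'; apply/eqP; apply: contraR tR => h'.
  by rewrite inE tQ; apply/existsP; exists i'.
have s0 : s = 0.
  have [i vi] := v_neq0; apply: (mulIf vi); rewrite mul0r -(Tv i) hp rmorph_sum mulr_suml.
  rewrite [RHS](bigID (fun k => es k == 1%N)) /= [X in _ + X]big1 ?addr0 => [|k ek].
    apply: eq_bigr => k /eqP ek; rewrite (ha k ek) !rmorphM /= peval_cst peval_var.
    by rewrite mulrA.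
  by rewrite rmorphM /= pv // mul0r.
pose c := \sum_(t in Q | t \notin R) peval P v (sF t).
have dT i j : peval P v (d_ j (T i)) = (j == i)%:R * c.
  rewrite pder_sum rmorph_sum (bigID (fun t => t \in R)) /= big1 ?add0r => [|t /andP[_ tR]].
    rewrite /c mulr_sumr; apply: eq_bigr => t /andP[tQ tR].
    have dE w : d_ j (x_ i - k_ w) = (j == i)%:R.
      by rewrite pderD pderN pder_cst pder_var oppr0 addr0.
    have vE w : peval P v (x_ i - k_ w) = v i - w by rewrite rmorphB peval_var peval_cst.
    have uv : u t i = v i.
      apply: yu => // i'; apply/eqP; apply: contraR tR => h'.
      by rewrite inE tQ; apply/existsP; exists i'.
    rewrite pderM dE rmorphD rmorphM vE uv subrr mulr0 add0r.
    by rewrite rmorphM rmorph_nat mulrC.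
  by rewrite pderM rmorphD !rmorphM /= dsFv0 // sFv0 // !mul0r addr0.
have c0 : c != 0.
  have E t : (t \in Q) && (t \notin R) ->
      peval P v (sF t) = \prod_(t' in R) (lv v - lv (y t')) ^+ 2.
    move=> /andP[tQ tR]; rewrite sFv; apply: eq_bigr => t' _; congr ((_ - _) ^+ 2).
    apply: eq_bigr => i _; congr (_ * _); apply/eqP; apply: contraR tR => h'.
    by rewrite inE tQ; apply/existsP; exists i.
  rewrite /c (eq_bigr _ E) sumr_const -mulr_natl mulf_neq0 //.
    rewrite pnatr_eq0 -lt0n; apply/card_gt0P; exists (Ordinal (d_gt0 o), 1%g).
    rewrite unfold_in; apply/andP; split; first by rewrite inE /= group1.
    rewrite inE inE /= group1 /= negb_exists; apply/forallP=> i; rewrite negbK /y /=.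
    rewrite expr0 invr1 mul1r repr_mx1 invmx1 (bigD1 i) //= mxE eqxx mulr1 big1 ?addr0 //.
    by move=> j /negPf ji; rewrite mxE ji mulr0.
  apply/prodf_neq0 => t tR; rewrite expf_neq0 // subr_eq0 eq_sym; exact: hm.
pose Y : 'M[C]_l := \matrix_(j, k) peval P v (d_ j (p k)).
have YM : Y *m thetav = c%:M.
  apply/matrixP=> j i; rewrite !mxE -mulr_natl -(dT i j) hp pder_sum rmorph_sum.
  under [RHS]eq_bigr => k _ do rewrite pderM rmorphD !rmorphM.
  rewrite big_split /= [X in _ = _ + X](bigID (fun k => es k == 1%N)) /=.
  rewrite [X in _ = _ + (_ + X)]big1 ?addr0 => [|k ek]; last by rewrite pv // mul0r.
  rewrite (_ : \sum_(k | es k == 1%N) _ = s * (j == i)%:R).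
    by rewrite s0 mul0r addr0; apply: eq_bigr => k _; rewrite !mxE.
  rewrite /s mulr_suml; apply: eq_bigr => k /eqP ek.
  by rewrite (ha k ek) pderZ pder_var rmorphM peval_cst rmorph_nat mulrA.
have : Y *m thetav \in unitmx by rewrite YM unitmxE det_scalar unitrX // unitfE.
by rewrite unitmx_mul => /andP[].
Qed.

Local Notation form := {ffun {set 'I_l} -> S^o}.
Local Notation gdf := (gdf P f).
Local Notation jac := (jac P f).
Implicit Types (a b : form) (p q : S) (i j k : 'I_l) (I J K : {set 'I_l}).

Lemma v_free g : g \in G :\ 1%g -> exists i, peval P v (x_ i - gact g (x_ i)) != 0.
Proof.
move=> /setD1P[g1 gG]; apply/existsP; rewrite -negb_forall; apply: contra g1.
move/forallP=> hg; apply/eqP/set1P; apply: (subsetP rG_faithful); apply/rkerP; split=> //.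
have E p : peval P v (gact g p) = peval P v p.
  rewrite /gact /pact peval_subst; apply: eq_peval => i.
  have := hg i; rewrite rmorphB subr_eq0 /= peval_var => /eqP ->.
  by rewrite gact_var.
have : thetav *m rG g = thetav.
  apply/matrixP=> k j; rewrite !mxE -[in RHS](theta_inv k gG) rmorph_sum.
  by apply: eq_bigr => s _; rewrite mxE rmorphM peval_cst E mulrC.
by move=> h; rewrite -(mulKmx thetav_unit (rG g)) h mulVmx // thetav_unit.
Qed.

Lemma span_at_v : exists G0, peval P v G0 != 0 /\ forall i, in_span gdf (G0 *: edx S i).
Proof.
have [|m [h1 h2]] := span_vars f_gen (phi := peval P v) _ v_free.
  by move=> N; rewrite pnatr_eq0.
by eexists; split; first exact: h1.
Qed.

Lemma oneform_df i : is_oneform (gdf i).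
Proof. exact: oneform_gdf. Qed.

Lemma jac_v : peval P v jac != 0.
Proof.
have [G0 [hG0 /jac_dvd_span[s hs]]] := span_at_v.
apply: contraNneq hG0 => j0; have /eqP := congr1 (peval P v) hs.
by rewrite rmorphM rmorphXn j0 mul0r expf_eq0 => /andP[].
Qed.

Lemma jac0 : jac != 0.
Proof. by apply: contraNneq jac_v => ->; rewrite rmorph0. Qed.

Lemma lincomb_edxE (u : 'I_l -> S) i : lincomb (edx S (l := l)) u [set i] = u i.
Proof.
rewrite /lincomb sum_ffunE (bigD1 i) //= big1 ?addr0 => [|j ji].
  by rewrite formZE ebasisE eqxx mulr1.
by rewrite formZE ebasisE (inj_eq set1_inj) eq_sym (negPf ji) mulr0.
Qed.

(* Cramer's rule for the Jacobian matrix, with a multiplier [G0] that may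
   differ from the Jacobian but does not vanish at [v]. *)
Lemma jacobian_inv : exists (G0 : S) (Y : 'I_l -> 'I_l -> S),
  [/\ peval P v G0 != 0, forall i, G0 *: edx S i = lincomb gdf (Y i) &
      forall i s, \sum_j Y i j * d_ s (f j) = (s == i)%:R * G0].
Proof.
have [G0 [hG0 hs]] := span_at_v.
have [Y hY] : exists Y : 'I_l -> 'I_l -> S, forall i, G0 *: edx S i = lincomb gdf (Y i).
  exact: (fin_all_exists (P := fun i u => G0 *: edx S i = lincomb gdf u)).
exists G0, Y; split=> // i s.
have := congr1 (fun a : form => a [set s]) (hY i).
rewrite formZE ebasisE (inj_eq set1_inj) mulrC => ->.
rewrite /lincomb sum_ffunE; apply: eq_bigr => j _.
by rewrite formZE lincomb_edxE.
Qed.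

Lemma jacobian_free (u : 'I_l -> S) :
  (forall j, \sum_i u i * d_ i (f j) = 0) -> forall i, u i = 0.
Proof.
move=> hu i; have [G0 [Y [hG0 _ hY]]] := jacobian_inv.
have G00 : G0 != 0 by apply: contraNneq hG0 => ->; rewrite rmorph0.
apply: (mulIf G00); rewrite mul0r.
transitivity (\sum_s u s * \sum_j Y i j * d_ s (f j)).
  rewrite (bigD1 i) //= [X in _ + X]big1 ?addr0 => [|s /negPf si]; first by rewrite hY eqxx mul1r.
  by rewrite hY si mul0r mulr0.
under eq_bigr => s _ do rewrite mulr_sumr.
rewrite exchange_big big1 // => j _ /=; under eq_bigr => s _ do rewrite mulrCA.
by rewrite -mulr_sumr hu mulr0.
Qed.

Definition jacv : 'M[C]_l := \matrix_(i, j) peval P v (d_ i (f j)).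

Lemma jacv_unit : jacv \in unitmx.
Proof.
have [G0 [Y [hG0 _ hY]]] := jacobian_inv.
have : jacv *m (\matrix_(j, i) peval P v (Y i j)) \in unitmx.
  rewrite (_ : _ *m _ = (peval P v G0)%:M) ?unitmxE ?det_scalar ?unitrX ?unitfE //.
  apply/matrixP=> s i; rewrite !mxE -mulr_natl.
  rewrite -(rmorph_nat (peval P v)) -rmorphM -hY rmorph_sum.
  by apply: eq_bigr => j _; rewrite !mxE rmorphM mulrC.
by rewrite unitmx_mul => /andP[].
Qed.

Local Notation last_out := [set~ o].

Definition hat a : S := top (ewedge (ewedge_set gdf last_out) a).

Lemma hatZ p a : hat (p *: a) = p * hat a.
Proof. by rewrite /hat ewedgeZr topZ. Qed.

Lemma hat_sum (T : Type) (r : seq T) (Q : pred T) (F : T -> form) :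
  hat (\sum_(t <- r | Q t) F t) = \sum_(t <- r | Q t) hat (F t).
Proof. by rewrite /hat ewedge_sumr top_sum. Qed.

Lemma ewedge_set_last K : o \notin K ->
  ewedge (ewedge_set gdf K) (gdf o) = ewedge_set gdf (o |: K).
Proof.
move=> oK; rewrite -[gdf o](ewedge_set1 gdf) ewedge_set_mul //; last exact: oneform_df.
rewrite disjoint_sym disjoints1 oK inversionsr1 setUC (_ : [set _ in _ | _] = set0).
  by rewrite cards0 scale1r.
apply/setP=> j; rewrite inE in_set0; apply/negbTE; rewrite negb_and -leqNgt.
by rewrite [X in _ || X](leq_ord j) orbT.
Qed.

Lemma hat_df r : hat (gdf r) = (r == o)%:R * jac.
Proof.
rewrite /hat; have [->|ro] := eqVneq r o.
  rewrite ewedge_set_last ?inE ?eqxx // mul1r; congr (top (ewedge_set _ _)).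
  by apply/setP=> i; rewrite !inE; case: eqP.
rewrite -[gdf r](ewedge_set1 gdf) ewedge_set_mul; last exact: oneform_df.
by rewrite disjoint_sym disjoints1 !inE ro top0 mul0r.
Qed.

Lemma hat_lincomb (w : 'I_l -> form) (u : 'I_l -> S) :
  hat (lincomb w u) = \sum_i u i * hat (w i).
Proof. by rewrite hat_sum; apply: eq_bigr => i _; rewrite hatZ. Qed.

Lemma hat_pdiff p : hat (pdiff P p) = \sum_r d_ r p * hat (edx S r).
Proof. exact: hat_lincomb. Qed.

(* At [v], the vector field [hat] is proportional to the Euler field.         *)
Lemma hat_v i : h%:R * peval P v (hat (edx S i)) = peval P v jac * v i.
Proof.
pose u i := h%:R * peval P v (hat (edx S i)) - peval P v jac * v i.
have hu j : \sum_i u i * jacv i j = 0.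
  rewrite /u; under eq_bigr => s _ do rewrite mulrBl -!mulrA.
  rewrite sumrB -!mulr_sumr.
  have -> : \sum_s peval P v (hat (edx S s)) * jacv s j = (j == o)%:R * peval P v jac.
    rewrite -(rmorph_nat (peval P v)) -rmorphM -hat_df hat_pdiff rmorph_sum.
    by apply: eq_bigr => s _; rewrite rmorphM mxE mulrC.
  have -> : \sum_s v s * jacv s j = (d j)%:R * (j == o)%:R.
    by rewrite -fv -(peval_euler v (f_homog j)); apply: eq_bigr => s _; rewrite mxE.
  by case: eqP => [->|_]; rewrite ?(mul0r, mulr0) ?subrr //; ring.
have : (\row_i u i) *m jacv = 0.
  by apply/rowP=> j; rewrite !mxE -[RHS](hu j); apply: eq_bigr => s _; rewrite mxE.
move/(congr1 (mulmx^~ (invmx jacv))); rewrite mulmxK ?jacv_unit // mul0mx.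
by move/rowP/(_ i); rewrite !mxE => /eqP; rewrite subr_eq0 => /eqP.
Qed.

Lemma hat_pdiff_v m p : \sum_r v r * peval P v (d_ r p) = m * peval P v p ->
  h%:R * peval P v (hat (pdiff P p)) = peval P v jac * (m * peval P v p).
Proof.
move=> hp; rewrite hat_pdiff rmorph_sum mulr_sumr -hp mulr_sumr.
by apply: eq_bigr => r _; rewrite rmorphM mulrCA hat_v; ring.
Qed.

Local Notation e := (fun j : 'I_l => (d j).-1).

Lemma eact_df g j : g \in G -> eact P (rG g) (gdf j) = gdf j.
Proof. by move=> gG; rewrite eact_pdiff; congr pdiff; apply: f_ginv. Qed.

Lemma eact_df_set g K : g \in G ->
  eact P (rG g) (ewedge_set gdf K) = ewedge_set gdf K.
Proof.
by move=> gG; rewrite eact_wedge_set; apply: eq_ewedge_set => j _; apply: eact_df.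
Qed.

Definition dtheta k : {ffun 'I_l -> form} := [ffun i => pdiff P (theta k i)].

Definition theta_form k : {ffun 'I_l -> form} := [ffun i => theta k i *: eone S l].

Lemma dact_dtheta g k : g \in G -> dact P (rG g) (dtheta k) = dtheta k.
Proof.
move=> gG; apply/ffunP=> j; rewrite !ffunE -[in RHS](theta_inv k gG) pdiff_sum.
by apply: eq_bigr => s _; rewrite ffunE eact_pdiff pdiffZ.
Qed.

Lemma dact_theta g k : g \in G -> dact P (rG g) (theta_form k) = theta_form k.
Proof.
move=> gG; apply/ffunP=> j; rewrite !ffunE -[in RHS](theta_inv k gG) scaler_suml.
by apply: eq_bigr => s _; rewrite ffunE eactZ eact_one scalerA.
Qed.

Lemma pairing_invariant eta (w : 'I_l -> form) a :
  (forall g, g \in G -> dact P (rG g) eta = eta) ->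
  (forall g, g \in G -> coinvariant P (rG g) w) ->
  (forall g, g \in G -> eact P (rG g) a = a) ->
  exists2 q, ginv q & top (ewedge a (pairing eta w)) = jac * q.
Proof.
move=> heta hw ha; apply: top_invariant => // g gG.
by rewrite eact_wedge ha // eact_pairing ?heta ?repr_mx_unit //; apply: hw.
Qed.

Lemma pairing_der eta j K :
  (forall g, g \in G -> dact P (rG g) eta = eta) ->
  exists2 q, ginv q &
    \sum_i d_ i (f j) * top (ewedge (ewedge_set gdf K) (eta i)) = jac * q.
Proof.
move=> heta; have [|||q hq Eq] := @pairing_invariant eta
    (fun i => d_ i (f j) *: eone S l) (ewedge_set gdf K).
- by [].
- by move=> g gG; apply: coinvariant_pder; apply: f_ginv.
- by move=> g gG; apply: eact_df_set.
exists q => //; rewrite -Eq /pairing ewedge_sumr top_sum; apply: eq_bigr => i _.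
by rewrite ewedgeZr ewedge1r ewedgeZr topZ.
Qed.

Lemma pairing_hess eta j K :
  (forall g, g \in G -> dact P (rG g) eta = eta) ->
  exists2 q, ginv q &
    \sum_i top (ewedge (ewedge (ewedge_set gdf K) (eta i)) (pdiff P (d_ i (f j)))) = jac * q.
Proof.
move=> heta; have [|||q hq Eq] := @pairing_invariant eta
    (fun i => pdiff P (d_ i (f j))) (ewedge_set gdf K).
- by [].
- by move=> g gG; apply: coinvariant_pdiff; apply: f_ginv.
- by move=> g gG; apply: eact_df_set.
exists q => //; rewrite -Eq /pairing ewedge_sumr top_sum; apply: eq_bigr => i _.
by rewrite ewedgeA.
Qed.

Lemma scaling_pact_inv p : scaling P 2 p = pact P (2^-1)%:M p.
Proof.
apply: eq_psubst => i; rewrite invmx_scalar invrK (bigD1 i) //= big1 ?addr0 => [|j ji].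
  by rewrite mxE eqxx mulr1n.
by rewrite mxE (negPf ji) mulr0n rmorph0 mul0r.
Qed.

Local Notation sact := (eact P (2^-1)%:M).

Lemma sact_pdiff m p : scaling P 2 p = k_ (2 ^+ m) * p ->
  sact (pdiff P p) = k_ (2 ^+ m) *: pdiff P p.
Proof. by move=> hp; rewrite eact_pdiff -scaling_pact_inv hp pdiffZ. Qed.

Lemma sact_df_set K : sact (ewedge_set gdf K) = k_ (2 ^+ (\sum_(j in K) d j)) *: ewedge_set gdf K.
Proof.
rewrite eact_wedge_set expr_sum rmorph_prod -ewedge_setZ; apply: eq_ewedge_set => j _.
by apply: sact_pdiff; have [] := f_homog j.
Qed.

Lemma scaling_pder m i p : (0 < m)%N -> scaling P 2 p = k_ (2 ^+ m) * p ->
  scaling P 2 (d_ i p) = k_ (2 ^+ m.-1) * d_ i p.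
Proof.
move=> m0 hp; have k2 : k_ 2 != 0 by rewrite fmorph_eq0 pnatr_eq0.
apply: (mulfI k2); rewrite -pder_scaling hp pderZ mulrA -rmorphM -exprS prednK //.
Qed.

Lemma scaling_quotient a (q : S) m : hat a = jac * q ->
  sact a = k_ (2 ^+ m) *: a -> k_ (2 ^+ h) * scaling P 2 q = k_ (2 ^+ m) * q.
Proof.
move=> ha hm; pose kappa := top (sact (ebasis S setT)).
pose m0 := (\sum_(j in last_out) d j)%N.
have m0h : (\sum_(j in setT) d j = h + m0)%N.
  by rewrite (bigD1 o) ?inE //=; congr addn; apply: eq_bigl => j; rewrite !inE.
have H1 : scaling P 2 jac * kappa = k_ (2 ^+ (h + m0)) * jac.
  rewrite scaling_pact_inv -top_eact sact_df_set topZ -m0h.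
  by [].
have H2 : scaling P 2 (jac * q) * kappa = k_ (2 ^+ m0) * (k_ (2 ^+ m) * (jac * q)).
  rewrite -ha scaling_pact_inv /hat -top_eact eact_wedge sact_df_set hm.
  by rewrite ewedgeZl ewedgeZr !topZ.
have c0 : k_ (2 ^+ m0) * jac != 0.
  by rewrite mulf_neq0 ?jac0 // fmorph_eq0 expf_neq0 // pnatr_eq0.
apply: (mulfI c0); move: H2; rewrite rmorphM mulrAC H1 exprD rmorphM => H2.
transitivity (k_ (2 ^+ h) * k_ (2 ^+ m0) * jac * scaling P 2 q); first by ring.
by rewrite H2; ring.
Qed.

Hypothesis es_sum : (\sum_k es k + \sum_j e j = l * h)%N.

(* The determinant is an invariant of degree 0, hence a constant.             *)
Lemma ginv_matrix_inv (N : 'M[S]_l) :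
  (forall k j, ginv (N k j)) ->
  (forall k j, k_ (2 ^+ h) * scaling P 2 (N k j) = k_ (2 ^+ (es k + e j)) * N k j) ->
  map_mx (peval P v) N \in unitmx ->
  exists N' : 'M[S]_l, [/\ forall k j, ginv (N' k j), N *m N' = 1%:M & N' *m N = 1%:M].
Proof.
move=> hN hs hv.
have detN : scaling P 2 (\det N) = \det N.
  have E : k_ (2 ^+ h) *: map_mx (scaling P 2) N =
      diag_mx (\row_k k_ (2 ^+ es k)) *m N *m diag_mx (\row_j k_ (2 ^+ e j)).
    apply/matrixP=> k j; rewrite mul_mx_diag mul_diag_mx !mxE hs exprD rmorphM.
    by ring.
  have := congr1 determinant E; rewrite detZ !det_mulmx !det_diag -det_map_mx.
  under eq_bigr => k _ do rewrite mxE.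
  under [X in _ = _ * X]eq_bigr => k _ do rewrite mxE.
  rewrite -!rmorph_prod -!expr_sum -rmorphXn -exprM mulrAC -rmorphM -exprD es_sum mulnC.
  apply: mulfI; by rewrite fmorph_eq0 expf_neq0 // pnatr_eq0.
have [c0 hc0] : exists c0, \det N = k_ c0 by eexists; apply: (scaling_cst detN).
have c00 : c0 != 0.
  by move: hv; rewrite unitmxE det_map_mx hc0 peval_cst unitfE.
exists (k_ c0^-1 *: \adj N); split.
- move=> k j g gG; have E : map_mx (gact g) N = N.
    by apply/matrixP=> s t; rewrite mxE hN.
  by rewrite mxE rmorphM gact_cst -[in RHS]E -map_mx_adj [in RHS]mxE.
- by rewrite -scalemxAr mul_mx_adj hc0 scale_scalar_mx -rmorphM mulVf // rmorph1.
- by rewrite -scalemxAl mul_adj_mx hc0 scale_scalar_mx -rmorphM mulVf // rmorph1.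
Qed.

Lemma der_matrix : exists B B' : 'M[S]_l,
  [/\ forall k j, \sum_i hat (pdiff P (theta k i)) * d_ i (f j) = jac * B k j,
      forall k j, ginv (B' k j), B *m B' = 1%:M & B' *m B = 1%:M].
Proof.
have [B hB] : exists B : 'I_l -> 'I_l -> S, forall k j, ginv (B k j) /\
    \sum_i hat (pdiff P (theta k i)) * d_ i (f j) = jac * B k j.
  refine (@fin_all_exists_pair 'I_l 'I_l S (fun k j (b : S) => ginv b /\
    \sum_i hat (pdiff P (theta k i)) * d_ i (f j) = jac * b) _) => k j.
  have [|q hq Eq] := @pairing_der (dtheta k) j last_out.
    by move=> g gG; apply: dact_dtheta.
  exists q; split=> //; rewrite -Eq; apply: eq_bigr => i _.
  by rewrite mulrC ffunE.
pose N : 'M[S]_l := \matrix_(k, j) B k j.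
have [|||N' [h1 h2 h3]] := @ginv_matrix_inv N.
- by move=> k j; rewrite mxE; have [] := hB k j.
- move=> k j; rewrite mxE; have [_ E] := hB k j.
  apply: (@scaling_quotient (\sum_i d_ i (f j) *: pdiff P (theta k i))).
    by rewrite -E hat_sum; apply: eq_bigr => i _; rewrite hatZ mulrC.
  rewrite eact_sum scaler_sumr; apply: eq_bigr => i _; rewrite eactZ -scaling_pact_inv.
  rewrite (@scaling_pder (d j)) ?d_gt0 //; last by have [] := f_homog j.
  rewrite (@sact_pdiff (es k)); last by have [] := theta_homog k i.
  by rewrite !scalerA exprD rmorphM; congr (_ *: _); ring.
- have -> : map_mx (peval P v) N = h%:R^-1 *: (diag_mx (\row_k (es k)%:R) *m thetav *m jacv).
    have h0 : h%:R != 0 :> C by rewrite pnatr_eq0 -lt0n.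
    apply/matrixP=> k j; apply: (mulfI h0); apply: (mulfI jac_v).
    rewrite !mxE mulVKf // mulrCA -rmorphM; have [_ <-] := hB k j.
    rewrite rmorph_sum !mulr_sumr; apply: eq_bigr => i _.
    rewrite rmorphM mulrA (hat_pdiff_v (peval_euler v (theta_homog k i))).
    by rewrite mul_diag_mx !mxE; ring.
  rewrite unitmxZ ?unitfE ?invr_eq0 ?pnatr_eq0 -?lt0n // !unitmx_mul thetav_unit jacv_unit !andbT.
  rewrite unitmxE det_diag unitfE; apply/prodf_neq0 => k _.
  by rewrite mxE pnatr_eq0 -lt0n.
by exists N, N'; split=> // k j; have [_] := hB k j; rewrite mxE.
Qed.

Lemma hess_matrix : exists B B' : 'M[S]_l,
  [/\ forall k j, \sum_i theta k i * hat (pdiff P (d_ i (f j))) = jac * B k j,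
      forall k j, ginv (B' k j), B *m B' = 1%:M & B' *m B = 1%:M].
Proof.
have [B hB] : exists B : 'I_l -> 'I_l -> S, forall k j, ginv (B k j) /\
    \sum_i theta k i * hat (pdiff P (d_ i (f j))) = jac * B k j.
  refine (@fin_all_exists_pair 'I_l 'I_l S (fun k j (b : S) => ginv b /\
    \sum_i theta k i * hat (pdiff P (d_ i (f j))) = jac * b) _) => k j.
  have [|q hq Eq] := @pairing_hess (theta_form k) j last_out.
    by move=> g gG; apply: dact_theta.
  exists q; split=> //; rewrite -Eq; apply: eq_bigr => i _.
  by rewrite ffunE ewedgeZr ewedge1r ewedgeZl topZ.
pose N : 'M[S]_l := \matrix_(k, j) B k j.
have [|||N' [h1 h2 h3]] := @ginv_matrix_inv N.
- by move=> k j; rewrite mxE; have [] := hB k j.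
- move=> k j; rewrite mxE; have [_ E] := hB k j.
  apply: (@scaling_quotient (\sum_i theta k i *: pdiff P (d_ i (f j)))).
    by rewrite -E hat_sum; apply: eq_bigr => i _; rewrite hatZ.
  rewrite eact_sum scaler_sumr; apply: eq_bigr => i _; rewrite eactZ -scaling_pact_inv.
  rewrite (@sact_pdiff (d j).-1); last first.
    by apply: scaling_pder => //; have [] := f_homog j.
  have [-> _] := theta_homog k i.
  by rewrite !scalerA exprD rmorphM; congr (_ *: _); ring.
- have -> : map_mx (peval P v) N = h%:R^-1 *: (thetav *m jacv *m diag_mx (\row_j (e j)%:R)).
    have h0 : h%:R != 0 :> C by rewrite pnatr_eq0 -lt0n.
    apply/matrixP=> k j; apply: (mulfI h0); apply: (mulfI jac_v).
    rewrite mul_mx_diag !mxE mulVKf // mulrCA -rmorphM; have [_ <-] := hB k j.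
    rewrite rmorph_sum mulr_sumr mulr_suml mulr_sumr; apply: eq_bigr => i _.
    have fj : phomog P (d j).-1.+1 (f j) by rewrite prednK.
    rewrite rmorphM mulrCA (hat_pdiff_v (peval_euler_der v i fj)).
    by rewrite !mxE; ring.
  rewrite unitmxZ ?unitfE ?invr_eq0 ?pnatr_eq0 -?lt0n // !unitmx_mul thetav_unit jacv_unit /=.
  rewrite unitmxE det_diag unitfE; apply/prodf_neq0 => j _.
  by rewrite mxE pnatr_eq0; have := d_gt0 j; have := d_neq1 j; case: (d j) => [|[]].
by exists N, N'; split=> // k j; have [_] := hB k j; rewrite mxE.
Qed.

Local Notation dform := {ffun 'I_l -> form}.

Definition topdf K a : S := top (ewedge (ewedge_set gdf K) a).

Lemma topdfB K a b : topdf K (a - b) = topdf K a - topdf K b.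
Proof. by rewrite /topdf ewedgeDr ewedgeNr topD topN. Qed.

Lemma topdfZ K p a : topdf K (p *: a) = p * topdf K a.
Proof. by rewrite /topdf ewedgeZr topZ. Qed.

Lemma topdf_sum K (T : Type) (r : seq T) (Q : pred T) (F : T -> form) :
  topdf K (\sum_(t <- r | Q t) F t) = \sum_(t <- r | Q t) topdf K (F t).
Proof. by rewrite /topdf ewedge_sumr top_sum. Qed.

Definition co K : {set 'I_l} := ~: (o |: K).

Lemma notin_co K : o \notin co K.
Proof. by rewrite !inE eqxx. Qed.

Lemma coK K : o \notin K -> co (co K) = K.
Proof.
move=> oK; apply/setP=> i; rewrite !inE negb_or negbK andb_orr andNb /=.
by case: eqP => // ->; rewrite (negPf oK).
Qed.

Lemma sum_co (F : {set 'I_l} -> S) K :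
  \sum_(I : {set 'I_l} | o \notin I) (I == co K)%:R * F I = F (co K).
Proof.
rewrite (bigD1 (co K)) ?notin_co //= eqxx mul1r big1 ?addr0 // => I /andP[_ /negPf->].
by rewrite mul0r.
Qed.

Lemma topdf_df K I : o \notin I ->
  topdf (o |: K) (ewedge_set gdf I) =
  (I == co K)%:R * ((-1) ^+ inversions (o |: K) I * jac).
Proof.
move=> oI; rewrite /topdf ewedge_set_mul; last exact: oneform_df.
have [->|IK] := eqVneq I (co K).
  by rewrite -setI_eq0 setICr eqxx setUCr topZ mul1r.
rewrite mul0r; case: ifP => [dis|_]; last by rewrite top0.
rewrite topZ top_wedge_set ?mulr0 //; first exact: oneform_df.
apply: contra_neq IK => KI; apply/setP=> i; rewrite !inE -in_setU1.
have /setP/(_ i) := KI; rewrite inE [RHS]inE.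
by case: (boolP (i \in o |: K)) => [/(disjointFr dis) -> //|_ /= ->].
Qed.

Lemma topdf_df0 K I : o \notin K -> o \notin I -> topdf K (ewedge_set gdf I) = 0.
Proof.
move=> oK oI; rewrite /topdf ewedge_set_mul; last exact: oneform_df.
case: ifP => _; last by rewrite top0.
rewrite topZ top_wedge_set ?mulr0 //; first exact: oneform_df.
by apply/eqP => /setP/(_ o); rewrite !inE (negPf oK) (negPf oI).
Qed.

Lemma topdf_df_oneform K I a : o \notin K -> o \notin I -> is_oneform a ->
  topdf K (ewedge (ewedge_set gdf I) a) =
  (I == co K)%:R * ((-1) ^+ inversions K I * hat a).
Proof.
move=> oK oI ha; rewrite /topdf ewedgeA ewedge_set_mul; last exact: oneform_df.
have [->|IK] := eqVneq I (co K).
  have -> : K :|: co K = last_out.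
    apply/setP=> i; rewrite !inE negb_or; case: (boolP (i \in K)) => [iK|_] /=.
      by apply/esym; apply: contraNneq oK => <-.
    by rewrite andbT.
  have -> : [disjoint K & co K].
    by rewrite disjoints_subset; apply/subsetP=> i iK; rewrite !inE iK orbT.
  by rewrite ewedgeZl topZ mul1r.
rewrite mul0r; case: ifP => [dis|_]; last by rewrite ewedge0l top0.
rewrite ewedgeZl topZ (@top_degree _ _ (#|K :|: I| + 1)) ?mulr0 //.
  apply: form_degree_wedge; first by apply: form_degree_wedge_set; exact: oneform_df.
  exact: form_degree_oneform.
rewrite addn1 eqSS; apply: contra_neq IK => cKI.
have KI : K :|: I = last_out.
  apply/eqP; rewrite eqEcard cKI cardsC1 card_ord leqnn andbT.
  by apply/subsetP=> i; rewrite !inE; case: eqP => // ->; rewrite (negPf oK) (negPf oI).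
apply/setP=> i; have /setP/(_ i) := KI; rewrite !inE negb_or => <-.
by case: (boolP (i \in K)) => [/(disjointFr dis) -> //|_] /=; rewrite andbT.
Qed.

Lemma topdf_setU1 r K a : r \notin K ->
  topdf (r |: K) a = (-1) ^+ (n + inversions [set r] K) *
    top (ewedge (ewedge (ewedge_set gdf K) a) (gdf r)).
Proof.
move=> rK; rewrite top_oneformC; last exact: oneform_df.
rewrite ewedgeA -[X in ewedge (ewedge X _) _](ewedge_set1 gdf).
rewrite ewedge_set_mul ?disjoints1 ?rK; last exact: oneform_df.
by rewrite ewedgeZl topZ -/(topdf _ _) exprD -mulrA [X in _ = _ * X]mulrCA !signrMK.
Qed.

Lemma top_df_mem r K a : r \in K ->
  top (ewedge (ewedge (ewedge_set gdf K) a) (gdf r)) = 0.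
Proof.
move=> rK; rewrite top_oneformC; last exact: oneform_df.
rewrite ewedgeA -[X in ewedge (ewedge X _) _](ewedge_set1 gdf).
rewrite ewedge_set_mul ?disjoints1 ?rK; last exact: oneform_df.
by rewrite ewedge0l top0 mulr0.
Qed.

Definition theta_dtheta_form (s : 'I_l + 'I_l) : dform :=
  match s with inl k => theta_form k | inr k => dtheta k end.

Local Notation index := ({set 'I_l} * ('I_l + 'I_l))%type.

Definition basis_form (t : index) : dform :=
  [ffun i => ewedge (ewedge_set gdf t.1) (theta_dtheta_form t.2 i)].

Definition combination (c : index -> S) : dform :=
  \sum_(t : index | o \notin t.1) c t *: basis_form t.

Lemma combinationE c i : combination c i =
  \sum_(I : {set 'I_l} | o \notin I)
    (\sum_k (c (I, inl k) * theta k i)) *: ewedge_set gdf I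
  + \sum_(I : {set 'I_l} | o \notin I)
    \sum_k c (I, inr k) *: ewedge (ewedge_set gdf I) (pdiff P (theta k i)).
Proof.
rewrite /combination sum_ffunE.
under eq_bigr => t _ do rewrite ffunE [basis_form t i]ffunE.
transitivity (\sum_(I : {set 'I_l} | o \notin I) \sum_s
    c (I, s) *: ewedge (ewedge_set gdf I) (theta_dtheta_form s i)).
  by rewrite pair_big_dep /=; apply: eq_big => [[I s]|[I s] _] //=; rewrite andbT.
rewrite -big_split; apply: eq_bigr => I _ /=; rewrite big_sumType /=; congr (_ + _).
  rewrite scaler_suml; apply: eq_bigr => k _.
  by rewrite ffunE ewedgeZr ewedge1r scalerA.
by apply: eq_bigr => k _; rewrite ffunE.
Qed.

Lemma topdf_combination c K i : o \notin K ->
  topdf K (combination c i) = (-1) ^+ inversions K (co K) *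
    \sum_k c (co K, inr k) * hat (pdiff P (theta k i)).
Proof.
move=> oK; rewrite combinationE /topdf ewedgeDr topD -!/(topdf _ _) !topdf_sum.
rewrite [X in X + _]big1 ?add0r => [|I oI]; last by rewrite topdfZ topdf_df0 ?mulr0.
rewrite -(sum_co (fun I => (-1) ^+ inversions K I *
  \sum_k c (I, inr k) * hat (pdiff P (theta k i)))); apply: eq_bigr => I oI.
rewrite topdf_sum !mulr_sumr; apply: eq_bigr => k _.
rewrite topdfZ topdf_df_oneform //; first by ring.
by eexists.
Qed.

Lemma topdf_combination_last c K i : (forall I k, c (I, inr k) = 0) ->
  topdf (o |: K) (combination c i) = (-1) ^+ inversions (o |: K) (co K) *
    (jac * \sum_k c (co K, inl k) * theta k i).
Proof.
move=> hc; rewrite combinationE [X in _ + X]big1 ?addr0 => [|I _]; last first.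
  by apply: big1 => k _; rewrite hc scale0r.
rewrite topdf_sum -(sum_co (fun I => (-1) ^+ inversions (o |: K) I *
  (jac * \sum_k c (I, inl k) * theta k i))); apply: eq_bigr => I oI.
by rewrite topdfZ topdf_df //; ring.
Qed.

Lemma hess_free (u : 'I_l -> S) :
  (forall j, \sum_i u i * hat (pdiff P (d_ i (f j))) = 0) -> forall i, u i = 0.
Proof.
move=> hu; have [N [N' [hN _ hNN' _]]] := hess_matrix.
pose H : 'M[S]_l := \matrix_(i, j) hat (pdiff P (d_ i (f j))).
have hH : (\matrix_(k, i) theta k i) *m H = jac *: N.
  by apply/matrixP=> k j; rewrite !mxE -hN; apply: eq_bigr => i _; rewrite !mxE.
have dH : \det H != 0.
  have /eqP := congr1 determinant hH; rewrite det_mulmx detZ.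
  apply: contraTneq => ->; rewrite mulr0 eq_sym mulf_neq0 ?expf_neq0 ?jac0 //.
  have /(congr1 determinant) := hNN'; rewrite det_mulmx det1 => E.
  by apply/eqP => N0; move/eqP: E; rewrite N0 mul0r eq_sym oner_eq0.
have uH : (\row_i u i) *m H = 0.
  by apply/rowP=> j; rewrite !mxE -[RHS](hu j); apply: eq_bigr => i _; rewrite !mxE.
move=> i; have := congr1 (mulmx^~ (\adj H)) uH.
rewrite -mulmxA mul_mx_adj mul_mx_scalar mul0mx => /rowP/(_ i)/eqP.
by rewrite !mxE mulf_eq0 (negPf dH) => /eqP.
Qed.

Lemma der_cancel (u : 'I_l -> S) :
  (forall i, \sum_k u k * hat (pdiff P (theta k i)) = 0) -> forall k, u k = 0.
Proof.
move=> hu; have [N [N' [hN _ hNN' _]]] := der_matrix.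
have uN : (\row_k u k) *m N = 0.
  apply/rowP=> j; rewrite !mxE; apply: (mulfI jac0); rewrite mulr0.
  rewrite mulr_sumr (eq_bigr (fun k => u k *
    \sum_i hat (pdiff P (theta k i)) * d_ i (f j))) => [|k _]; last first.
    by rewrite mxE mulrCA -hN.
  under eq_bigr => k _ do rewrite mulr_sumr.
  rewrite exchange_big big1 // => i _ /=.
  by under eq_bigr => k _ do rewrite mulrA; rewrite -mulr_suml hu mul0r.
move=> k; have := congr1 (mulmx^~ N') uN.
by rewrite -mulmxA hNN' mulmx1 mul0mx => /rowP/(_ k); rewrite !mxE.
Qed.

Lemma theta_cancel (u : 'I_l -> S) :
  (forall i, \sum_k u k * theta k i = 0) -> forall k, u k = 0.
Proof.
move=> hu; have [N [N' [hN _ hNN' _]]] := hess_matrix.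
have uN : (\row_k u k) *m N = 0.
  apply/rowP=> j; rewrite !mxE; apply: (mulfI jac0); rewrite mulr0.
  rewrite mulr_sumr (eq_bigr (fun k => u k *
    \sum_i theta k i * hat (pdiff P (d_ i (f j))))) => [|k _]; last first.
    by rewrite mxE mulrCA -hN.
  under eq_bigr => k _ do rewrite mulr_sumr.
  rewrite exchange_big big1 // => i _ /=.
  by under eq_bigr => k _ do rewrite mulrA; rewrite -mulr_suml hu mul0r.
move=> k; have := congr1 (mulmx^~ N') uN.
by rewrite -mulmxA hNN' mulmx1 mul0mx => /rowP/(_ k); rewrite !mxE.
Qed.

Lemma combination_free c : combination c = 0 -> forall t : index, o \notin t.1 -> c t = 0.
Proof.
move=> hc; have hr I k : o \notin I -> c (I, inr k) = 0.
  move=> oI; rewrite -(coK oI).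
  apply: (der_cancel (u := fun k => c (co (co I), inr k))) => i.
  have := topdf_combination c i (notin_co I); rewrite hc ffunE /topdf ewedge0r top0.
  by move/esym/eqP; rewrite mulf_eq0 signr_eq0 => /eqP.
pose c' t := if t.2 is inl _ then c t else 0.
have hc' : combination c' = 0.
  rewrite -hc; apply: eq_bigr => -[I [k|k]] //= oI.
  by rewrite hr.
move=> [I [k|k]] /= oI; last exact: hr.
rewrite -(coK oI); apply: (theta_cancel (u := fun k => c (co (co I), inl k))) => i.
have := topdf_combination_last (c := c') (co I) i (fun _ _ => erefl).
rewrite hc' ffunE /topdf ewedge0r top0.
by move/esym/eqP; rewrite mulf_eq0 signr_eq0 mulf_eq0 (negPf jac0) => /eqP.
Qed.

Definition dinv (eta : dform) := forall g, g \in G -> dact P (rG g) eta = eta.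

Lemma dactB A (eta eta' : dform) : dact P A (eta - eta') = dact P A eta - dact P A eta'.
Proof.
apply/ffunP=> j; rewrite !ffunE -sumrB; apply: eq_bigr => k _.
by rewrite !ffunE eactD -scaleN1r eactZ rmorphN1 scaleN1r scalerBr.
Qed.

Lemma dactZ A p (eta : dform) : dact P A (p *: eta) = pact P A p *: dact P A eta.
Proof.
apply/ffunP=> j; rewrite !ffunE scaler_sumr; apply: eq_bigr => k _.
by rewrite ffunE eactZ !scalerA mulrC.
Qed.

Lemma dact_sum A (T : Type) (r : seq T) (Q : pred T) (F : T -> dform) :
  dact P A (\sum_(t <- r | Q t) F t) = \sum_(t <- r | Q t) dact P A (F t).
Proof.
apply: (big_morph (dact P A)) => [eta eta'|]; last first.
  by have := dactB A 0 0; rewrite !subrr.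
have := dactB A (eta + eta') eta'; rewrite addrK => ->; by rewrite subrK.
Qed.

Lemma dact_wedge A a (eta : dform) :
  dact P A [ffun i => ewedge a (eta i)] = [ffun i => ewedge (eact P A a) (dact P A eta i)].
Proof.
apply/ffunP=> j; rewrite !ffunE ewedge_sumr; apply: eq_bigr => k _.
by rewrite ffunE eact_wedge ewedgeZr.
Qed.

Lemma dinv_basis_form t : dinv (basis_form t).
Proof.
move=> g gG; rewrite dact_wedge eact_df_set //.
by congr finfun; apply/boolp.funext => i; case: (t.2) => k /=; rewrite ?dact_theta ?dact_dtheta.
Qed.

Lemma dinv_combination c : (forall t : index, o \notin t.1 -> ginv (c t)) -> dinv (combination c).
Proof.
move=> hc g gG; rewrite dact_sum; apply: eq_bigr => t ot.
rewrite dactZ dinv_basis_form //; congr (_ *: _); exact: hc.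
Qed.

Lemma ginvM p q : ginv p -> ginv q -> ginv (p * q).
Proof. by move=> hp hq g gG; rewrite rmorphM hp ?hq. Qed.

Lemma ginv_sign m : ginv ((-1) ^+ m).
Proof. by move=> g _; rewrite rmorphXn rmorphN1. Qed.

Lemma ginv_sumr (T : Type) (r : seq T) (Q : pred T) (F : T -> S) :
  (forall t, Q t -> ginv (F t)) -> ginv (\sum_(t <- r | Q t) F t).
Proof. by move=> h g gG; rewrite rmorph_sum; apply: eq_bigr => t /h ->. Qed.

Lemma ginv0 : ginv 0.
Proof. by move=> g _; rewrite rmorph0. Qed.

Lemma dtheta_part eta : dinv eta -> exists c : {set 'I_l} -> 'I_l -> S,
  (forall I k, ginv (c I k)) /\
  forall K i, o \notin K -> topdf K (eta i) = (-1) ^+ inversions K (co K) *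
    \sum_k c (co K) k * hat (pdiff P (theta k i)).
Proof.
move=> heta; have [N [N' [hN hN' _ N'N]]] := der_matrix.
have [a ha] : exists a : {set 'I_l} -> 'I_l -> S, forall K j, ginv (a K j) /\
    \sum_i d_ i (f j) * topdf K (eta i) = jac * a K j.
  refine (@fin_all_exists_pair {set 'I_l} 'I_l S (fun K j (b : S) => ginv b /\
    \sum_i d_ i (f j) * topdf K (eta i) = jac * b) _) => K j.
  by have [q hq Eq] := pairing_der j K heta; exists q.
exists (fun I k => (-1) ^+ inversions (co I) I * \sum_j a (co I) j * N' j k); split.
  move=> I k; apply: ginvM; first exact: ginv_sign.
  by apply: ginv_sumr => j _; apply: ginvM; first have [] := ha (co I) j.
move=> K i oK; apply/eqP; rewrite -subr_eq0; apply/eqP; move: i; apply: jacobian_free => j.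
rewrite (coK oK); under eq_bigr => i _ do rewrite mulrBl.
rewrite sumrB; apply/eqP; rewrite subr_eq0; apply/eqP.
transitivity (jac * a K j).
  by have [_ <-] := ha K j; apply: eq_bigr => i _; rewrite mulrC.
transitivity (\sum_k (\sum_s a K s * N' s k) *
    \sum_i hat (pdiff P (theta k i)) * d_ i (f j)); last first.
  under [RHS]eq_bigr => i _ do rewrite mulr_sumr mulr_suml.
  rewrite [RHS]exchange_big; apply: eq_bigr => k _; rewrite mulr_sumr.
  apply: eq_bigr => i _.
  by rewrite !mulrA -expr2 sqrr_sign mul1r.
under eq_bigr => k _ do rewrite hN mulr_suml.
rewrite exchange_big /=.
transitivity (\sum_s (jac * a K s) * (N' *m N) s j).
  rewrite N'N (bigD1 j) //= big1 ?addr0 => [|s /negPf sj]; first by rewrite mxE eqxx mulr1.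
  by rewrite mxE sj mulr0.
apply: eq_bigr => s _; rewrite mxE mulr_sumr; apply: eq_bigr => k _; by ring.
Qed.

Lemma top_oneform_last b a : (forall r, r != o -> top (ewedge b (gdf r)) = 0) ->
  is_oneform a -> jac * top (ewedge b a) = top (ewedge b (gdf o)) * hat a.
Proof.
move=> hb [u ->]; have [G0 [Y [hG0 hY _]]] := jacobian_inv.
have G00 : G0 != 0 by apply: contraNneq hG0 => ->; rewrite rmorph0.
have E i : jac * top (ewedge b (edx S i)) = top (ewedge b (gdf o)) * hat (edx S i).
  apply: (mulfI G00).
  transitivity (jac * top (ewedge b (G0 *: edx S i))).
    by rewrite ewedgeZr topZ mulrCA.
  transitivity (top (ewedge b (gdf o)) * hat (G0 *: edx S i)); last first.
    by rewrite hatZ mulrCA.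
  rewrite hY hat_lincomb /lincomb ewedge_sumr top_sum !mulr_sumr.
  apply: eq_bigr => j _; rewrite hat_df ewedgeZr topZ.
  have [->|jo] := eqVneq j o => /=; first by ring.
  by rewrite hb // mul0r !mulr0.
rewrite hat_lincomb /lincomb ewedge_sumr top_sum !mulr_sumr.
by apply: eq_bigr => i _; rewrite ewedgeZr topZ mulrCA E mulrCA.
Qed.

Lemma theta_part eta : dinv eta -> (forall K i, o \notin K -> topdf K (eta i) = 0) ->
  exists c : {set 'I_l} -> 'I_l -> S, (forall I k, ginv (c I k)) /\
  forall K i, o \notin K -> topdf (o |: K) (eta i) =
    (-1) ^+ inversions (o |: K) (co K) * (jac * \sum_k c (co K) k * theta k i).
Proof.
move=> heta h0; have [N [N' [hN hN' _ N'N]]] := hess_matrix.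
have [a ha] : exists a : {set 'I_l} -> 'I_l -> S, forall K j, ginv (a K j) /\
    \sum_i top (ewedge (ewedge (ewedge_set gdf K) (eta i)) (pdiff P (d_ i (f j))))
    = jac * a K j.
  refine (@fin_all_exists_pair {set 'I_l} 'I_l S (fun K j (b : S) => ginv b /\
    \sum_i top (ewedge (ewedge (ewedge_set gdf K) (eta i)) (pdiff P (d_ i (f j))))
    = jac * b) _) => K j.
  by have [q hq Eq] := pairing_hess j K heta; exists q.
pose sg I := (-1) ^+ inversions (o |: co I) I * (-1) ^+ (n + inversions [set o] (co I)) : S.
exists (fun I k => sg I * \sum_j a (co I) j * N' j k); split.
  move=> I k; apply: ginvM; first by apply: ginvM; apply: ginv_sign.
  by apply: ginv_sumr => j _; apply: ginvM; first have [] := ha (co I) j.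
move=> K i oK; rewrite topdf_setU1 // /sg (coK oK).
pose xi i := ewedge (ewedge_set gdf K) (eta i).
suff E : top (ewedge (xi i) (gdf o)) = jac * \sum_k (\sum_j a K j * N' j k) * theta k i.
  rewrite -/(xi i) E.
  under [X in _ = _ * (_ * X)]eq_bigr => k _ do rewrite -!mulrA.
  by rewrite -!mulr_sumr [LHS]mulrCA [RHS]mulrCA signrMK.
have hxi s r : r != o -> top (ewedge (xi s) (gdf r)) = 0.
  move=> ro; have [rK|rK] := boolP (r \in K); first exact: top_df_mem.
  have := topdf_setU1 (eta s) rK; rewrite h0 ?in_setU1 ?negb_or 1?eq_sym ?ro //.
  by move/esym/eqP; rewrite mulf_eq0 signr_eq0 => /eqP.
apply/eqP; rewrite -subr_eq0; apply/eqP; move: i; apply: hess_free => j.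
under eq_bigr => i _ do rewrite mulrBl.
rewrite sumrB; apply/eqP; rewrite subr_eq0; apply/eqP.
transitivity (jac * (jac * a K j)).
  have [_ <-] := ha K j; rewrite mulr_sumr; apply: eq_bigr => i _.
  rewrite top_oneform_last //; first exact: hxi.
  by eexists.
transitivity (jac * \sum_k (\sum_s a K s * N' s k) *
    \sum_i theta k i * hat (pdiff P (d_ i (f j)))); last first.
  under [RHS]eq_bigr => i _ do rewrite -mulrA mulr_suml.
  rewrite -mulr_sumr exchange_big; congr (_ * _); apply: eq_bigr => k _; rewrite mulr_sumr.
  by apply: eq_bigr => i _; rewrite mulrA.
congr (_ * _); under eq_bigr => k _ do rewrite hN mulr_suml.
rewrite exchange_big /=.
transitivity (\sum_s (jac * a K s) * (N' *m N) s j).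
  rewrite N'N (bigD1 j) //= big1 ?addr0 => [|s /negPf sj]; first by rewrite mxE eqxx mulr1.
  by rewrite mxE sj mulr0.
apply: eq_bigr => s _; rewrite mxE mulr_sumr; apply: eq_bigr => k _; by ring.
Qed.

Theorem dinv_combinationP eta : dinv eta <-> exists c : index -> S,
  (forall t : index, o \notin t.1 -> ginv (c t)) /\ eta = combination c.
Proof.
split=> [heta|[c [hc ->]]]; last exact: dinv_combination.
have [c' [hc' E']] := dtheta_part heta.
pose c1 (t : index) := if t.2 is inr k then c' t.1 k else 0.
have ic1 t : ginv (c1 t) by case: t => I [k|k]; [apply: ginv0 | apply: hc'].
pose eta1 := eta - combination c1.
have heta1 : dinv eta1.
  by move=> g gG; rewrite dactB heta // dinv_combination.
have h1 K i : o \notin K -> topdf K (eta1 i) = 0.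
  by move=> oK; rewrite !ffunE topdfB topdf_combination // E' // subrr.
have [c [hc E]] := theta_part heta1 h1.
pose c2 (t : index) := if t.2 is inl k then c t.1 k else 0.
have ic2 t : ginv (c2 t) by case: t => I [k|k]; [apply: hc | apply: ginv0].
have h2 i : eta1 i = combination c2 i.
  apply/eqP; rewrite -subr_eq0; apply/eqP.
  have [G0 [Y [hG0 hY _]]] := jacobian_inv.
  apply: (@ewedge_set_eq0 _ _ gdf G0).
  - exact: oneform_df.
  - by apply: contraNneq hG0 => ->; rewrite rmorph0.
  - by move=> s; exists (Y s); apply: hY.
  move=> K; rewrite -/(topdf _ _) topdfB; have [oK|oK] := boolP (o \in K); last first.
    by rewrite h1 // topdf_combination // big1 ?mulr0 ?subrr // => k _; rewrite mul0r.
  rewrite -(setD1K oK) E ?in_setD1 ?eqxx // topdf_combination_last ?subrr //.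
exists (fun t => c1 t + c2 t); split.
  by move=> t _ g gG; rewrite rmorphD ic1 ?ic2.
apply/ffunP=> i; have := h2 i; rewrite !ffunE => /eqP; rewrite subr_eq => /eqP ->.
rewrite /combination !sum_ffunE -big_split; apply: eq_bigr => t _.
by rewrite !ffunE scalerDl addrC.
Qed.

Definition dfspan a := exists c : {set 'I_l} -> S,
  (forall I, o \notin I -> ginv (c I)) /\
  a = \sum_(I : {set 'I_l} | o \notin I) c I *: ewedge_set gdf I.

Lemma dfspan_df_set p I : ginv p -> o \notin I -> dfspan (p *: ewedge_set gdf I).
Proof.
move=> hp oI; exists (fun J => if J == I then p else 0); split=> [J _|].
  by case: eqP => _ //; apply: ginv0.
rewrite (bigD1 I) //= eqxx big1 ?addr0 // => J /andP[_ /negPf ->].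
by rewrite scale0r.
Qed.

Lemma dfspanD a b : dfspan a -> dfspan b -> dfspan (a + b).
Proof.
move=> [c [hc ->]] [c' [hc' ->]]; exists (fun I => c I + c' I); split.
  by move=> I oI g gG; rewrite rmorphD hc ?hc'.
by rewrite -big_split; apply: eq_bigr => I _ /=; rewrite scalerDl.
Qed.

Lemma dfspan0 : dfspan 0.
Proof.
exists (fun=> 0); split=> [I _|]; first exact: ginv0.
by rewrite big1 // => I _; rewrite scale0r.
Qed.

Lemma dfspan_sum (T : Type) (r : seq T) (Q : pred T) (F : T -> form) :
  (forall t, Q t -> dfspan (F t)) -> dfspan (\sum_(t <- r | Q t) F t).
Proof. by move=> h; apply: big_ind => //; [apply: dfspan0 | apply: dfspanD]. Qed.

Lemma dfspanM a b : dfspan a -> dfspan b -> dfspan (ewedge a b).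
Proof.
move=> [c [hc ->]] [c' [hc' ->]]; rewrite ewedge_suml; apply: dfspan_sum => I oI.
rewrite ewedge_sumr; apply: dfspan_sum => J oJ.
rewrite ewedgeZl ewedgeZr ewedge_set_mul; last exact: oneform_df.
case: ifP => _; last by rewrite !scaler0; apply: dfspan0.
rewrite !scalerA; apply: dfspan_df_set; last by rewrite inE negb_or oI.
by do 2?apply: ginvM; [apply: hc | apply: hc' | apply: ginv_sign].
Qed.

Lemma dfspan_one p : ginv p -> dfspan (p *: eone S l).
Proof. by move=> hp; rewrite -(ewedge_set0 gdf); apply: dfspan_df_set; rewrite ?inE. Qed.

Lemma ginv1 : ginv 1.
Proof. by move=> g _; rewrite rmorph1. Qed.

Lemma dfspan_df i : i != o -> dfspan (gdf i).
Proof.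
move=> io; rewrite -(ewedge_set1 gdf i) -[ewedge_set _ _]scale1r.
by apply: dfspan_df_set; [apply: ginv1 | rewrite inE eq_sym].
Qed.

Lemma df_free (c : {set 'I_l} -> S) :
  \sum_(I : {set 'I_l} | o \notin I) c I *: ewedge_set gdf I = 0 ->
  forall I, o \notin I -> c I = 0.
Proof.
move=> hc I oI; have /(congr1 (topdf (o |: co I))) := hc; rewrite topdf_sum.
under eq_bigr => J oJ do rewrite topdfZ topdf_df // mulrCA.
rewrite (sum_co (fun J => c J * ((-1) ^+ inversions (o |: co I) J * jac))) coK //.
rewrite /topdf ewedge0r top0 => /eqP.
by rewrite !mulf_eq0 signr_eq0 (negPf jac0) !orbF => /eqP.
Qed.

Lemma combination_wedge (c : index -> S) : combination c =
  \sum_s [ffun i => ewedge (\sum_(I : {set 'I_l} | o \notin I) c (I, s) *: ewedge_set gdf I)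
                           (theta_dtheta_form s i)].
Proof.
apply/ffunP=> i; rewrite /combination !sum_ffunE.
transitivity (\sum_(I : {set 'I_l} | o \notin I) \sum_s
    c (I, s) *: ewedge (ewedge_set gdf I) (theta_dtheta_form s i)).
  rewrite pair_big_dep /=; apply: eq_big => [[I s]|[I s] _] //=; first by rewrite andbT.
  by rewrite !ffunE.
rewrite exchange_big; apply: eq_bigr => s _; rewrite ffunE ewedge_suml.
by apply: eq_bigr => I _; rewrite ewedgeZl.
Qed.

Lemma dinv_module : is_free_basis (fun a (eta : dform) => [ffun i => ewedge a (eta i)])
  dfspan dinv predT theta_dtheta_form.
Proof.
split=> [eta|A hA].
  split=> [/dinv_combinationP[c [hc ->]]|[A [hA ->]]].
    exists (fun s => \sum_(I : {set 'I_l} | o \notin I) c (I, s) *: ewedge_set gdf I).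
    split; last exact: combination_wedge.
    move=> s _; exists (fun I => c (I, s)); split=> // I oI; exact: hc.
  have [c hc] := fin_all_exists (fun s => hA s isT).
  apply/dinv_combinationP; exists (fun t => c t.2 t.1); split.
    by move=> t ot; have [h _] := hc t.2; apply: h.
  rewrite combination_wedge; apply: eq_bigr => s _; congr finfun; apply/boolp.funext => i.
  by have [_ ->] := hc s.
have [c hc] := fin_all_exists (fun s => hA s isT).
have E : \sum_s [ffun i => ewedge (A s) (theta_dtheta_form s i)] =
    combination (fun t => c t.2 t.1).
  rewrite combination_wedge; apply: eq_bigr => s _; congr finfun; apply/boolp.funext => i.
  by have [_ ->] := hc s.
rewrite E => /combination_free c0 s _; have [_ ->] := hc s.
by apply: big1 => I oI; rewrite (c0 (I, s)) // scale0r.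
Qed.

Definition degree_index (m : nat) (t : index) : bool :=
  (o \notin t.1) && (if t.2 is inl _ then #|t.1| == m else #|t.1|.+1 == m).

Lemma dformZE p (eta : dform) i J : (p *: eta) i J = p * eta i J.
Proof. by rewrite ffunE formZE. Qed.

Lemma basis_form_degree (t : index) i :
  form_degree (if t.2 is inl _ then #|t.1| else #|t.1|.+1) (basis_form t i).
Proof.
have hI : form_degree #|t.1| (ewedge_set gdf t.1).
  by apply: form_degree_wedge_set; exact: oneform_df.
rewrite ffunE; case: (t.2) => k; rewrite ffunE.
  by rewrite ewedgeZr ewedge1r; apply: form_degreeZ.
rewrite -(addn1 #|t.1|); apply: form_degree_wedge => //.
by apply: form_degree_oneform; eexists.
Qed.

Lemma degree_combination m (c : index -> S) i J :
  (\sum_(t | degree_index m t) c t *: basis_form t) i J =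
  if #|J| == m then combination c i J else 0.
Proof.
rewrite /combination !sum_ffunE; case: ifP => [/eqP cJ|/negbT cJ].
  rewrite [RHS](bigID (degree_index m)) /= [X in _ + X]big1 ?addr0 => [|t].
    by apply: eq_bigl => t; rewrite /degree_index andbA andbb.
  rewrite /degree_index => /andP[-> /= ht]; rewrite dformZE.
  rewrite (basis_form_degree (t := t)) ?mulr0 // cJ eq_sym.
  by move: ht; case: (t.2).
apply: big1 => t; rewrite /degree_index => /andP[_ ht]; rewrite dformZE.
rewrite (basis_form_degree (t := t)) ?mulr0 //; move: ht.
by case: (t.2) => k /eqP ->.
Qed.

Lemma dinv_degree m : is_free_basis *:%R ginv
  (fun eta : dform => (forall i, form_degree m (eta i)) /\ dinv eta)
  (degree_index m) basis_form.
Proof.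
split=> [eta|c hc].
  split=> [[hm /dinv_combinationP[c [hc Ec]]]|[c [hc ->]]].
    exists c; split; first by move=> t /andP[ot _]; apply: hc.
    apply/ffunP=> i; apply/ffunP=> J; rewrite degree_combination -Ec.
    by case: ifP => // /negbT cJ; rewrite hm.
  split=> [i J cJ|]; first by rewrite degree_combination (negPf cJ).
  pose c' t := if degree_index m t then c t else 0.
  have -> : \sum_(t | degree_index m t) c t *: basis_form t = combination c'.
    rewrite /combination [RHS](bigID (degree_index m)) /= [X in _ + X]big1 ?addr0.
      apply: eq_big => t; first by rewrite /degree_index andbA andbb.
      by rewrite /c' => ->.
    by move=> t /andP[_ /negPf ht]; rewrite /c' ht scale0r.
  apply: dinv_combination => t _; rewrite /c'.
  by case: ifP => [/hc //|_]; apply: ginv0.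
move=> h0; pose c' t := if degree_index m t then c t else 0.
have E : combination c' = 0.
  rewrite -h0 /combination [LHS](bigID (degree_index m)) /= [X in _ + X]big1 ?addr0.
    apply: eq_big => t; first by rewrite /degree_index andbA andbb.
    by rewrite /c' => /andP[_ ->].
  by move=> t /andP[_ /negPf ht]; rewrite /c' ht scale0r.
move=> t ht; have := combination_free E (t := t).
by rewrite /c' ht; apply; case/andP: ht.
Qed.

Lemma df_module : is_free_basis *:%R ginv dfspan
  (fun I : {set 'I_l} => o \notin I) (ewedge_set gdf).
Proof. by split=> [a|c _ /df_free h I oI]; last exact: h. Qed.

Lemma dfspan_min (Q : form -> Prop) :
  (forall p, ginv p -> Q (p *: eone S l)) -> (forall i, i != o -> Q (gdf i)) ->
  (forall a b, Q a -> Q b -> Q (a + b)) -> (forall a b, Q a -> Q b -> Q (ewedge a b)) ->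
  forall a, dfspan a -> Q a.
Proof.
move=> Qs Qg QD QM _ [c [hc ->]].
have Q0 : Q 0 by rewrite -(scale0r (eone S l)); apply/Qs/ginv0.
have Q1 : Q (eone S l) by rewrite -[eone S l]scale1r; apply/Qs/ginv1.
apply: big_ind => // I oI; rewrite -[ewedge_set _ _]ewedge1l -ewedgeZl.
apply: (QM); first exact/Qs/hc.
rewrite /ewedge_set; apply: big_ind => [|a b|i iI]; [exact: Q1|exact: (QM)|apply: Qg].
by apply: contraNneq oI => <-.
Qed.

Lemma pdiff_scalar p : \sum_(I : {set 'I_l}) \sum_i
  d_ i ((p *: eone S l) I) *: ewedge (edx S i) (ebasis S I) = pdiff P p.
Proof.
rewrite (bigD1 set0) //= [X in _ + X]big1 ?addr0 => [|I /negPf I0].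
  by apply: eq_bigr => i _; rewrite formZE ebasisE eqxx mulr1 ewedge1r.
by apply: big1 => i _; rewrite formZE ebasisE I0 mulr0 pder0 scale0r.
Qed.
End Duality.

(** * The polynomial ring *)

Section MPolyInstance.
Variables (C : numClosedFieldType) (l : nat).
Local Notation S := {mpoly C[l]}.
Implicit Types (p q : S) (i j : 'I_l) (c : C) (m : 'X_{1..l}).
Implicit Types (t : 'I_l -> S) (v : 'I_l -> C).

Local Opaque mpoly_scale mpoly_opp mpoly_add mpoly_mul.

Lemma mpoly_ring_ind (Q : S -> Prop) :
  (forall c, Q c%:MP) -> (forall i, Q 'X_i) ->
  (forall p q, Q p -> Q q -> Q (p + q)) ->
  (forall p q, Q p -> Q q -> Q (p * q)) -> forall p, Q p.
Proof.
move=> hC hX hD hM; elim/mpolyind => [|c m p _ _ hp].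
  by rewrite -mpolyC0.
apply: hD => //; rewrite -mul_mpolyC; apply: (hM) => //.
rewrite mpolyXE_id; apply: big_ind => //.
- by rewrite -mpolyC1.
- move=> i _; elim: (m i) => [|k IH]; first by rewrite expr0 -mpolyC1.
  by rewrite exprS; apply: hM.
Qed.

Definition mpoly_subst t : {rmorphism S -> S} := comp_mpoly [tuple t i | i < l].

Definition mpoly_eval v : {rmorphism S -> C} := meval v.

Definition mpoly_const : {rmorphism C -> S} := @mpolyC l C.

Lemma mpoly_subst_cst t c : mpoly_subst t (mpoly_const c) = mpoly_const c.
Proof. exact: comp_mpolyC. Qed.

Lemma mpoly_subst_var t i : mpoly_subst t 'X_i = t i.
Proof. by apply: etrans (comp_mpolyXU _ _) _; rewrite -tnth_nth tnth_mktuple. Qed.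

Lemma mpoly_der_var i j : mderiv i ('X_j : S) = (i == j)%:R.
Proof.
rewrite mderivX mnm1E eq_sym; case: eqP => [->|_]; last by rewrite scale0r.
suff -> : (U_(j) - U_(j) = 0 :> 'X_{1..l})%MM by rewrite mpolyX0 scale1r.
by apply/mnmP=> k; rewrite mnmBE mnm0E subnn.
Qed.

Lemma mpoly_scale_monomial c m :
  mpoly_subst (fun i => mpoly_const c * 'X_i) 'X_[m] = c ^+ mdeg m *: 'X_[m].
Proof.
apply: etrans (comp_mpolyX _ _) _.
transitivity (\prod_(i < l) ((c ^+ m i)%:MP * 'X_i ^+ m i : S)).
  apply: eq_bigr => i _; rewrite tnth_mktuple exprMn; congr (_ * _).
  by rewrite (rmorphXn (@mpolyC l C)).
rewrite big_split /= -mpolyXE_id -mul_mpolyC; congr (_ * _).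
rewrite -[RHS]/((c ^+ mdeg m)%:MP) mdegE -prodrXr.
by apply/esym; apply: (rmorph_prod (@mpolyC l C)).
Qed.

Lemma mpoly_subst_sum c p : mpoly_subst (fun i => mpoly_const c * 'X_i) p =
  \sum_(m <- msupp p) (p@_m * c ^+ mdeg m) *: 'X_[m].
Proof.
rewrite {1}[p]mpolyE rmorph_sum; apply: eq_bigr => m _.
apply: etrans (comp_mpolyZ _ _ _) _.
by rewrite [X in _ *: X]mpoly_scale_monomial scalerA.
Qed.

Lemma mcoeff_subst c p m :
  (mpoly_subst (fun i => mpoly_const c * 'X_i) p)@_m = p@_m * c ^+ mdeg m.
Proof.
rewrite mpoly_subst_sum raddf_sum /=.
have [mp|mp] := boolP (m \in msupp p).
  rewrite (bigD1_seq m) ?msupp_uniq //= mcoeffZ mcoeffX eqxx mulr1.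
  by rewrite big1 ?addr0 // => m' /negPf mm'; rewrite mcoeffZ mcoeffX mm' mulr0.
rewrite (memN_msupp_eq0 mp) mul0r big_seq big1 // => m' mp'.
rewrite mcoeffZ mcoeffX; case: eqP => [E|_]; last by rewrite mulr0.
by rewrite -E mp' in mp.
Qed.

Lemma mpoly_scaling_cst p :
  mpoly_subst (fun i => mpoly_const 2 * 'X_i) p = p ->
  p = mpoly_const (mpoly_eval (fun=> 0) p).
Proof.
move=> hp; have E : p = (p@_0%MM)%:MP.
  apply/mpolyP => m; rewrite mcoeffC.
  have [<-|m0] := eqVneq 0%MM m; first by rewrite mulr1.
  rewrite mulr0; have := mcoeff_subst 2 p m; rewrite hp.
  rewrite -[X in X = _]mulr1 => /eqP; rewrite -subr_eq0 -mulrBr mulf_eq0.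
  case/orP=> [/eqP //|]; rewrite subr_eq0 eq_sym pexpr_eq1 ?ler0n //; last first.
    by rewrite lt0n mdeg_eq0 eq_sym.
  by rewrite (eqr_nat C 2 1).
by rewrite [in RHS]E [X in mpoly_const X](mevalC _ _).
Qed.

Definition mpoly_poly_alg : poly_alg C l S :=
  @PolyAlg C l S mpoly_const (fun i => 'X_i) (@mderiv l C) mpoly_subst mpoly_eval
    mpoly_ring_ind (@mderivD l C) (@mderivM l C) (@mderivC l C) mpoly_der_var
    mpoly_subst_cst mpoly_subst_var (fun v => @mevalC l C v) (fun v => @mevalXU l C v)
    mpoly_scaling_cst.

Lemma mpoly_euler_monomial m : \sum_i 'X_i * mderiv i 'X_[m] = (mdeg m)%:R *: 'X_[m] :> S.
Proof.
rewrite mdegE natr_sum scaler_suml; apply: eq_bigr => i _.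
rewrite mderivX -scalerAr -mpolyXD.
have [->|mi] := eqVneq (m i) 0%N; first by rewrite !scale0r.
suff -> : (U_(i) + (m - U_(i)) = m)%MM by [].
by rewrite addmC submK // lep1mP.
Qed.

Lemma dhomog_phomog d p : p \is d.-homog -> phomog mpoly_poly_alg d p.
Proof.
move=> /dhomogP hp; split=> [c|].
  apply: etrans (mpoly_subst_sum c p) _.
  rewrite {3}[p]mpolyE mulr_sumr big_seq [RHS]big_seq; apply: eq_bigr => m /hp hm.
  by rewrite hm; apply/esym; apply: etrans (mul_mpolyC _ _) _; rewrite scalerA mulrC.
transitivity (\sum_(m <- msupp p) p@_m *: (\sum_i 'X_i * mderiv i 'X_[m]) : S).
  under [RHS]eq_bigr => m _ do rewrite scaler_sumr.
  rewrite exchange_big; apply: eq_bigr => i _.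
  rewrite {1}[p]mpolyE /= raddf_sum mulr_sumr; apply: eq_bigr => m _.
  by rewrite [X in _ * X = _](mderivZ _ _ _) -scalerAr.
rewrite {3}[p]mpolyE mulr_sumr big_seq [RHS]big_seq; apply: eq_bigr => m /hp hm.
rewrite mpoly_euler_monomial hm; apply/esym; apply: etrans (mul_mpolyC _ _) _.
by rewrite !scalerA mulrC.
Qed.

Lemma mpoly_pactE (A : 'M[C]_l) p : pact mpoly_poly_alg A p =
  p \mPo [tuple \sum_j invmx A j i *: 'X_j | i < l].
Proof.
suff E : [tuple \sum_j mpoly_const (invmx A j i) * 'X_j | i < l] =
    [tuple \sum_j invmx A j i *: ('X_j : S) | i < l].
  by rewrite -E.
apply: eq_from_tnth => i; rewrite !tnth_mktuple; apply: eq_bigr => j _.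
exact: mul_mpolyC.
Qed.

Lemma mpoly_substE (f : l.-tuple S) p : psubst mpoly_poly_alg (tnth f) p = p \mPo f.
Proof.
suff E : [tuple tnth f i | i < l] = f by rewrite -[in RHS]E.
by apply: eq_from_tnth => i; rewrite tnth_mktuple.
Qed.

End MPolyInstance.

Section Bridge.
Variables (R : realType) (l : nat).
Local Notation S := (Spoly R l).
Local Notation P := (mpoly_poly_alg R[i] l).
Implicit Types (A : 'M[R[i]]_l) (p q : S) (a b : form R l).

Lemma act_polyE A p : act_poly A p = pact P A p.
Proof. exact: esym (mpoly_pactE A p). Qed.

Lemma comp_mpolyE (f : l.-tuple S) q : q \mPo f = psubst P (tnth f) q.
Proof. exact: esym (mpoly_substE f q). Qed.

Lemma wedgeE : @wedge R l = @ewedge S l.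
Proof. by change (@wedge R l = @wedge R l); reflexivity. Qed.

Lemma wedge_setE : @wedge_set R l = @ewedge_set S l.
Proof. by change (@wedge_set R l = @wedge_set R l); reflexivity. Qed.

Lemma diffE : @diff R l = pdiff P.
Proof. by change (@diff R l = @diff R l); reflexivity. Qed.

Lemma act_formE A a : act_form A a = eact P A a.
Proof.
change (act_form A a = \sum_I pact P A (a I) *: wedge_set (act_dx A) I).
by apply: eq_bigr => I _; rewrite act_polyE; reflexivity.
Qed.

Lemma act_dformE A (eta : dform R l) : act_dform A eta = dact P A eta.
Proof.
change (act_dform A eta = [ffun j => \sum_k (A k j)%:MP *: eact P A (eta k)]).
apply/ffunP=> j; rewrite /act_dform [LHS]ffunE [RHS]ffunE.
by apply: eq_bigr => k _; rewrite act_formE; reflexivity.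
Qed.

End Bridge.

Lemma is_free_basis_ext (A M : zmodType) (scale : A -> M -> M) (P P' : A -> Prop)
    (N N' : M -> Prop) (I : finType) (D D' : pred I) (b b' : I -> M) :
  (forall x, P x <-> P' x) -> (forall m, N m <-> N' m) -> D =1 D' -> b =1 b' ->
  is_free_basis scale P N D b -> is_free_basis scale P' N' D' b'.
Proof.
move=> hP hN hD hb [h1 h2].
have hs c : \sum_(i | D i) scale (c i) (b i) = \sum_(i | D' i) scale (c i) (b' i).
  by apply: eq_big => // i _; rewrite hb.
split=> [m|c hc h0 i Di].
  split=> [/hN/h1[c [hc ->]]|[c [hc ->]]].
    by exists c; rewrite hs; split=> // i; rewrite -hD => /hc/hP.
  by apply/hN/h1; exists c; rewrite hs; split=> // i; rewrite hD => /hc/hP.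
by apply: (h2 c) => //; rewrite ?hs ?hD // => j; rewrite hD => /hc/hP.
Qed.

Lemma phomog_gt0 (C : numClosedFieldType) (l : nat) (S : idomainType)
  (P : poly_alg C l S) (f : 'I_l -> S) i m :
  (forall q, psubst P f q = 0 -> q = 0) -> phomog P m (f i) -> (0 < m)%N.
Proof.
move=> f_indep [hs _]; rewrite lt0n; apply/eqP => m0.
have /scaling_cst E : psubst P (fun i => pcst P 2 * pvar P i) (f i) = f i.
  by rewrite [LHS]hs m0 expr0 rmorph1 mul1r.
pose c := peval P (fun=> 0) (f i).
have /f_indep/(congr1 (peval P (fun=> c + 1)))/eqP : psubst P f (pvar P i - pcst P c) = 0.
  by rewrite rmorphB /= psubst_var psubst_cst {1}E subrr.
by rewrite rmorphB /= peval_var peval_cst rmorph0 addrC addKr oner_eq0.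
Qed.

Section Bridge.
Variables (R : realType) (n : nat) (gT : finGroupType) (G : {group gT}).
Local Notation l := n.+1.
Local Notation S := (Spoly R l).
Local Notation P := (mpoly_poly_alg R[i] l).
Variable rG : mx_representation R[i] G l.
Variables (f : l.-tuple S) (theta : 'I_l -> derivation R l) (coexp : 'I_l -> nat).
Implicit Types (A : 'M[R[i]]_l) (p q : S) (a b : form R l).

Definition theta_coef (k i : 'I_l) : S := theta k i.

Lemma inv_polyE p : inv_poly rG p <-> ginv P rG p.
Proof. by split=> h g gG; have := h g gG; rewrite act_polyE. Qed.

Lemma act_derE A (t : derivation R l) j :
  act_der A t j = \sum_k pcst P (A k j) * pact P A (t k).
Proof.
change (act_der A t j = \sum_k (A k j)%:MP * pact P A (t k)).
by rewrite ffunE; apply: eq_bigr => k _; rewrite act_polyE; reflexivity.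
Qed.

Lemma inv_derE (t : derivation R l) : inv_der rG t <-> gder_inv P rG (fun i => t i).
Proof.
split=> h g gG.
  by move=> j; have /ffunP/(_ j) := h g gG; rewrite act_derE.
by apply/ffunP=> j; rewrite act_derE; exact: (h g gG j).
Qed.

Lemma sum_derE (c : 'I_l -> S) i :
  (\sum_k c k *: theta k) i = \sum_k c k * theta_coef k i :> S.
Proof.
change ((\sum_k c k *: theta k) i = \sum_k (c k *: theta k i) :> S).
by rewrite sum_ffunE; apply: eq_bigr => k _; rewrite ffunE; reflexivity.
Qed.

Lemma inv_dformE (eta : dform R l) : inv_dform rG eta <-> dinv P rG eta.
Proof. by split=> h g gG; have := h g gG; rewrite act_dformE. Qed.

Lemma df_setE : df_set f =1 ewedge_set (gdf P (tnth f)).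
Proof.
by rewrite /df_set wedge_setE => I; congr (ewedge_set _ I); rewrite /df diffE.
Qed.

Lemma der_dformE (t : derivation R l) k : der_dform t k = (t k : S) *: ext_one R l.
Proof. by rewrite ffunE. Qed.

Lemma diff_dformE (eta : dform R l) k : diff_dform eta k =
  \sum_(I : {set 'I_l}) \sum_i (eta k I : S)^`M(i) *: wedge (dx R i) (ext_basis R I).
Proof. by rewrite ffunE. Qed.

Lemma wedge_dformE a (eta : dform R l) i : wedge_dform a eta i = wedge a (eta i).
Proof. by rewrite ffunE. Qed.

Lemma theta_dthetaE k : theta_dtheta theta k = theta_dtheta_form P theta_coef k.
Proof.
case: k => k; apply/ffunP=> i.
  rewrite [RHS]ffunE.
  change (der_dform (theta k) i = theta_coef k i *: ext_one R l).
  exact: der_dformE.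
change (diff_dform (der_dform (theta k)) i = dtheta P theta_coef k i).
rewrite [RHS]ffunE diff_dformE der_dformE.
have := pdiff_scalar P (theta_coef k i); set rhs := pdiff P _ => <-.
by match goal with |- ?x = ?y => change (y = y) end; reflexivity.
Qed.

Lemma df_thetaE t : df_theta f theta t = basis_form P (tnth f) theta_coef t.
Proof.
apply/ffunP=> i; apply: etrans (wedge_dformE _ _ _) _.
by rewrite [RHS]ffunE wedgeE theta_dthetaE df_setE; reflexivity.
Qed.

Lemma subalgebraE a : subalgebra (inv_poly rG) (df_butlast f) a <-> dfspan P rG (tnth f) a.
Proof.
split=> [|h].
  elim=> [p /inv_polyE hp|_ [i io ->]|x y _ hx _ hy|x y _ hx _ hy].
  - exact: (dfspan_one (tnth f) hp).
  - exact: (dfspan_df P rG (tnth f) io).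
  - exact: (dfspanD hx hy).
  - rewrite wedgeE; exact: (dfspanM hx hy).
refine (@dfspan_min _ _ _ P _ _ rG (tnth f)
  (subalgebra (inv_poly rG) (df_butlast f)) _ _ _ _ a h).
- move=> p hp; exact: (subalgebra_scalar _ (proj2 (inv_polyE p) hp)).
- move=> i io; exact: (subalgebra_gen _ (ex_intro2 _ _ i io erefl)).
- move=> x y hx hy; exact: (subalgebra_add hx hy).
- move=> x y hx hy; exact: (subalgebra_mul hx hy).
Qed.

Lemma dform_degreeE m (eta : dform R l) :
  dform_degree m eta <-> forall i, form_degree m (eta i).
Proof. by split=> h k I cI; exact: h. Qed.

Local Notation d := (fun i => mpdeg (tnth f i)).

Hypothesis Hrefl : reflection_group rG.
Hypothesis Hinv : basic_invariants rG f.
Hypothesis Hder : basic_derivations rG theta coexp.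
Hypothesis Hdual : duality_group rG f coexp.

Lemma inv_gen p : ginv P rG p <-> exists q, p = psubst P (tnth f) q.
Proof.
have [_ _ _ hf] := Hinv; rewrite -inv_polyE; apply: (iff_trans (hf p)).
split=> -[q ->]; exists q; first exact: comp_mpolyE.
exact: esym (comp_mpolyE f q).
Qed.

Lemma inv_indep q : psubst P (tnth f) q = 0 -> q = 0.
Proof. by have [_ _ hf _] := Hinv; rewrite -comp_mpolyE => /hf. Qed.

Lemma inv_homog i : phomog P (d i) (tnth f i).
Proof. by have [hf _ _ _] := Hinv; apply: dhomog_phomog. Qed.

Lemma der_homog k i : phomog P (coexp k) (theta_coef k i).
Proof. by have [_ h] := Hder; exact: (dhomog_phomog (h k i)). Qed.

Lemma der_inv k : gder_inv P rG (theta_coef k).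
Proof.
have [[h _] _] := Hder; apply/inv_derE/h.
exists (fun j => (j == k)%:R); split=> [j _|].
  by case: eqP => _ g _; rewrite act_polyE ?rmorph1 ?rmorph0.
rewrite (bigD1 k) //= eqxx scale1r big1 ?addr0 // => j /negPf ->.
by rewrite scale0r.
Qed.

Lemma der_gen (t : 'I_l -> S) : gder_inv P rG t ->
  exists c : 'I_l -> S, (forall k, ginv P rG (c k)) /\
    forall i, t i = \sum_k c k * theta_coef k i.
Proof.
move=> ht; have [[h _] _] := Hder.
have /h[c [hc Ec]] : inv_der rG ([ffun i => t i] : derivation R l).
  apply/inv_derE => g gG j; rewrite ffunE -[RHS](ht g gG j).
  by apply: eq_bigr => k _; rewrite ffunE.
exists c; split=> [k|i]; first exact: (proj1 (inv_polyE (c k)) (hc k isT)).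
by have /ffunP/(_ i) := Ec; rewrite ffunE sum_derE.
Qed.

Lemma der_free (c : 'I_l -> S) : (forall k, ginv P rG (c k)) ->
  (forall i, \sum_k c k * theta_coef k i = 0) -> forall k, c k = 0.
Proof.
move=> hc h0 k; have [[_ h] _] := Hder; apply: (h c) => // [j _|].
  exact: (proj2 (inv_polyE (c j)) (hc j)).
by apply/ffunP=> i; rewrite sum_derE h0 ffunE.
Qed.

Lemma deg_gt0 i : (0 < d i)%N.
Proof. exact: (phomog_gt0 inv_indep (inv_homog i)). Qed.

Lemma deg_le i : (d i <= d ord_max)%N.
Proof. by have [_ h _ _] := Hinv; apply: h; exact: leq_ord. Qed.

Lemma exponent_coexp : exists2 s : seq nat, perm_eq s (codom coexp) &
  forall i : 'I_l, ((d i).-1 + nth 0 s i)%N = d ord_max.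
Proof.
have [_ h] := Hdual; exists (sort geq (codom coexp)); last exact: h.
by rewrite perm_sort.
Qed.

Lemma coexp_bounds k : (0 < coexp k <= d ord_max)%N.
Proof.
have [s hs h] := exponent_coexp.
have sl : size s = l by rewrite (perm_size hs) size_codom card_ord.
have : coexp k \in s by rewrite (perm_mem hs) codom_f.
case/(nthP 0%N) => j js <-; rewrite sl in js.
have := h (Ordinal js); have := deg_gt0 (Ordinal js); have := deg_le (Ordinal js).
by rewrite /=; lia.
Qed.

Lemma sum_coexp : (\sum_k coexp k + \sum_i (d i).-1 = l * d ord_max)%N.
Proof.
have [s hs h] := exponent_coexp.
have sl : size s = l by rewrite (perm_size hs) size_codom card_ord.
have -> : (\sum_k coexp k)%N = (\sum_(i < l) nth 0 s i)%N.
  transitivity (\sum_(x <- s) x)%N; first by rewrite (perm_big _ hs) /= big_image.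
  by rewrite (big_nth 0%N) sl big_mkord.
rewrite addnC -big_split /= (eq_bigr (fun=> d ord_max)) => [|i _]; last exact: h.
by rewrite sum_nat_const card_ord.
Qed.

Theorem duality_modules :
  [/\ is_free_basis *:%R (inv_poly rG)
        (subalgebra (inv_poly rG) (df_butlast f))
        (fun I : {set 'I_n.+1} => ord_max \notin I) (df_set f),
      is_free_basis (@wedge_dform R n.+1)
        (subalgebra (inv_poly rG) (df_butlast f))
        (inv_dform rG) predT (theta_dtheta theta)
    & forall m : nat, (m <= n.+1)%N ->
        is_free_basis *:%R (inv_poly rG)
          (fun eta => dform_degree m eta /\ inv_dform rG eta)
          (in_degree m) (df_theta f theta)].
Proof.
have [v hv] := exists_point inv_gen inv_indep (fun j => (j == ord_max)%:R).
have faithful : mx_faithful rG by have [] := Hrefl.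
have irr : mx_irreducible rG by have [] := Hdual.
have es0 k : (0 < coexp k)%N by have /andP[] := coexp_bounds k.
have esh k : (coexp k <= d ord_max)%N by have /andP[] := coexp_bounds k.
have hP p : ginv P rG p <-> inv_poly rG p by apply: iff_sym; exact: inv_polyE.
have hR a : dfspan P rG (tnth f) a <-> subalgebra (inv_poly rG) (df_butlast f) a.
  by apply: iff_sym; exact: subalgebraE.
split=> [||m _].
- have H := df_module faithful irr inv_gen inv_homog
    der_homog der_inv der_gen der_free deg_gt0 es0 esh hv.
  have E := is_free_basis_ext hP hR (fun=> erefl) (fun I => esym (df_setE I)) H.
  exact: E.
- have H := dinv_module faithful irr inv_gen inv_indep inv_homog
    der_homog der_inv der_gen der_free deg_gt0 es0 esh hv sum_coexp.
  have hN eta : dinv P rG eta <-> inv_dform rG eta by apply: iff_sym; exact: inv_dformE.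
  have E := is_free_basis_ext hR hN (fun=> erefl) (fun k => esym (theta_dthetaE k)) H.
  exact: E.
- have H := dinv_degree faithful irr inv_gen inv_indep inv_homog
    der_homog der_inv der_gen der_free deg_gt0 es0 esh hv sum_coexp m.
  have hN (eta : dform R l) : (forall i, form_degree m (eta i)) /\ dinv P rG eta <->
      dform_degree m eta /\ inv_dform rG eta.
    split=> -[h1 h2]; split; [exact: (proj2 (dform_degreeE m eta) h1) |
      exact: (proj2 (inv_dformE eta) h2) | exact: (proj1 (dform_degreeE m eta) h1) |
      exact: (proj1 (inv_dformE eta) h2)].
  have E := is_free_basis_ext hP hN (fun=> erefl) (fun t => esym (df_thetaE t)) H.
  exact: E.
Qed.

End Bridge.

Theorem theorem1p1 (R : realType) (n : nat) (gT : finGroupType)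
  (G : {group gT}) (rG : mx_representation R[i] G n.+1)
  (f : n.+1.-tuple {mpoly R[i][n.+1]})
  (theta : 'I_n.+1 -> derivation R n.+1) (coexp : 'I_n.+1 -> nat) :
  reflection_group rG ->
  basic_invariants rG f ->
  basic_derivations rG theta coexp ->
  duality_group rG f coexp ->
  [/\ (* R is the exterior algebra over S^W on df_1, ..., df_(l-1) *)
      is_free_basis *:%R (inv_poly rG)
        (subalgebra (inv_poly rG) (df_butlast f))
        (fun I : {set 'I_n.+1} => ord_max \notin I) (df_set f),
      is_free_basis (@wedge_dform R n.+1)
        (subalgebra (inv_poly rG) (df_butlast f))
        (inv_dform rG) predT (theta_dtheta theta)
    & forall m : nat, (m <= n.+1)%N ->
        is_free_basis *:%R (inv_poly rG)
          (fun eta => dform_degree m eta /\ inv_dform rG eta)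
          (in_degree m) (df_theta f theta)].
Proof. exact: duality_modules. Qed.
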